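(* Let $\mathcal T_h$ be an admissible adjusted cut mesh and let $h$ be sufficiently small. Assume that the active tetrahedra form a conforming tetrahedral complex covering the closed surface $\Gamma$. Then the local maps $\Phi_T:\Gamma_h\cap T\to\Gamma\cap T$ agree pointwise on common faces (that is, if cut tetrahedra $T^+$ and $T^-$ share a cut face $\mathcal F$, then $\Phi_{T^+}=\Phi_{T^-}$ on $\Gamma_h\cap\mathcal F$) and define a continuous bijection $$\Phi_h:\Gamma_h\longrightarrow\Gamma .$$ In particular, $\Phi_h$ is a homeomorphism and, for every polynomial degree $r\ge 1$, $S_{h,r}^l\subset H^1(\Gamma)$.
   Context: Setting. $U\subset\mathbb R^3$ is a fixed polygonal (polyhedral) bulk domain, $\Gamma=\{x\in U:F(x)=0\}$ is a smooth closed connected surface, $F\in C^{m+2}(U)$ with $m\ge 1$, and $\nabla F\neq 0$ on a tubular neighborhood of $\Gamma$. $d$ is the signed distance function to $\Gamma$. $\mathcal T_h$ is a tetrahedral mesh with mesh size $h=\max_{T\in\mathcal T_h}\operatorname{diam}(T)$; one considers a family of such meshes as $h\to0$, with all constants independent of $h$ and of the particular cut tetrahedron. Admissible adjusted cut mesh: for all sufficiently small $h$, (i) $\mathcal T_h$ is uniformly shape regular; (ii) no vertex lies on $\Gamma$, and every vertex $A$ of a cut tetrahedron satisfies $|d(A)|\ge\eta h$ for a fixed $\eta>0$; (iii) if $A_i,A_j$ are two vertices of a tetrahedron then $|d(A_i)|-|d(A_j)|=O(h^2)$. A cut (active) tetrahedron is one that is intersected by $\Gamma$. For $h$ small every cut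 tetrahedron $T=\operatorname{conv}\{x_0,x_1,x_2,x_3\}$ is of one of two types. Three-edge cut: exactly one vertex, say $x_0$, has a sign of $F$ different from the other three. Let $B_i$ be the unique intersection of $\Gamma$ with the edge $x_0x_i$, $i=1,2,3$. The linear patch is $\Gamma_h\cap T=K_h=\operatorname{conv}\{B_1,B_2,B_3\}$, and for $X\in K_h$, $\Phi_T(X)$ is the unique point of $\Gamma$ in $T$ on the ray starting at $x_0$ and passing through $X$. Four-edge cut: after relabeling, $F(x_0),F(x_2)>0$ and $F(x_1),F(x_3)<0$. Put $M(u)=(1-u)x_0+ux_2$, $N(v)=(1-v)x_1+vx_3$ for $0\le u,v\le1$. For each $(u,v)\in[0,1]^2$ there is a unique $w(u,v)\in(0,1)$ with $Y(u,v)=(1-w(u,v))M(u)+w(u,v)N(v)\in\Gamma$. Let $P_{ij}$ be the zero of $F$ on the edge $x_ix_j$. The linear patch is $\Gamma_h\cap T=K_{1,h}\cup K_{2,h}$ with $K_{1,h}=\triangle P_{01}P_{12}P_{30}$, $K_{2,h}=\triangle P_{12}P_{23}P_{30}$. For $X\in K_{1,h}\cup K_{2,h}$ with barycentric coordinates $(\alpha,\beta,\gamma,\delta)$ relative to $(x_0,x_1,x_2,x_3)$ put $u(X)=\gamma/(\alpha+\gamma)$, $v(X)=\delta/(\beta+\delta)$ and $\Phi_T(X)=Y(u(X),v(X))$. $\Gamma_h$ is the union of all these linear triangles over all cut tetrahedra, $\mathcal K_h$ is the resulting surface triangulation, and $\Phi_h|_{\Gamma_h\cap T}=\Phi_T$.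 The finite element space is $S_h^r=\{\phi_h\in C^0(\Gamma_h):\phi_h|_K\in\mathbb P_r(K)\ \forall K\in\mathcal K_h\}$ and the lifted space is $S_{h,r}^l=\{\phi_h^l:\Gamma\to\mathbb R:\ \phi_h^l(\Phi_h(X))=\phi_h(X)\ \forall X\in\Gamma_h,\ \phi_h\in S_h^r\}$. *)

(* Defs.v *)
From HB Require Import structures.
From mathcomp Require Import all_boot all_order all_algebra.
From mathcomp Require Import all_fingroup.
From mathcomp Require Import all_classical all_reals all_analysis.

Set Implicit Arguments.
Unset Strict Implicit.
Unset Printing Implicit Defensive.

Import Order.TTheory GRing.Theory Num.Theory.
Import numFieldNormedType.Exports.

Local Open Scope classical_set_scope.
Local Open Scope ring_scope.

(* R^3 is 'rV[R]_3; its library norm is the sup norm, so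
   the Euclidean norm, used for all distances and diameters, is defined here. *)

Section Calculus.
Context {R : realType}.

(* f is of class C^k on the open set A: k-fold Frechet differentiable with all
   iterated directional derivatives continuous. *)
Fixpoint Ck {V W : normedModType R} (k : nat) (A : set V) (f : V -> W) : Prop :=
  if k is k'.+1 then
    (forall x, A x -> differentiable f x) /\
    (forall v : V, Ck k' A (fun x => 'D_v f x))
  else forall x, A x -> {for x, continuous f}.

Definition grad (F : 'rV[R]_3 -> R) (x : 'rV[R]_3) : 'rV[R]_3 :=
  \row_i 'D_(delta_mx 0 i) F x.

Definition enorm (x : 'rV[R]_3) : R := Num.sqrt (\sum_i x 0 i ^+ 2).

Definition dist_to (A : set 'rV[R]_3) (x : 'rV[R]_3) : R :=
  inf [set enorm (x - a) | a in A].

Definition diam (A : set 'rV[R]_3) : R :=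
  sup [set e | exists x y, [/\ A x, A y & e = enorm (x - y)]].

End Calculus.

Section Simplices.
Context {R : realType}.

Definition hull_on n (p : 'I_n -> 'rV[R]_3) (A : {set 'I_n}) : set 'rV[R]_3 :=
  [set x | exists l : 'I_n -> R,
    [/\ forall i, 0 <= l i, forall i, i \notin A -> l i = 0,
        \sum_i l i = 1 & x = \sum_i l i *: p i]].

Definition hull n (p : 'I_n -> 'rV[R]_3) : set 'rV[R]_3 := hull_on p [set: 'I_n].

Definition triangle (a b c : 'rV[R]_3) : set 'rV[R]_3 :=
  hull (fun i : 'I_3 => nth 0 [:: a; b; c] i).

Definition segment (a b : 'rV[R]_3) : set 'rV[R]_3 :=
  [set x | exists t, 0 <= t <= 1 /\ x = (1 - t) *: a + t *: b].

(* An ordered list of four vertices; the tetrahedron itself is hull T. *)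
Definition tet : Type := {ffun 'I_4 -> 'rV[R]_3}.

Definition nondegenerate (T : tet) : Prop :=
  forall l : 'I_4 -> R,
    \sum_i l i = 0 -> \sum_i l i *: T i = 0 -> forall i, l i = 0.

Definition barycentric (T : tet) (x : 'rV[R]_3) : {ffun 'I_4 -> R} :=
  xget 0 [set l : {ffun 'I_4 -> R} |
            \sum_i l i = 1 /\ x = \sum_i l i *: T i].

Definition inradius (T : tet) : R :=
  sup [set r | 0 <= r /\
    exists c, forall y, enorm (y - c) <= r -> hull T y].

Definition relabel (T : tet) (s : {perm 'I_4}) : tet := [ffun i => T (s i)].

Definition polyhedral_domain (U : set 'rV[R]_3) : Prop :=
  [/\ open U, U !=set0, connected U, bounded_set U &
    exists s : seq tet, (forall T, T \in s -> nondegenerate T) /\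
      closure U = \bigcup_(T in [set` s]) hull T].

(* Possible hanging nodes are not excluded here: conformity is a separate
   hypothesis on the active tetrahedra only. *)
Definition tetrahedral_mesh (U : set 'rV[R]_3) (Th : seq tet) : Prop :=
  [/\ forall T, T \in Th -> nondegenerate T,
      closure U = \bigcup_(T in [set` Th]) hull T &
      forall T T', T \in Th -> T' \in Th -> T <> T' ->
        interior (hull T) `&` interior (hull T') = set0].

Definition mesh_size (Th : seq tet) : R :=
  \big[Num.max/0]_(T <- Th) diam (hull T).

Definition conforming_complex (Ts : set tet) : Prop :=
  forall T T', Ts T -> Ts T' -> exists A A' : {set 'I_4},
    hull T `&` hull T' = hull_on T A /\ hull T `&` hull T' = hull_on T' A'.

End Simplices.

Arguments tet R : clear implicits.

Section CutMesh.
Context {R : realType}.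
Variables (U : set 'rV[R]_3) (F : 'rV[R]_3 -> R).

Definition zero_set : set 'rV[R]_3 := [set x | U x /\ F x = 0].

Local Notation Gam := zero_set.

(* Closed connected regular level set; smoothness comes from that of F. *)
Definition closed_regular_surface : Prop :=
  [/\ Gam !=set0, compact Gam, connected Gam &
    exists2 e : R, 0 < e &
      forall x, dist_to Gam x < e -> U x /\ grad F x != 0].

(* Signed distance, oriented so that d and F have the same sign. *)
Definition sdist (x : 'rV[R]_3) : R := Num.sg (F x) * dist_to Gam x.

Definition active (Th : seq (tet R)) : set (tet R) :=
  [set T | T \in Th /\ (hull T `&` Gam) !=set0].

(* The constants sigma, eta, C are common to all members of the family. *)
Definition admissible_family (J : Type) (Th : J -> seq (tet R)) : Prop :=
  exists sigma eta C h1 : R, [/\ 0 < sigma, 0 < eta, 0 <= C, 0 < h1 &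
    forall j, let h := mesh_size (Th j) in h < h1 ->
      [/\ forall T, T \in Th j -> diam (hull T) <= sigma * inradius T,
          forall T i, T \in Th j -> ~ Gam (T i),
          forall T i, active (Th j) T -> eta * h <= `|sdist (T i)| &
          forall T i k, active (Th j) T ->
            `| `|sdist (T i)| - `|sdist (T k)| | <= C * h ^+ 2]].

(* In normal position, vertex 0 of a three-edge cut is the lone vertex and the
   vertices 0, 1, 2, 3 of a four-edge cut have signs +, -, +, -. *)
Definition three_edge_cut (T : tet R) : Prop :=
  forall i, i != 0 -> F (T 0) * F (T i) < 0.

Definition four_edge_cut (T : tet R) : Prop :=
  [/\ 0 < F (T 0), F (T 1) < 0, 0 < F (T 2) & F (T 3) < 0].

Definition normal_position (T : tet R) : Prop :=
  three_edge_cut T \/ four_edge_cut T.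

(* A choice of normal relabeling.  For four-edge cuts the relabeling is not
   unique and determines along which diagonal the linear patch is split. *)
Definition normal_labeling (Th : seq (tet R)) (lab : tet R -> {perm 'I_4}) :
    Prop :=
  forall T, active Th T -> (exists s, normal_position (relabel T s)) ->
    normal_position (relabel T (lab T)).

Definition edge_point (a b : 'rV[R]_3) : 'rV[R]_3 :=
  xget 0 (Gam `&` segment a b).

(* Up to well_posed_cut, T is meant to be in normal position. *)
Definition edge_pt (T : tet R) (i k : 'I_4) : 'rV[R]_3 :=
  edge_point (T i) (T k).

Definition patch_triangles (T : tet R) : set (set 'rV[R]_3) :=
  let P := edge_pt T in
  if `[< three_edge_cut T >] then [set triangle (P 0 1) (P 0 2) (P 0 3)]
  else if `[< four_edge_cut T >] then
    [set triangle (P 0 1) (P 1 2) (P 3 0); triangle (P 1 2) (P 2 3) (P 3 0)]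
  else set0.

Definition linear_patch (T : tet R) : set 'rV[R]_3 :=
  \bigcup_(K in patch_triangles T) K.

Definition ray_points (T : tet R) (X : 'rV[R]_3) : set 'rV[R]_3 :=
  [set Y | [/\ Gam Y, hull T Y &
    exists2 t : R, 0 <= t & Y = T 0 + t *: (X - T 0)]].

Definition join_point (T : tet R) (u v w : R) : 'rV[R]_3 :=
  (1 - w) *: ((1 - u) *: T 0 + u *: T 2) + w *: ((1 - v) *: T 1 + v *: T 3).

Definition join_params (T : tet R) (u v : R) : set R :=
  [set w | 0 < w < 1 /\ Gam (join_point T u v w)].

Definition Phi_loc (T : tet R) (X : 'rV[R]_3) : 'rV[R]_3 :=
  if `[< three_edge_cut T >] then xget 0 (ray_points T X)
  else
    let b := barycentric T X in
    let u := b 2 / (b 0 + b 2) in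
    let v := b 3 / (b 1 + b 3) in
    join_point T u v (xget 0 (join_params T u v)).

(* All the points selected by xget above exist and are unique. *)
Definition well_posed_cut (T : tet R) : Prop :=
  (three_edge_cut T /\
   (forall i, i != 0 -> exists! B, (Gam `&` segment (T 0) (T i)) B) /\
   (forall X, linear_patch T X -> exists! Y, ray_points T X Y)) \/
  (four_edge_cut T /\
   (forall i k, F (T i) * F (T k) < 0 ->
      exists! P, (Gam `&` segment (T i) (T k)) P) /\
   (forall u v, 0 <= u <= 1 -> 0 <= v <= 1 -> exists! w, join_params T u v w)).

Section DiscreteSurface.
Variables (Th : seq (tet R)) (lab : tet R -> {perm 'I_4}).

Definition normalized (T : tet R) : tet R := relabel T (lab T).

Definition surface_triangulation : set (set 'rV[R]_3) :=
  \bigcup_(T in active Th) patch_triangles (normalized T).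

Definition Gamma_h : set 'rV[R]_3 :=
  \bigcup_(K in surface_triangulation) K.

Definition PhiT (T : tet R) : 'rV[R]_3 -> 'rV[R]_3 := Phi_loc (normalized T).

(* Restrictions to K of polynomials of total degree at most r. *)
Definition poly_on (r : nat) (K : set 'rV[R]_3) (f : 'rV[R]_3 -> R) : Prop :=
  exists c : 'I_r.+1 -> 'I_r.+1 -> 'I_r.+1 -> R, forall X, K X ->
    f X = \sum_(i < r.+1) \sum_(j < r.+1) \sum_(k < r.+1 | (i + j + k <= r)%N)
            c i j k * X 0 0 ^+ i * X 0 1 ^+ j * X 0 2 ^+ k.

(* Functions on Gamma_h and on the surface are represented by total functions
   whose values elsewhere are irrelevant. *)
Definition fe_space (r : nat) : set ('rV[R]_3 -> R) :=
  [set phi | {within Gamma_h, continuous phi} /\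
     forall K, surface_triangulation K -> poly_on r K phi].

Definition lifted_space (Phi_h : 'rV[R]_3 -> 'rV[R]_3) (r : nat) :
    set ('rV[R]_3 -> R) :=
  [set f | exists2 phi, fe_space r phi &
     forall X, Gamma_h X -> f (Phi_h X) = phi X].

End DiscreteSurface.

End CutMesh.

Section Sobolev.
Context {R : realType}.

Definition leb2 := (@lebesgue_measure R \x @lebesgue_measure R)%E.

Definition L2loc (V : set (R * R)) (f : R * R -> R) : Prop :=
  measurable_fun V f /\
  forall K : set (R * R), compact K -> K `<=` V ->
    (\int[leb2]_(p in K) ((f p) ^+ 2)%:E < +oo)%E.

Definition test_function (V : set (R * R)) (phi : R * R -> R) : Prop :=
  [/\ forall k, Ck k [set: R * R] phi,
      compact (closure [set p | phi p != 0]) &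
      closure [set p | phi p != 0] `<=` V].

Definition weak_derivative (V : set (R * R)) (e : R * R) (f g : R * R -> R) :
    Prop :=
  forall phi, test_function V phi ->
    \int[leb2]_(p in V) (f p * 'D_e phi p) =
    - \int[leb2]_(p in V) (g p * phi p).

Definition H1loc (V : set (R * R)) (f : R * R -> R) : Prop :=
  L2loc V f /\
  forall e, e = (1, 0) \/ e = (0, 1) ->
    exists g, L2loc V g /\ weak_derivative V e f g.

(* Regular C^1 parametrization of a relatively open part of S, with continuous
   inverse. *)
Definition local_parametrization (S : set 'rV[R]_3) (V : set (R * R))
    (chi : R * R -> 'rV[R]_3) : Prop :=
  [/\ open V, Ck 1 V chi, set_inj V chi,
      forall p, V p -> forall a b : R,
        a *: 'D_((1, 0) : R * R) chi p + b *: 'D_((0, 1) : R * R) chi p = 0 ->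
        a = 0 /\ b = 0 &
      forall W, open W -> W `<=` V ->
        exists2 O, open O & chi @` W = S `&` O].

(* H^1 of a compact surface S through local coordinates.  By compactness,
   finitely many compactly contained coordinate patches cover S, so that the
   local conditions amount to finiteness of the global H^1 norm. *)
Definition H1 (S : set 'rV[R]_3) (f : 'rV[R]_3 -> R) : Prop :=
  forall V chi, local_parametrization S V chi -> H1loc V (f \o chi).

End Sobolev.

(* Main.v *)
Require Import Defs.
From HB Require Import structures.
From mathcomp Require Import all_boot all_order all_algebra.
From mathcomp Require Import all_fingroup.
From mathcomp Require Import all_classical all_reals all_analysis.
From mathcomp Require Import measurable_realfun ring lra.

Set Implicit Arguments.
Unset Strict Implicit.
Unset Printing Implicit Defensive.

Import Order.TTheory GRing.Theory Num.Theory.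
Import numFieldNormedType.Exports.

Local Open Scope classical_set_scope.
Local Open Scope ring_scope.

(** Let [h] be small. On an active cell [T], expand [F] to second order: the
error is of order [h^2], while by admissibility [F] is at least a multiple of
[h] in modulus at every vertex ([vertex_bound]). Hence [F] is positive on the
face spanned by the positive vertices, negative on the face spanned by the
negative ones, and strictly decreasing on every segment from the first face to
the second ([cut_tet_of_bounds], [active_cut_tet]). Such segments, the joins of
the two faces, foliate the rest of the cell, and each carries exactly one point
of the surface. For a three-edge cut they are the rays from the lone vertex, and
for a four-edge cut the segments from [M(u)] to [N(v)]; in both cases [Phi_T]
sends a point to the zero of [F] on the join through it ([Phi_locP]).

The linear patch is a zero set of the same kind: of an affine function for a
three-edge cut, of the minimum or maximum of two affine functions for a
four-edge cut ([patch_separating]). So the patch also meets each join exactly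
once, and moving along joins is a bijection between the patch and the part of
the surface in [T].

Two facts make these bijections fit together. Lying on the same join means that
the barycentric coordinates at positive vertices are multiplied by one factor
and those at negative vertices by another ([coax]); this involves only the
vertices of the smallest face containing the points, so that it has the same
meaning in two cells sharing that face ([coax_transfer]). And the trace of the
patch on a face consists of segments between zeros of [F] on edges of that face
([patch_face_segment]), so that it too is seen alike from both sides
([patch_transfer]). The relation [lift_rel] between discrete and exact surface
obtained by joining the local ones is therefore functional in both directions
and total on both sides. Its graph is compact, being a finite union of compact
sets ([lift_graph_compact]), whence continuity of the lift and of its inverse
([lift_homeomorphism]).

For the Sobolev statement, let [Y] lie over one patch triangle. Its inverse lift
is the intersection of the join through [Y] with the plane of the triangle, so
that its coordinates are rational functions of [Y] with positive denominator
([footE]). A lifted finite element function is thus locally Lipschitz on each of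
finitely many closed pieces covering the surface; along a segment in a chart,
continuous induction combines the pieces ([piecewise_lip_chart]). It remains that
locally Lipschitz functions of two variables belong to [H1loc]
([loc_lip_H1loc]). By Fubini this is integration by parts on lines, which follows
from the differentiability almost everywhere of Lipschitz functions of one
variable ([lipschitz_ae_derivable]). *)

(** * Lipschitz functions on the line *)

Section StieltjesLipschitz.
Context {R : realType}.
Variables (f : cumulative R R) (C : R).
Hypothesis fC : forall x y, x <= y -> f y - f x <= C * (y - x).

Lemma wlength_le_lip (A : set (ocitv_type R)) : ocitv A ->
  (wlength f A <= C%:E * wlength idfun A)%E.
Proof.
move=> /ocitvP[->|[[a b]/= ab ->]].
  by rewrite !wlength0 mule0.
rewrite !wlength_itv_bnd ?(ltW ab)//= -EFinM lee_fin; apply: fC; exact: ltW.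
Qed.

Hypothesis C0 : 0 < C.

(** Both outer measures are infima over the same countable covers by half-open
intervals. *)
Lemma lebesgue_stieltjes_le_lip (A : set (measurableTypeR R)) :
  (lebesgue_stieltjes_measure f A <= C%:E * lebesgue_measure A)%E.
Proof.
rewrite /lebesgue_measure /lebesgue_stieltjes_measure /measure_extension /mu_ext.
rewrite -ereal_inf_pZl//.
apply: le_ereal_inf_tmp => _ [_ [F [mF AF] <-] <-].
apply: ge_ereal_inf; exists (\sum_(k <oo) wlength f (F k))%E; first by exists F.
rewrite -nneseriesZl; last first.
  by move=> n _; exact: wlength_ge0.
apply: lee_nneseries => n _; first by move=> _; exact: wlength_ge0.
by apply: wlength_le_lip; exact: mF.
Qed.
End StieltjesLipschitz.

Section LipschitzDensity.
Context {R : realType}.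
Let mu := @lebesgue_measure R.

Lemma lip_continuous (k : R -> R) (L : R) :
  (forall x y, `|k x - k y| <= L * `|x - y|) -> continuous k.
Proof.
move=> kL x; apply/cvgrPdist_le => e e0.
have L1 : 0 < `|L| + 1 by rewrite ltr_wpDl.
apply/nbhs_ballP; exists (e / (`|L| + 1)) => /=; first by rewrite divr_gt0.
move=> y; rewrite /ball/= => xy; apply: (le_trans (kL _ _)).
apply: (@le_trans _ _ ((`|L| + 1) * `|x - y|)).
  by rewrite ler_wpM2r// (le_trans (ler_norm L))// lerDl.
by rewrite -ler_pdivlMl// mulrC ltW.
Qed.

Let is_derive_inside (G k : R -> R) (a b L x : R) : a < x < b ->
  (forall y, a <= y <= b -> G y = k y + L * y - (0 + L * a)) ->
  derivable G x 1 -> is_derive x (1 : R) k ('D_1 G x - L).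
Proof.
move=> /andP[ax xb] GE dG.
apply: (@near_eq_is_derive _ _ _ (G \- (L \*: (id \- cst a)))).
  near=> y => /=.
  have axb : a <= y <= b.
    apply/andP; split; near: y; [exact: lt_le_nbhsr|exact: lt_le_nbhsl].
  by rewrite GE// /cst/= -[L *: _]/(L * (y - a)); ring.
have dGx : is_derive x (1 : R) G ('D_1 G x) by split.
have dL : is_derive x (1 : R) (L \*: (id \- cst a)) (L *: (1 - 0)).
  by apply: is_deriveZ; apply: is_deriveB.
by rewrite subr0 [L *: 1]mulr1 in dL; exact: is_deriveB.
Unshelve. all: by end_near. Qed.

Let is_derive_outside (k : R -> R) (a b x : R) : x <> a -> x <> b ->
  ~~ (a < x < b) -> (forall y, ~~ (a < y < b) -> k y = 0) ->
  is_derive x (1 : R) k 0.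
Proof.
move=> xa xb + k0; rewrite negb_and -!leNgt !le_eqVlt.
move=> /orP[/orP[/eqP//|xa']|/orP[/eqP/esym//|bx]];
    apply: (@near_eq_is_derive _ _ _ (cst 0)); near=> y.
  rewrite k0// negb_and -leNgt; apply/orP; left; near: y.
  exact: lt_le_nbhsl.
rewrite k0// negb_and -!leNgt; apply/orP; right; near: y.
exact: lt_le_nbhsr.
Unshelve. all: by end_near. Qed.

(** Adding [L * x] makes [k] nondecreasing with increments at most [2 L] times
those of [x]. The Stieltjes measure of the sum is then dominated by Lebesgue
measure, so it has a Radon-Nikodym density; the sum is the primitive of that
density and the fundamental theorem of calculus differentiates it almost
everywhere. *)
Lemma lipschitz_ae_derivable (k : R -> R) (a b L : R) : a < b ->
  (forall x y, `|k x - k y| <= L * `|x - y|) ->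
  (forall x, x \notin `]a, b[ -> k x = 0) ->
  exists dk : R -> R, [/\ mu.-integrable setT (EFin \o dk),
    (\int[mu]_x (dk x)%:E = 0)%E &
    {ae mu, forall x, is_derive (x : R) (1 : R) k (dk x)}].
Proof.
move=> ab kL k0.
have L0 : 0 <= L.
  have := kL 1 0; rewrite subr0 normr1 mulr1; exact: le_trans.
(* The extra 1 keeps the constant positive when [L = 0]. *)
pose C := 2 * L + 1.
have C0 : 0 < C by rewrite ltr_wpDl// mulr_ge0.
pose f x := k x + L * x.
have fnd : nondecreasing f.
  move=> x y xy; have := kL x y; rewrite ler_norml distrC ger0_norm ?subr_ge0//.
  by move=> /andP[_]; rewrite /f mulrBr; lra.
have fc : continuous f.
  move=> x; apply: cvgD; first exact: (lip_continuous kL).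
  by apply: cvgMl_tmp; exact: cvg_id.
have frc : right_continuous f by exact: right_continuousW.
pose fm := isCumulative.Build R _ R f fnd frc.
pose fcum : cumulative R R := HB.pack f fm.
have fC x y : x <= y -> fcum y - fcum x <= C * (y - x).
  move=> xy; have := kL x y; rewrite ler_norml distrC ger0_norm ?subr_ge0//.
  rewrite /= /f /C => /andP[? _]; nra.
have nule := lebesgue_stieltjes_le_lip fC C0.
pose ls := lebesgue_stieltjes_measure fcum.
have mD : measurable (`]a, b] : set (measurableTypeR R)) by exact: measurable_itv.
have lsD : (ls [set` `]a, b]] < +oo)%E.
  apply: le_lt_trans (nule _) _.
  by rewrite lebesgue_measure_itv/= lte_fin ab -EFinD -EFinM ltry.
pose nu : {finite_measure set (measurableTypeR R) -> \bar R} := mfrestr mD lsD.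
have numu : nu `<< mu.
  apply/null_content_dominatesP => A mA muA0.
  apply/eqP; rewrite eq_le measure_ge0 andbT.
  have /le_trans -> // : (nu A <= ls A)%E.
    by rewrite /nu/= /mfrestr /mrestr le_measure// ?inE//; exact: measurableI.
  have {}muA0 : lebesgue_measure A = 0%E := muA0.
  by rewrite (le_trans (nule A))// muA0 mule0.
have [rho [rho0 rhofin rhoint rhoE]] := radon_nikodym_sigma_finite numu.
pose r x := fine (rho x).
have rE x : (r x)%:E = rho x by rewrite fineK.
have EFr : EFin \o r = rho by apply/funext => x /=; rewrite rE.
have rint (D : set R) : measurable D -> mu.-integrable D (EFin \o r).
  by move=> mD'; rewrite EFr; apply: integrableS rhoint.
have nuE x : a <= x <= b -> nu [set` `]a, x]] = (f x - f a)%:E.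
  move=> /andP[ax xb]; rewrite /nu/= /mfrestr /mrestr.
  rewrite setIidl; last by apply: subset_itvl; rewrite bnd_simp.
  rewrite /ls /lebesgue_stieltjes_measure /measure_extension measurable_mu_extE//=.
    by rewrite wlength_itv_bnd.
  exact: is_ocitv.
pose G y := (\int[mu]_(t in [set` Interval (BRight a) (BRight y)]) (r t))%R.
have GE x : a <= x <= b -> G x = f x - f a.
  move=> axb; rewrite /G /Rintegral.
  under eq_integral do rewrite rE.
  by rewrite -rhoE; [rewrite nuE|exact: measurable_itv].
pose dk := (fun x => r x - L) \_ `]a, b].
have cstint : mu.-integrable `]a, b] (EFin \o cst L).
  rewrite (_ : EFin \o cst L = cst L%:E)//; apply/integrableP; split=> //.
  rewrite integral_cst//= lebesgue_measure_itv/= lte_fin ab -EFinD -EFinM.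
  exact: ltry.
exists dk; split.
- by rewrite /dk -restrict_EFin; apply/integrable_restrict => //; rewrite setTI; exact: (integrableB mD (rint _ mD) cstint).
- rewrite /dk.
  rewrite (_ : (fun x => _) = (EFin \o (fun x => r x - L)) \_ `]a, b]); last first.
    by rewrite restrict_EFin.
  rewrite -integral_mkcond.
  rewrite [LHS](integralB mD (rint _ mD) cstint) EFr.
  rewrite -rhoE// nuE ?(ltW ab) ?lexx//.
  rewrite (_ : EFin \o cst L = cst L%:E)// integral_cst//=.
  rewrite lebesgue_measure_itv/= lte_fin ab -(EFinB b a) -EFinM -EFinB.
  by congr EFin; rewrite /f !k0 ?in_itv/= ?ltxx ?andbF//; ring.
- have loc : locally_integrable [set: R] r.
    by apply: open_integrable_locally; [exact: openT|exact: rint].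
  have ae_neq (c : R) : {ae mu, forall x, x <> c}.
    exists [set c]; split => //; first exact: lebesgue_measure_set1.
    by move=> x /=; move/contrapT.
  have := FTC1 (a := BRight a) (fun y => rint _ (measurable_itv _)) loc.
  apply: (filterS3 (ae_filter_ringOfSetsType mu) _ (ae_neq a) (ae_neq b)).
  move=> x xa xb /= Gx; rewrite /dk patchE.
  have [axb|xab] := boolP (a < x < b).
    have /andP[ax xb'] := axb.
    have [dG dGE] := Gx ax; rewrite derive1E in dGE.
    have Dx : `]a, b]%classic x by rewrite /= in_itv/= ax (ltW xb').
    rewrite (mem_set Dx) -dGE.
    apply: is_derive_inside axb _ dG => y axb'.
    by rewrite [LHS](GE _ axb') /f (k0 a) ?in_itv/= ?ltxx.
  rewrite memNset.
    by apply: is_derive_outside xa xb xab _ => y yab; rewrite k0 ?in_itv.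
  rewrite /= in_itv/= => /andP[ax]; rewrite le_eqVlt => /orP[/eqP//|xb'].
    by move: xab; rewrite ax xb'.
Qed.
End LipschitzDensity.

(** * Locally Lipschitz functions *)

Section CompactBound.
Context {R : realType}.

(** Bounds that hold locally, and may always be relaxed, can be chosen uniformly
on a compact set. *)
Lemma compact_locally_bounded (T : topologicalType) (K : set T) (P : T -> R -> Prop) :
  compact K ->
  (forall x M N, M <= N -> P x M -> P x N) ->
  (forall x, K x -> exists M, \forall y \near x, P y M) ->
  exists M, forall x, K x -> P x M.
Proof.
move=> /compact_near_coveringP cK Pm Pl.
have [|M [_ KM]] := cK _ (pinfty_nbhs R) (fun M x => P x M).
  move=> x /Pl[M0 nM0]; near=> y M => /=.
  have yM : P y M0 by near: y.
  by apply: Pm yM; near: M; apply: nbhs_pinfty_ge; rewrite num_real.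
by exists (M + 1) => x Kx; apply: KM => //; rewrite ltrDl.
Unshelve. all: by end_near. Qed.
End CompactBound.

Definition loc_lip {R : realType} {V : normedModType R} (k : V -> R) (t : V) :=
  exists e L : R, 0 < e /\ forall s s', `|s - t| < e -> `|s' - t| < e ->
    `|k s - k s'| <= L * `|s - s'|.

Section ContinuousInduction.
Context {R : realType}.

(** Continuous induction: the supremum of the points up to which the estimate
holds is such a point, and it can be passed unless it is [b]. *)
Lemma pointwise_lip_increment (k : R -> R) (a b L : R) : a <= b ->
  (forall t, a <= t <= b -> exists2 e : R, 0 < e & forall s, a <= s <= b ->
     `|s - t| < e -> `|k s - k t| <= L * `|s - t|) ->
  `|k b - k a| <= L * (b - a).
Proof.
move=> ab kL.
pose A := [set t | a <= t <= b /\ `|k t - k a| <= L * (t - a)].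
have Aa : A a by split; rewrite ?lexx// subrr normr0 subrr mulr0.
have supA : has_sup A by split; [exists a|exists b => t [/andP[]]].
have ac : a <= sup A by apply: ub_le_sup => //; case: supA.
have cb : sup A <= b by apply: ge_sup; [exists a|move=> t [/andP[]]].
have acb : a <= sup A <= b by apply/andP.
have step t s : A t -> t <= s -> s <= b ->
    `|k s - k t| <= L * (s - t) -> A s.
  move=> [/andP[at_ tb] kt] ts sb kst; split; first by rewrite (le_trans at_).
  rewrite (_ : k s - k a = (k s - k t) + (k t - k a)); last by ring.
  rewrite (le_trans (ler_normD _ _))// (le_trans (lerD kst kt))//.
  by rewrite -mulrDr (_ : s - t + (t - a) = s - a)//; ring.
have [e e0 ce] := kL _ acb.
have Ac : A (sup A).
  have [t At tc] := sup_adherent e0 supA.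
  have tsup : t <= sup A by apply: ub_le_sup => //; case: supA.
  apply: (step t) => //.
  have tl : `|t - sup A| = sup A - t by rewrite distrC ger0_norm ?subr_ge0.
  rewrite distrC -tl; apply: ce; first by case: At.
  by rewrite tl ltrBlDr -ltrBlDl.
have [cb'|bc] := ltP (sup A) b; last first.
  have -> : b = sup A by apply/eqP; rewrite eq_le bc cb.
  by case: Ac.
pose s := Num.min (sup A + e / 2) b.
have cs : sup A < s by rewrite lt_min cb' ltrDl divr_gt0.
have sb : s <= b by rewrite ge_min lexx orbT.
have se : s <= sup A + e / 2 by rewrite ge_min lexx.
have : A s.
  apply: (step (sup A)) => //; first exact: ltW.
  have := ce s; rewrite gtr0_norm ?subr_gt0//; apply.
    by rewrite sb (le_trans ac)// ltW.
  by lra.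
by move=> /(ub_le_sup supA.2); rewrite leNgt cs.
Qed.

Lemma clamp_mono_lip (x y a b : R) : x <= y ->
  Num.max a (Num.min x b) <= Num.max a (Num.min y b)
    <= Num.max a (Num.min x b) + (y - x).
Proof.
move=> xy; have mxy : Num.min x b <= Num.min y b <= Num.min x b + (y - x).
  case: (leP x b) => xb; case: (leP y b) => yb.
  - by rewrite xy subrKC lexx.
  - by rewrite xb subrKC ltW.
  - by move: xb; rewrite ltNge (le_trans xy yb).
  - by rewrite lexx lerDl subr_ge0.
move: mxy => /andP[m1 m2].
apply/andP; split.
  by rewrite ge_max; apply/andP; split; rewrite le_max ?lexx// m1 orbT.
rewrite ge_max; apply/andP; split.
  by rewrite ler_wpDr ?subr_ge0// le_max lexx.
by apply: le_trans m2 _; rewrite lerD2r le_max lexx orbT.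
Qed.

(** Clamping to the interval contracts distances and does not change the values
of [k], so it is enough to compare points of the interval, where compactness
makes the local constants uniform. *)
Lemma compact_supp_lip (k : R -> R) (a b : R) : a <= b ->
  (forall t : R, loc_lip k t) ->
  (forall t, t \notin `]a, b[ -> k t = 0) ->
  exists L, forall x y, `|k x - k y| <= L * `|x - y|.
Proof.
move=> ab kl k0.
have [M HM] : exists M, forall t, `[a, b]%classic t ->
    0 <= M /\ \forall s \near t, `|k s - k t| <= M * `|s - t|.
  apply: (@compact_locally_bounded _ _ _ (fun t M => 0 <= M /\
      \forall s \near t, `|k s - k t| <= M * `|s - t|)).
  - exact: segment_compact.
  - move=> x M N MN [M0 kM]; split; first exact: le_trans MN.
    apply: filterS kM => s /le_trans; apply; exact: ler_wpM2r.
  - move=> t _; have [e [L [e0 HL]]] := kl t.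
    exists `|L|; apply/nbhs_ballP; exists e => //= s.
    rewrite /ball/= distrC => st; split => //.
    apply/nbhs_ballP; exists (e - `|s - t|) => /=; first by rewrite subr_gt0.
    move=> s'; rewrite /ball/= distrC => ss'.
    rewrite (le_trans (HL _ _ _ st))//; last by rewrite ler_wpM2r// ler_norm.
    rewrite (_ : s' - t = (s' - s) + (s - t)); last by ring.
    by rewrite (le_lt_trans (ler_normD _ _))//; lra.
have incr x y : x <= y -> `[a, b]%classic x -> `[a, b]%classic y ->
    `|k y - k x| <= M * (y - x).
  move=> xy /= xab yab; apply: pointwise_lip_increment => // t /andP[xt ty].
  have [|_ /nbhs_ballP[e /= e0 eM]] := HM t.
    move: xab yab; rewrite /= !in_itv/= => /andP[ax _] /andP[_ yb].
    by rewrite (le_trans ax)//= (le_trans ty).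
  by exists e => // s _ st; apply: eM; rewrite /ball/= distrC.
have M0 : 0 <= M.
  by have [] := HM a; rewrite //= in_itv/= lexx.
exists M.
pose c x := Num.max a (Num.min x b).
have cab x : `[a, b]%classic (c x).
  by rewrite /= in_itv/= /c le_max lexx ge_max ab ge_min lexx orbT.
have kc x : k x = k (c x).
  rewrite /c; have [xa|ax] := leP x a.
    rewrite (min_l (le_trans xa ab)) (max_l xa) !k0// in_itv/= ?ltxx// ltNge xa//.
  have [xb|bx] := leP x b; first by rewrite max_r// ltW.
  by rewrite max_r// !k0// in_itv/= ?ltxx ?andbF// (ltNge x b) (ltW bx) andbF.
have cx x y := @clamp_mono_lip x y a b.
suff H x y : x <= y -> `|k x - k y| <= M * `|x - y|.
  move=> x y; have [/H//|/ltW/H] := leP x y; by rewrite distrC (distrC y).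
move=> xy; rewrite kc (kc y) distrC (distrC x) (ger0_norm (_ : 0 <= y - x)) ?subr_ge0//.
have /andP[c1 c2] := cx _ _ xy.
apply: le_trans (incr _ _ c1 (cab _) (cab _)) _.
by rewrite ler_wpM2l// lerBlDl.
Qed.
End ContinuousInduction.

Section LocallyLipschitz.
Context {R : realType}.

Lemma loc_lipM (V : normedModType R) (f g : V -> R) (t : V) :
  loc_lip f t -> loc_lip g t -> loc_lip (f \* g) t.
Proof.
move=> [e1 [L1 [e10 H1]]] [e2 [L2 [e20 H2]]].
pose e := Num.min (Num.min e1 e2) 1.
have e0 : 0 < e by rewrite !lt_min e10 e20 ltr01.
have He s : `|s - t| < e -> [/\ `|s - t| < e1, `|s - t| < e2 & `|s - t| < 1].
  by rewrite !lt_min => /andP[/andP[-> ->] ->].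
exists e, ((`|f t| + `|L1|) * `|L2| + (`|g t| + `|L2|) * `|L1|); split => // s s'.
move=> /He[s1 s2 s3] /He[s'1 s'2 s'3].
have bnd (k : V -> R) L e' x : 0 < e' -> (forall s s', `|s - t| < e' -> `|s' - t| < e' ->
    `|k s - k s'| <= L * `|s - s'|) -> `|x - t| < e' -> `|x - t| < 1 ->
    `|k x| <= `|k t| + `|L|.
  move=> e'0 Hk xe x1; rewrite -[k x](subrK (k t)) addrC.
  rewrite (le_trans (ler_normD _ _))// lerD2l.
  rewrite (le_trans (Hk _ _ xe _)) ?subrr ?normr0//.
  rewrite (@le_trans _ _ (`|L| * `|x - t|))// ?ler_wpM2r ?ler_norm//.
  by rewrite ler_piMr// ltW.
have fs := bnd _ _ _ _ e10 H1 s1 s3.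
have gs := bnd _ _ _ _ e20 H2 s'2 s'3.
rewrite /= (_ : _ - _ = f s * (g s - g s') + g s' * (f s - f s')); last by ring.
rewrite (le_trans (ler_normD _ _))// mulrDl !normrM lerD// -mulrA ler_pM//.
  by rewrite (le_trans (H2 _ _ s2 s'2))// ler_wpM2r// ler_norm.
by rewrite (le_trans (H1 _ _ s1 s'1))// ler_wpM2r// ler_norm.
Qed.

Lemma loc_lip_near0 (V : normedModType R) (f : V -> R) (t : V) :
  (\forall s \near t, f s = 0) -> loc_lip f t.
Proof.
move=> /nbhs_ballP[e /= e0 fe]; exists e, 0; split => // s s' st st'.
have ballE x : `|x - t| < e -> f x = 0.
  by move=> xt; apply: fe; rewrite -ball_normE /ball_/= distrC.
by rewrite !ballE// subrr normr0 mul0r.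
Qed.

Lemma loc_lip_cvg (V : normedModType R) (f : V -> R) (t : V) :
  loc_lip f t -> {for t, continuous f}.
Proof.
move=> [e [L [e0 fe]]]; apply/cvgrPdist_le => eps eps0.
have L1 : 0 < `|L| + 1 by rewrite ltr_wpDl.
have d0 : 0 < Num.min e (eps / (`|L| + 1)) by rewrite lt_min e0 divr_gt0.
apply/nbhs_ballP; exists (Num.min e (eps / (`|L| + 1))) => //= s.
rewrite -ball_normE /ball_/= lt_min => /andP[se seps].
rewrite (le_trans (fe _ _ _ _)) ?subrr ?normr0//; first by rewrite distrC.
apply: (@le_trans _ _ ((`|L| + 1) * `|t - s|)).
  by rewrite ler_wpM2r// (le_trans (ler_norm L))// lerDl.
by rewrite -ler_pdivlMl// mulrC ltW.
Qed.

Lemma is_derive_cvg_seq (k : R -> R) (t l : R) : is_derive t (1 : R) k l ->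
  (fun n => n.+1%:R * (k (t + n.+1%:R^-1) - k t)) @ \oo --> l.
Proof.
move=> [dk <-].
have u0 : (fun n => n.+1%:R^-1 : R) @ \oo --> (0 : R)^'.
  move=> A /= [e /= e0 eA].
  have /cvgrPdist_lt/(_ _ e0)[N _ NP] := @cvg_harmonic R.
  exists N => // n Nn; apply: eA; last by rewrite /= invr_neq0.
  by rewrite /=; exact: NP.
have := cvg_comp _ _ u0 dk; apply: cvg_trans; apply: near_eq_cvg.
apply: nearW => n /=; rewrite invrK [_ *: 1]mulr1 [_ + t]addrC.
by [].
Qed.

Lemma is_derive_along (V W : normedModType R) (f : V -> W) (x v : V) (t : R) :
  derivable f (x + t *: v) v ->
  is_derive t (1 : R) (fun t : R => f (x + t *: v)) ('D_v f (x + t *: v)).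
Proof.
have E : (fun h : R => h^-1 *: (((fun t : R => f (x + t *: v)) \o shift t) (h *: 1)
      - f (x + t *: v)))
    = (fun h : R => h^-1 *: ((f \o shift (x + t *: v)) (h *: v) - f (x + t *: v))).
  apply/funext => h; congr (_ *: (f _ - _)).
  by rewrite /= [h *: 1]mulr1 scalerDl addrCA.
by move=> df; split; rewrite /derivable /derive E.
Qed.

Lemma near_cont_bound (V W : normedModType R) (f : V -> W) (p : V) :
  {for p, continuous f} -> \forall q \near p, `|f q| <= `|f p| + 1.
Proof.
move=> /cvgrPdist_le/(_ _ ltr01) fp; apply: filterS fp => q fq.
rewrite -[f q](subrK (f p)) addrC (le_trans (ler_normD _ _))// lerD2l.
by rewrite distrC.
Qed.

Lemma compact_norm_bound (V : normedModType R) (K : set V) : compact K ->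
  exists M : R, forall p, K p -> `|p| <= M.
Proof.
move=> cK; apply: (@compact_locally_bounded _ _ K (fun p M => `|p| <= M)) => //.
  by move=> p M N MN /le_trans; apply.
by move=> p _; exists (`|p| + 1); apply: near_cont_bound.
Qed.

Lemma loc_lip_C1 (k dk : R -> R) (t : R) :
  (forall s, is_derive s (1 : R) k (dk s)) -> {for t, continuous dk} -> loc_lip k t.
Proof.
move=> kd /cvgrPdist_lt/(_ _ ltr01) /nbhs_ballP[e /= e0 de].
exists e, (`|dk t| + 1); split => //.
suff H s s' : s < s' -> `|s - t| < e -> `|s' - t| < e ->
    `|k s - k s'| <= (`|dk t| + 1) * `|s - s'|.
  move=> s s' st s't; have [ss'|ss'|->] := ltgtP s s'; first exact: H.
    by rewrite distrC (distrC s); exact: H.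
  by rewrite !subrr !normr0 mulr0.
move=> ss' st s't.
have ck : {within `[s, s'], continuous k}.
  by apply: derivable_within_continuous => x _; exact: ex_derive.
have [c] := MVT ss' (fun x _ => kd x) ck.
rewrite in_itv/= => /andP[sc cs'] kE.
rewrite distrC kE normrM (distrC s) ler_wpM2r//.
have ct : `|t - c| < e.
  by move: st s't; rewrite !ltr_norml => /andP[? ?] /andP[? ?]; apply/andP; split; lra.
have := de c ct; rewrite /= => dc.
rewrite -[dk c](subrK (dk t)) addrC (le_trans (ler_normD _ _))// lerD2l.
by rewrite distrC ltW.
Qed.
End LocallyLipschitz.

(** * Integration by parts on a line *)

Section LineIntegral.
Context {R : realType}.
Let mu := @lebesgue_measure R.

(** The product [h * ph] is Lipschitz with compact support, so its derivative
exists almost everywhere and has integral zero. At a point where it exists and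
[ph] does not vanish, the difference quotients of [h] converge, and [gg] is
their limit. No differentiability of [h] itself is known beforehand. *)
Lemma line_integral_zero (h ph dph gg : R -> R) (W S : set R) (a b : R) :
  a < b -> closed S -> S `<=` W -> S `<=` `]a, b[%classic ->
  (forall t, W t -> loc_lip h t) ->
  (forall t, is_derive t (1 : R) ph (dph t)) -> (forall t, loc_lip ph t) ->
  (forall t, ~ S t -> ph t = 0) ->
  (forall t l, W t ->
    (fun n => n.+1%:R * (h (t + n.+1%:R^-1) - h t)) @ \oo --> l -> gg t = l) ->
  measurable_fun setT (fun t => h t * dph t + gg t * ph t) ->
  (\int[mu]_t (h t * dph t + gg t * ph t)%:E = 0)%E.
Proof.
move=> ab cS SW Sab hl phd phl ph0 ggl mpsi.
have notS t : ~ S t -> \forall s \near t, ~ S s.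
  by move=> St; apply: open_nbhs_nbhs; split => //; exact: closed_openC.
have [dk [dkint dk0 dkae]] : exists dk : R -> R, [/\ mu.-integrable setT (EFin \o dk),
    (\int[mu]_x (dk x)%:E = 0)%E &
    {ae mu, forall x, is_derive (x : R) (1 : R) (h \* ph) (dk x)}].
  have kz t : t \notin `]a, b[ -> (h \* ph) t = 0.
    move=> tab; rewrite /= ph0 ?mulr0// => /Sab/=.
    by rewrite (negbTE tab).
  have [|L kL] := compact_supp_lip (ltW ab) _ kz; last exact: lipschitz_ae_derivable kL kz.
  move=> t; have [/SW Wt|St] := pselect (S t); first exact: loc_lipM (hl _ Wt) (phl _).
  apply: loc_lip_near0; apply: filterS (notS _ St) => s Ss.
  by rewrite /= ph0 ?mulr0.
suff pt t : is_derive t (1 : R) (h \* ph) (dk t) ->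
    h t * dph t + gg t * ph t = dk t.
  rewrite -dk0; apply: ae_eq_integral => //.
  - exact/measurable_EFinP.
  - exact: measurable_int dkint.
  move: dkae; apply: filterS; first exact: (ae_filter_ringOfSetsType mu).
  by move=> t /pt <-.
move=> dkt.
have [/SW Wt|St] := pselect (S t); last first.
  have kn0 : \forall s \near t, (cst 0) s = (h \* ph) s.
    by apply: filterS (notS _ St) => s Ss; rewrite /= ph0 ?mulr0.
  have pn0 : \forall s \near t, (cst 0) s = ph s.
    by apply: filterS (notS _ St) => s Ss; rewrite /= ph0.
  have /@derive_val <- := dkt.
  have /@derive_val <- := phd t.
  rewrite -(near_eq_derive _ kn0) -(near_eq_derive _ pn0) !derive_cst.
  by rewrite mulr0 ph0// mulr0 addr0.
have kcv := is_derive_cvg_seq dkt.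
have pcv := is_derive_cvg_seq (phd t).
have hcv : (fun n => h (t + n.+1%:R^-1)) @ \oo --> h t.
  have /continuous_cvg := loc_lip_cvg (hl _ Wt); apply.
  rewrite -[X in _ --> X]addr0; apply: cvgD; first exact: cvg_cst.
  exact: cvg_harmonic.
have qcv : (fun n => ph t * (n.+1%:R * (h (t + n.+1%:R^-1) - h t))) @ \oo
    --> dk t - h t * dph t.
  rewrite (_ : (fun n => _) = (fun n =>
    n.+1%:R * ((h \* ph) (t + n.+1%:R^-1) - (h \* ph) t) -
    h (t + n.+1%:R^-1) * (n.+1%:R * (ph (t + n.+1%:R^-1) - ph t)))).
    exact: cvgB kcv (cvgM hcv pcv).
  by apply/funext => n /=; ring.
have [p0|p0] := eqVneq (ph t) 0.
  rewrite p0 mulr0 addr0; apply/eqP; rewrite eq_sym -subr_eq0; apply/eqP.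
  apply: (cvg_unique _ qcv) => //; rewrite p0.
  rewrite (_ : (fun n => _) = cst 0); first exact: cvg_cst.
  by apply/funext => n /=; rewrite mul0r.
have : (fun n => n.+1%:R * (h (t + n.+1%:R^-1) - h t)) @ \oo
    --> (ph t)^-1 * (dk t - h t * dph t).
  rewrite (_ : (fun n => _) = (fun n =>
    (ph t)^-1 * (ph t * (n.+1%:R * (h (t + n.+1%:R^-1) - h t))))).
    exact: cvgM (cvg_cst _) qcv.
  by apply/funext => n /=; rewrite mulKf.
by move=> /(ggl _ _ Wt) ->; rewrite mulrAC mulVf// mul1r subrKC.
Qed.
End LineIntegral.

(** * Lebesgue measure on the plane *)

Section PlaneMeasurability.
Context {R : realType}.

(** An open set of the plane is the countable union of the boxes with rational
corners that it contains. *)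
Lemma open_measurable2 (V : set (R * R)) : open V -> measurable V.
Proof.
move=> oV.
pose box (i : rat * rat * (rat * rat)) : set (R * R) :=
  [set` `]ratr i.1.1, ratr i.1.2[%R] `*` [set` `]ratr i.2.1, ratr i.2.2[%R].
have -> : V = \bigcup_i (if `[< box i `<=` V >] then box i else set0).
  apply/seteqP; split => [[x y] Vxy|p [i _]]; last first.
    by case: asboolP => // /(_ p).
  have /nbhs_ballP[e /= e0 eV] : nbhs (x, y) V by exact: open_nbhs_nbhs.
  have ratl z : exists q : rat, z - e < ratr q < z.
    have /rat_in_itvoo[q] : z - e < z by rewrite ltrBlDr ltrDl.
    by rewrite in_itv; exists q.
  have ratg z : exists q : rat, z < ratr q < z + e.
    have /rat_in_itvoo[q] : z < z + e by rewrite ltrDl.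
    by rewrite in_itv; exists q.
  have [[q1 /andP[a1 b1]] [q2 /andP[a2 b2]]] := (ratl x, ratg x).
  have [[q3 /andP[a3 b3]] [q4 /andP[a4 b4]]] := (ratl y, ratg y).
  exists ((q1, q2), (q3, q4)) => //; case: asboolP => [_|].
    by split; rewrite /= in_itv/= ?b1 ?a2 ?b3 ?a4.
  case=> -[x' y'] [/=]; rewrite !in_itv/= => /andP[c1 c2] /andP[c3 c4].
  by apply: eV; split; rewrite /ball/= ltr_norml; apply/andP; split; lra.
apply: countable_bigcupT_measurable => [|i]; first exact: countableP.
case: ifP => _ //; apply: measurableX; exact: measurable_itv.
Qed.

Lemma continuous_measurable2 (V : set (R * R)) (f : R * R -> R) : open V ->
  (forall p, V p -> {for p, continuous f}) -> measurable_fun V f.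
Proof.
move=> oV cf; apply: (measurability _ (RGenOInfty.measurableE R)).
move=> /= _ [_ [a ->]] <-; apply: open_measurable2.
rewrite openE => p [Vp /= fp]; rewrite /interior.
have oa : open [set` `]a, +oo[%R] by exact: interval_open.
apply: filterI; first exact: open_nbhs_nbhs.
by apply: (cf _ Vp); exact: open_nbhs_nbhs.
Qed.
End PlaneMeasurability.

Section PlaneIntegrability.
Context {R : realType}.
Let mu2 : {measure set _ -> \bar R} := (@lebesgue_measure R \x @lebesgue_measure R)%E.

Lemma compact_measurable2 (K : set (R * R)) : compact K -> measurable K.
Proof.
move=> cK; rewrite -[K]setCK; apply: measurableC; apply: open_measurable2.
by apply: closed_openC; apply: compact_closed => //; exact: norm_hausdorff.
Qed.

Lemma compact_leb2_lty (K : set (R * R)) : compact K -> (leb2 K < +oo)%E.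
Proof.
move=> cK.
have [M KM] := compact_norm_bound cK.
pose B : set (R * R) := [set` `[-M, M]] `*` [set` `[-M, M]].
have mB : measurable B by apply: measurableX; exact: measurable_itv.
have KB : K `<=` B.
  move=> [x y] /KM; rewrite prod_normE/= ge_max => /andP[xM yM].
  by split; rewrite /= in_itv/= -ler_norml.
apply: (@le_lt_trans _ _ (mu2 B)).
  by apply: (@le_measure _ _ _ mu2) => //; rewrite inE//; exact: compact_measurable2.
rewrite /mu2/= product_measure1E; [|exact: measurable_itv..].
change (lebesgue_measure [set` `[(- M)%R, M]] * lebesgue_measure [set` `[(- M)%R, M]]
  < +oo)%E.
rewrite lebesgue_measure_itv/=; case: ifP => _; last by rewrite mul0e ltry.
by rewrite -(EFinB M) -EFinM ltry.
Qed.

Let cst_mul_lty (c : R) (m : \bar R) : (0 <= m -> m < +oo -> c%:E * m < +oo)%E.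
Proof.
by move=> m0 moo; rewrite -(@fineK _ m) ?ge0_fin_numE// -EFinM ltry.
Qed.

Lemma bounded_L2loc (V : set (R * R)) (f : R * R -> R) :
  open V -> measurable_fun V f ->
  (forall p, V p -> exists M : R, \forall q \near p, `|f q| <= M) -> L2loc V f.
Proof.
move=> oV mf fb; split => // K cK KV.
have mK := compact_measurable2 cK.
have [M KM] : exists M : R, forall p, K p -> `|f p| <= M.
  apply: (@compact_locally_bounded _ _ K (fun p M => `|f p| <= M)) => //.
    by move=> p M N MN /le_trans; apply.
  by move=> p /KV/fb.
apply: (@le_lt_trans _ _ (\int[mu2]_(p in K) cst (M ^+ 2)%:E p)%E).
  apply: ge0_le_integral => //.
  - by move=> p _; rewrite lee_fin sqr_ge0.
  - apply/measurable_EFinP; apply: measurable_funX;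
    exact: measurable_funS (open_measurable2 oV) KV mf.
  - move=> p Kp; rewrite lee_fin -[f p ^+ 2]real_normK ?num_real// lerXn2r ?nnegrE//.
      exact: le_trans (KM _ Kp).
    exact: KM.
rewrite integral_cst//; have K2 := compact_leb2_lty cK.
by apply: cst_mul_lty => //; exact: measure_ge0.
Qed.

Lemma bounded_supp_integrable (K : set (R * R)) (f : R * R -> R) :
  compact K -> measurable_fun setT f -> (exists M : R, forall p, K p -> `|f p| <= M) ->
  (forall p, ~ K p -> f p = 0) -> mu2.-integrable setT (EFin \o f).
Proof.
move=> cK mf [M KM] f0; apply/integrableP; split; first exact/measurable_EFinP.
have mK := compact_measurable2 cK.
have -> : (fun x => `|(EFin \o f) x|%E) = (fun x => `|(f x)%:E|%E) \_ K.
  apply/funext => p; rewrite patchE /=; case: ifPn => //.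
  by rewrite notin_setE => /f0 ->; rewrite normr0.
rewrite -integral_mkcond.
apply: (@le_lt_trans _ _ (\int[mu2]_(p in K) cst M%:E p)%E).
  apply: ge0_le_integral => //.
  apply: measurableT_comp => //; apply/measurable_EFinP.
  exact: measurable_funTS.
rewrite integral_cst//; have K2 := compact_leb2_lty cK.
by apply: cst_mul_lty => //; exact: measure_ge0.
Qed.
End PlaneIntegrability.

(** * Weak derivatives of locally Lipschitz functions *)

Section LimsupBound.
Context {R : realType}.

Lemma limn_esup_bounded (u : R^nat) (M : R) : (\forall n \near \oo, `|u n| <= M) ->
  `|fine (limn_esup (EFin \o u))| <= M.
Proof.
have up (v : R^nat) : (\forall n \near \oo, `|v n| <= M) ->
    (limn_esup (EFin \o v) <= M%:E)%E.
  move=> vM; apply: ge_ereal_inf.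
  exists (ereal_sup ((EFin \o v) @` [set n | `|v n| <= M])).
    by exists [set n | `|v n| <= M].
  apply: ge_ereal_sup => _ [n /= vn <-]; rewrite lee_fin.
  exact: le_trans (ler_norm _) vn.
move=> uM; have le1 := up u uM.
have le2 : (- M%:E <= limn_esup (EFin \o u))%E.
  apply: le_trans (limn_einf_sup _); rewrite /limn_einf leeN2.
  have -> : (\- (EFin \o u))%E = EFin \o (\- u) by [].
  by apply: up; apply: filterS uM => n; rewrite /= normrN.
move: le1 le2; case: (limn_esup _) => [x| |] //=.
by rewrite !lee_fin ler_norml => -> ->.
Qed.
End LimsupBound.

(** An upper directional derivative is measurable without any null set to
discard; the sequence of steps is countable for that reason, and [H] is extended
by zero so that the quotients are total. *)
Definition upper_diff {R : realType} (V : set (R * R)) (H : R * R -> R)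
    (e p : R * R) : R :=
  fine (limn_esup (fun n =>
    (n.+1%:R * ((H \_ V) (p + n.+1%:R^-1 *: e) - (H \_ V) p))%:E)).

Section WeakDerivativeLip.
Context {R : realType}.
Variables (V : set (R * R)) (H : R * R -> R) (e : R * R).
Hypotheses (oV : open V) (Hl : forall p, V p -> loc_lip H p) (e1 : `|e| = 1).

Let Ht : R * R -> R := H \_ V.
Let quot n p := n.+1%:R * (Ht (p + n.+1%:R^-1 *: e) - Ht p).
Let g : R * R -> R := upper_diff V H e.
Let line (p0 : R * R) (t : R) : R * R := p0 + t *: e.

Let HtE p : V p -> Ht p = H p.
Proof. by move=> Vp; rewrite /Ht patchE mem_set. Qed.

Let Ht_lip p : V p -> loc_lip Ht p.
Proof.
move=> Vp; have [e0 [L [e00 HL]]] := Hl Vp.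
have /nbhs_ballP[r /= r0 rV] : nbhs p V by exact: open_nbhs_nbhs.
exists (Num.min e0 r), L; split; first by rewrite lt_min e00.
move=> s s'; rewrite !lt_min => /andP[se sr] /andP[s'e s'r].
by rewrite !HtE; [exact: HL|apply: rV; rewrite -ball_normE /ball_/= distrC..].
Qed.

Let mHt : measurable_fun setT Ht.
Proof.
apply/(measurable_restrictT _ (open_measurable2 oV)).
by apply: continuous_measurable2 => // p Vp; apply: loc_lip_cvg; exact: Hl.
Qed.

Let mg : measurable_fun setT g.
Proof.
apply: (measurableT_comp (@fine_measurable _ _ measurableT)).
apply: measurable_fun_limn_esup => n; apply/measurable_EFinP.
apply: measurable_funM => //; apply: measurable_funB => //.
apply: (measurableT_comp mHt) => //.
have E : (fun p : R * R => p + n.+1%:R^-1 *: e) =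
    (fun p => (p.1 + n.+1%:R^-1 * e.1, p.2 + n.+1%:R^-1 * e.2)).
  by apply/funext => -[x y]; case: e.
by rewrite E; apply: measurable_fun_pair; apply: measurable_funD.
Qed.

Let g_bound p : V p -> exists M, \forall q \near p, `|g q| <= M.
Proof.
move=> /Ht_lip[e0 [L [e00 HL]]]; exists `|L|; apply/nbhs_ballP.
exists (e0 / 2) => /=; first by rewrite divr_gt0.
move=> q; rewrite -ball_normE /ball_/= distrC => qp.
apply: limn_esup_bounded.
have e20 : 0 < e0 / 2 by rewrite divr_gt0.
have /cvgrPdist_lt/(_ _ e20)[N _ NP] := @cvg_harmonic R.
exists N => // n /NP; rewrite /= sub0r normrN => ne.
have qp' : `|q - p| < e0 by lra.
rewrite /quot normrM ger0_norm// mulrC -ler_pdivlMr// (le_trans (HL _ _ _ qp'))//.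
  rewrite addrAC (le_lt_trans (ler_normD _ _))// normrZ e1 mulr1; lra.
rewrite [_ - _]addrAC subrr add0r normrZ e1 mulr1 ger0_norm//.
by rewrite ler_wpM2r// ler_norm.
Qed.

Lemma upper_diff_L2loc : L2loc V (upper_diff V H e).
Proof.
by apply: bounded_L2loc => //; exact: measurable_funTS.
Qed.

Let loc_lip_line p0 (k : R * R -> R) t : loc_lip k (line p0 t) ->
  loc_lip (k \o line p0) t.
Proof.
have lineB s s' : `|line p0 s - line p0 s'| = `|s - s'|.
  by rewrite /line opprD addrACA subrr add0r -scalerBl normrZ e1 mulr1.
move=> [e0 [L [e00 kL]]]; exists e0, L; split => // s s' st s't.
have := kL (line p0 s) (line p0 s'); rewrite !lineB; exact.
Qed.

Let gE p0 t l : V (line p0 t) ->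
  (fun n => n.+1%:R * ((Ht \o line p0) (t + n.+1%:R^-1) - (Ht \o line p0) t))
    @ \oo --> l -> (g \o line p0) t = l.
Proof.
move=> _ cl; rewrite /= /g /upper_diff.
suff : (fun n => (quot n (line p0 t))%:E) @ \oo --> l%:E.
  by move=> /cvg_limn_einf_sup[_ ->].
apply: cvg_EFin; first exact: nearW.
rewrite (_ : _ \o _ = (fun n => n.+1%:R * ((Ht \o line p0) (t + n.+1%:R^-1)
  - (Ht \o line p0) t)))//.
by apply/funext => n /=; rewrite /quot /line scalerDl addrA.
Qed.

Variable phi : R * R -> R.
Hypothesis tphi : test_function V phi.

Let S := closure [set p | phi p != 0].
Let Psi p := Ht p * 'D_e phi p + g p * phi p.

Let phi0 p : ~ S p -> phi p = 0.
Proof.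
by move=> Sp; apply/eqP/negPn/negP => p0; apply: Sp; exact: subset_closure.
Qed.

Let cS : compact S. Proof. by case: tphi. Qed.
Let SV : S `<=` V. Proof. by case: tphi. Qed.

Let phi_diff p : differentiable phi p.
Proof. by case: tphi => /(_ 1%N)[+ _] _ _; apply. Qed.

Let Dphi_cont p : {for p, continuous (fun q => 'D_e phi q)}.
Proof. by case: tphi => /(_ 1%N)[_ /(_ e) /= +] _ _; apply. Qed.

Let Dphi0 p : ~ S p -> 'D_e phi p = 0.
Proof.
move=> Sp; have pn0 : \forall s \near p, (cst 0) s = phi s.
  have : \forall s \near p, ~ S s.
    by apply: open_nbhs_nbhs; split => //; apply: closed_openC; exact: closed_closure.
  by apply: filterS => s /phi0 ->.
by rewrite -(near_eq_derive _ pn0) derive_cst.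
Qed.

Let mphi : measurable_fun setT phi.
Proof.
apply: continuous_measurable2; first exact: openT.
by move=> p _; exact: differentiable_continuous.
Qed.

Let mDphi : measurable_fun setT (fun p => 'D_e phi p).
Proof. by apply: continuous_measurable2; first exact: openT. Qed.

Let mPsi : measurable_fun setT Psi.
Proof. exact: (measurable_funD (measurable_funM mHt mDphi) (measurable_funM mg mphi)). Qed.

Let is_derive_line p0 t :
  is_derive t (1 : R) (phi \o line p0) ('D_e phi (line p0 t)).
Proof. by apply: is_derive_along; exact: diff_derivable. Qed.

Lemma line_integral_upper_diff p0 : (\int[@lebesgue_measure R]_t (Psi (line p0 t))%:E = 0)%E.
Proof.
have [M SM] := compact_norm_bound cS.
have lc : continuous (line p0).
  move=> t; apply: cvgD; first exact: cvg_cst.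
  by apply: cvgZr_tmp; exact: cvg_id.
pose N := `|M| + `|p0| + 1.
apply: (@line_integral_zero _ (Ht \o line p0) (phi \o line p0)
  (fun t => 'D_e phi (line p0 t)) (g \o line p0) (line p0 @^-1` V)
  (line p0 @^-1` S) (- N) N).
- by rewrite gtrN// /N; have := normr_ge0 M; have := normr_ge0 p0; lra.
- apply: closed_comp => [t _|]; [exact: lc|exact: closed_closure].
- by move=> t /SV.
- move=> t /SM; rewrite /line => ltM; rewrite /= in_itv/= -ltr_norml.
  have : `|t| <= `|p0 + t *: e| + `|p0|.
    rewrite -[X in X <= _]mulr1 -e1 -normrZ -{1}(addKr p0 (t *: e)) addrC.
    by rewrite (le_trans (ler_normB _ _)).
  by have := ler_norm M; rewrite /N; lra.
- by move=> t Vt; apply: loc_lip_line; exact: Ht_lip.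
- exact: is_derive_line.
- move=> t; apply: loc_lip_C1; first exact: is_derive_line.
  by apply: (@continuous_comp _ _ _ (line p0) (fun q => 'D_e phi q)); [exact: lc|].
- by move=> t /phi0.
- by move=> t l; exact: gE.
- apply: (measurableT_comp mPsi).
  rewrite (_ : line p0 = (fun t => (p0.1 + t * e.1, p0.2 + t * e.2))).
    by apply: measurable_fun_pair; apply: measurable_funD => //; apply: measurable_funM.
  by apply/funext => t; rewrite /line; case: (p0) => x y; case: e.
Qed.

Let Psi1 p := Ht p * 'D_e phi p.
Let Psi2 p := g p * phi p.

Let bounded_on_S (f : R * R -> R) :
  (forall p, S p -> exists M : R, \forall q \near p, `|f q| <= M) ->
  exists M : R, forall p, S p -> `|f p| <= M.
Proof.
move=> fb; apply: (@compact_locally_bounded _ _ S (fun p M => `|f p| <= M)) => //.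
by move=> p M N MN /le_trans; apply.
Qed.

Let cont_bound (f : R * R -> R) p : {for p, continuous f} ->
  exists M : R, \forall q \near p, `|f q| <= M.
Proof. by move=> /near_cont_bound; exists (`|f p| + 1). Qed.

Let bounded_on_SM (f k : R * R -> R) :
  (exists M : R, forall p, S p -> `|f p| <= M) ->
  (exists M : R, forall p, S p -> `|k p| <= M) ->
  exists M : R, forall p, S p -> `|f p * k p| <= M.
Proof.
move=> [M1 f1] [M2 k2]; exists (M1 * M2) => p Sp.
by rewrite normrM ler_pM// ?f1 ?k2.
Qed.

Let Psi1_int : leb2.-integrable setT (EFin \o Psi1).
Proof.
apply: (bounded_supp_integrable cS) => [||p /Dphi0 p0].
- exact: measurable_funM mHt mDphi.
- apply: bounded_on_SM; apply: bounded_on_S => p Sp; apply: cont_bound.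
    by apply: loc_lip_cvg; apply: Ht_lip; exact: SV.
  exact: Dphi_cont.
- by rewrite /Psi1 p0 mulr0.
Qed.

Let Psi2_int : leb2.-integrable setT (EFin \o Psi2).
Proof.
apply: (bounded_supp_integrable cS) => [||p /phi0 p0].
- exact: measurable_funM mg mphi.
- apply: bounded_on_SM; apply: bounded_on_S => p Sp; first exact: g_bound (SV Sp).
  by apply: cont_bound; exact: differentiable_continuous.
- by rewrite /Psi2 p0 mulr0.
Qed.

Lemma upper_diff_integrable : leb2.-integrable setT (EFin \o Psi).
Proof. exact: integrableD Psi1_int Psi2_int. Qed.

Lemma weak_derivative_quot : (\int[leb2]_p (Psi p)%:E = 0)%E ->
  \int[leb2]_(p in V) (H p * 'D_e phi p) = - \int[leb2]_(p in V) (g p * phi p).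
Proof.
move=> Psi0.
have -> : \int[leb2]_(p in V) (H p * 'D_e phi p) = \int[leb2]_p Psi1 p.
  rewrite Rintegral_mkcond; apply: eq_Rintegral => p _.
  rewrite patchE /Psi1 /Ht patchE; case: ifPn => //.
  by rewrite mul0r.
have -> : \int[leb2]_(p in V) (g p * phi p) = \int[leb2]_p Psi2 p.
  rewrite Rintegral_mkcond; apply: eq_Rintegral => p _.
  rewrite patchE /Psi2; case: ifPn => //; rewrite notin_setE => Vp.
  by rewrite phi0 ?mulr0// => /SV.
apply/eqP; rewrite -addr_eq0 -RintegralD//; apply/eqP.
by rewrite /Rintegral Psi0.
Qed.
End WeakDerivativeLip.

Section LocLipH1.
Context {R : realType}.

(** Fubini reduces the weak formulation to the lines in the direction of
differentiation, on each of which it is integration by parts for a Lipschitz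
function of one variable. *)
Lemma loc_lip_H1loc (V : set (R * R)) (H : R * R -> R) : open V ->
  (forall p, V p -> loc_lip H p) -> H1loc V H.
Proof.
move=> oV Hl.
have Hc p : V p -> {for p, continuous H} by move=> /Hl; exact: loc_lip_cvg.
split.
  apply: bounded_L2loc => //; first exact: continuous_measurable2.
  by move=> p /Hc /near_cont_bound; exists (`|H p| + 1).
move=> e he.
have e1 : `|e| = 1.
  by case: he => ->; rewrite prod_normE/= normr1 normr0 /Num.max ?ltr10 ?ltr01.
exists (upper_diff V H e); split; first exact: upper_diff_L2loc.
move=> phi tphi; apply: weak_derivative_quot => //.
have Psi_int := upper_diff_integrable oV Hl e1 tphi.
have line0 := line_integral_upper_diff oV Hl e1 tphi.
case: he => eE.
- rewrite -[LHS](integral21_prod_meas1 Psi_int).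
  rewrite -[RHS](@integral0 _ _ _ (@lebesgue_measure R) setT); apply: eq_integral => y _.
  rewrite -[RHS](line0 (0, y)); apply: eq_integral => x _.
  have -> // : (0, y) + x *: e = (x, y).
  by rewrite eE; congr pair; rewrite /= ?add0r ?scaler0 ?addr0// [_ *: _]mulr1.
- rewrite -[LHS](integral12_prod_meas1 Psi_int).
  rewrite -[RHS](@integral0 _ _ _ (@lebesgue_measure R) setT); apply: eq_integral => x _.
  rewrite -[RHS](line0 (x, 0)); apply: eq_integral => y _.
  have -> // : (x, 0) + y *: e = (x, y).
  by rewrite eE; congr pair; rewrite /= ?add0r ?scaler0 ?addr0// [_ *: _]mulr1.
Qed.
End LocLipH1.

(** * Uniform expansions near the surface *)

Section MeanValue.
Context {R : realType}.

Lemma segment_ball (V : normedModType R) (a x v : V) (r t : R) : 0 <= t <= 1 ->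
  `|x - a| < r -> `|x + v - a| < r -> `|x + t *: v - a| < r.
Proof.
move=> /andP[t0 t1] xr yr.
rewrite (_ : _ - a = (1 - t) *: (x - a) + t *: (x + v - a)); last first.
  rewrite [x + v - a]addrAC [t *: (x - a + v)]scalerDr addrA -scalerDl subrK scale1r.
  by rewrite addrAC.
rewrite (le_lt_trans (ler_normD _ _))// !normrZ ger0_norm ?subr_ge0// (ger0_norm t0).
have [->|tn0] := eqVneq t 0; first by rewrite subr0 mul1r mul0r addr0.
have tp : 0 < t by rewrite lt_def tn0.
rewrite (@lt_le_trans _ _ ((1 - t) * r + t * r))//; last by rewrite -mulrDl subrK mul1r.
by rewrite ler_ltD// ?ltr_pM2l// ler_wpM2l ?subr_ge0// ltW.
Qed.

Lemma mvt_along (V : normedModType R) (f : V -> R) (x v : V) :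
  (forall t : R, 0 <= t <= 1 -> derivable f (x + t *: v) v) ->
  exists2 c : R, 0 <= c <= 1 & f (x + v) - f x = 'D_v f (x + c *: v).
Proof.
move=> df; pose g (t : R) := f (x + t *: v).
have dg (t : R) : 0 <= t <= 1 -> is_derive t (1 : R) g ('D_v f (x + t *: v)).
  by move=> /df; exact: is_derive_along.
have cg : {within `[(0 : R), 1], continuous g}.
  apply: derivable_within_continuous => t; rewrite in_itv/= => /dg dgt.
  exact: ex_derive.
have dgo (t : R) : t \in `]0, 1[ -> is_derive t (1 : R) g ('D_v f (x + t *: v)).
  by rewrite in_itv/= => /andP[t0 t1]; apply: dg; rewrite !ltW.
have [c] := MVT ltr01 dgo cg.
rewrite in_itv/= => /andP[c0 c1]; rewrite subr0 mulr1 => gE.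
exists c; first by rewrite !ltW.
by rewrite -gE /g scale1r scale0r addr0.
Qed.

Lemma deriv_bound_lip (V : normedModType R) (f : V -> R) (a : V) (r B : R) :
  (forall z, `|z - a| < r -> differentiable f z) ->
  (forall z v, `|z - a| < r -> `|'D_v f z| <= B * `|v|) ->
  forall s s', `|s - a| < r -> `|s' - a| < r -> `|f s - f s'| <= B * `|s - s'|.
Proof.
move=> df fB s s' sr s'r.
have sE : s = s' + (s - s') by rewrite subrKC.
have [|c c01] := @mvt_along _ f s' (s - s').
  move=> t t01; apply: diff_derivable; apply: df; apply: segment_ball => //.
  by rewrite -sE.
rewrite -sE => ->; apply: fB; apply: segment_ball => //.
by rewrite -sE.
Qed.

Lemma near_ball (V : normedModType R) (a : V) (P : V -> Prop) :
  (\forall z \near a, P z) -> exists2 r : R, 0 < r & forall z, `|z - a| < r -> P z.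
Proof.
move=> /nbhs_ballP[r /= r0 rP]; exists r => // z za; apply: rP.
by rewrite -ball_normE /ball_/= distrC.
Qed.
End MeanValue.

Section RowCalculus.
Context {R : realType} {n : nat}.
Implicit Types (x v : 'rV[R]_n.+1).

Lemma row_entry_le x i : `|x 0 i| <= `|x|.
Proof.
rewrite [leRHS]mx_normrE; apply: (@le_bigmax _ _ _ (0 : R)
  (fun ij : 'I_1 * 'I_n.+1 => `|x ij.1 ij.2|) (0, i)).
Qed.

Lemma derive_row_sum (f : 'rV[R]_n.+1 -> R) x v : differentiable f x ->
  'D_v f x = \sum_j v 0 j * 'D_('e_j) f x.
Proof.
move=> df; rewrite deriveE// {1}[v]row_sum_delta linear_sum; apply: eq_bigr => j _.
by rewrite linearZ deriveE.
Qed.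

Lemma C1_loc_lip (f : 'rV[R]_n.+1 -> R) (a : 'rV[R]_n.+1) :
  (\forall z \near a, differentiable f z) ->
  (forall j, {for a, continuous (fun z => 'D_('e_j) f z)}) -> loc_lip f a.
Proof.
move=> df cf.
have bnd j : \forall z \near a, `|'D_('e_j) f z| <= `|'D_('e_j) f a| + 1.
  exact: near_cont_bound.
have [r1 r10 dr] := near_ball df.
have [r2 r20 br] := near_ball (filter_forall _ bnd).
exists (Num.min r1 r2), (\sum_j (`|'D_('e_j) f a| + 1)).
split; first by rewrite lt_min r10.
apply: deriv_bound_lip => [z|z v]; rewrite lt_min => /andP[z1 z2]; first exact: dr.
rewrite derive_row_sum; last exact: dr.
rewrite (le_trans (ler_norm_sum _ _ _))// mulr_suml ler_sum// => j _.
by rewrite normrM mulrC ler_pM// ?row_entry_le// br.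
Qed.

End RowCalculus.

Section SurfaceEstimates.
Context {R : realType}.
Variables (U : set 'rV[R]_3) (F : 'rV[R]_3 -> R) (m : nat).
Hypotheses (oU : open U) (hF : Ck m.+2 U F).
Let Gam := zero_set U F.
Hypothesis hGam : closed_regular_surface U F.

Lemma Ck_continuous (V W : normedModType R) k (A : set V) (f : V -> W) :
  Ck k A f -> forall x, A x -> {for x, continuous f}.
Proof.
by case: k => [|k] /= => [//|[df _] x Ax]; apply: differentiable_continuous; exact: df.
Qed.

Let F_diff x : U x -> differentiable F x.
Proof. by case: hF => + _; apply. Qed.

Let DF_diff v x : U x -> differentiable (fun z => 'D_v F z) x.
Proof. by case: hF => _ /(_ v)[+ _]; apply. Qed.

Let DF_cont v x : U x -> {for x, continuous (fun z => 'D_v F z)}.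
Proof. by move=> /(DF_diff v); exact: differentiable_continuous. Qed.

Let DDF_cont v w x : U x -> {for x, continuous (fun z => 'D_w (fun z => 'D_v F z) z)}.
Proof. by case: hF => _ /(_ v)[_ /(_ w)] /Ck_continuous; apply. Qed.

Let nearU a : U a -> \forall z \near a, U z.
Proof. by move=> Ua; exact: open_nbhs_nbhs. Qed.

(** The gradient of a twice differentiable function with continuous second
derivatives is locally Lipschitz, so the remainder is quadratic. *)
Lemma taylor_near a : U a -> exists r N : R, 0 < r /\ forall x y,
  `|x - a| < r -> `|y - a| < r ->
  U x /\ `|F y - F x - 'D_(y - x) F x| <= N * `|y - x| ^+ 2.
Proof.
move=> Ua.
have DFl j : loc_lip (fun z => 'D_('e_j) F z) a.
  apply: C1_loc_lip => [|i]; last exact: DDF_cont.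
  by apply: filterS (nearU Ua) => z; exact: DF_diff.
have /choice[rL rLP] j : exists p : R * R, 0 < p.1 /\ forall s s',
    `|s - a| < p.1 -> `|s' - a| < p.1 ->
    `|'D_('e_j) F s - 'D_('e_j) F s'| <= p.2 * `|s - s'|.
  by have [e [L HL]] := DFl j; exists (e, L).
have [rU rU0 rUP] := near_ball (nearU Ua).
pose r := Num.min rU (\big[Num.min/rU]_j (rL j).1).
have r0 : 0 < r.
  by rewrite lt_min rU0/=; apply: lt_bigmin => // j _; case: (rLP j).
have rrL z j : `|z - a| < r -> `|z - a| < (rL j).1.
  move=> zr; apply: lt_le_trans zr _; rewrite ge_min; apply/orP; right.
  exact: bigmin_le_cond.
exists r, (\sum_j `|(rL j).2|); split => // x y xr yr.
have rU' z : `|z - a| < r -> U z.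
  by move=> zr; apply: rUP; apply: lt_le_trans zr _; rewrite ge_min lexx.
split; first exact: rU'.
have yE : y = x + (y - x) by rewrite subrKC.
have seg (c : R) : 0 <= c <= 1 -> `|x + c *: (y - x) - a| < r.
  by move=> c01; apply: segment_ball => //; rewrite -yE.
have [t t01|c c01] := @mvt_along _ _ F x (y - x).
  by apply: diff_derivable; apply: F_diff; apply: rU'; exact: seg.
rewrite -yE => ->; have cr := seg c c01.
rewrite !derive_row_sum; [|by apply: F_diff; exact: rU'..].
rewrite -sumrB (le_trans (ler_norm_sum _ _ _))// mulr_suml ler_sum// => j _.
rewrite -mulrBr normrM expr2 mulrCA ler_pM ?row_entry_le//.
have [_ /(_ _ _ (rrL _ j cr) (rrL _ j xr)) h] := rLP j.
rewrite (le_trans h)// addrC addKr normrZ.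
rewrite (@le_trans _ _ (`|(rL j).2| * (`|c| * `|y - x|)))//.
  by rewrite ler_wpM2r ?ler_norm// mulr_ge0.
move: c01 => /andP[c0 c1]; rewrite ler_wpM2l// ger0_norm//.
by rewrite ler_piMl.
Qed.

Lemma surface_grad a : Gam a -> exists i, 'D_('e_i) F a != 0.
Proof.
move=> Ga; have [_ _ _ [e e0 eP]] := hGam.
have /eP[_ ga] : dist_to Gam a < e.
  apply: le_lt_trans e0; apply: ge_inf.
    by exists 0 => _ [x _ <-]; exact: sqrtr_ge0.
  exists a => //; rewrite /enorm subrr big1 ?sqrtr0// => i _.
  by rewrite mxE expr0n.
apply: contrapT => h; move: ga; apply/negP/negPn/eqP.
apply/rowP => i; rewrite !mxE; apply/eqP/negPn/negP => Di; apply: h.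
by exists i.
Qed.

(** One constant serves the remainder, the gradient and the radius: enlarging it
weakens all three estimates, which is the form needed to globalize them over the
compact surface. *)
Lemma uniform_taylor : exists N : R, 0 < N /\ forall z x y, Gam z ->
  `|x - z| < N^-1 -> `|y - z| < N^-1 ->
  [/\ U x, `|F y - F x - 'D_(y - x) F x| <= N * `|y - x| ^+ 2 &
    exists i, N^-1 <= `|'D_('e_i) F x|].
Proof.
have [_ cGam _ _] := hGam.
pose P z N := 0 < N /\ forall x y, `|x - z| < N^-1 -> `|y - z| < N^-1 ->
  [/\ U x, `|F y - F x - 'D_(y - x) F x| <= N * `|y - x| ^+ 2 &
    exists i, N^-1 <= `|'D_('e_i) F x|].
have [||N NP] := @compact_locally_bounded _ _ Gam P cGam.
- move=> z M N MN [M0 MP]; have N0 : 0 < N by exact: lt_le_trans MN.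
  have NM : N^-1 <= M^-1 by rewrite lef_pV2.
  split => // x y xz yz; have [||Ux H [i iM]] := MP x y.
  + exact: lt_le_trans xz NM.
  + exact: lt_le_trans yz NM.
  split => //; last by exists i; exact: le_trans iM.
  by rewrite (le_trans H)// ler_wpM2r// exprn_ge0.
- move=> a [Ua Fa].
  have [r [N [r0 rP]]] := taylor_near Ua.
  have [i Di] := surface_grad (conj Ua Fa).
  have c0 : 0 < `|'D_('e_i) F a| / 2 by rewrite divr_gt0// normr_gt0.
  set d := `|'D_('e_i) F a| in c0.
  have d0 : 0 < d by rewrite normr_gt0.
  have DFa : {for a, continuous (fun z => 'D_('e_i) F z)} by exact: DF_cont.
  move: DFa => /cvgrPdist_lt/(_ _ c0)/near_ball[s s0 sP].
  (* Halving the radii leaves room for moving the center to nearby points. *)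
  pose M := `|N| + 2 / r + 2 / s + 2 / d.
  have [u0 [v0 w0]] : 0 < 2 / r /\ 0 < 2 / s /\ 0 < 2 / d by rewrite !divr_gt0.
  have N0 := normr_ge0 N.
  have M0 : 0 < M by rewrite /M; lra.
  have Mle x : 0 < x -> 2 / x <= M -> M^-1 <= x / 2.
    by move=> x0 xM; rewrite -invf_div lef_pV2// posrE divr_gt0.
  have Mr : M^-1 <= r / 2 by apply: Mle => //; rewrite /M; lra.
  have Ms : M^-1 <= s / 2 by apply: Mle => //; rewrite /M; lra.
  have Md : M^-1 <= d / 2 by apply: Mle => //; rewrite /M; lra.
  exists M; apply/nbhs_ballP; exists (Num.min r s / 2) => /=.
    by rewrite divr_gt0// lt_min r0.
  move=> a'; rewrite -ball_normE /ball_/= distrC ltr_pdivlMr// lt_min.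
  move=> /andP[a'r a's]; split => // x y xa ya.
  have close z t : 0 < t -> `|a' - a| * 2 < t -> M^-1 <= t / 2 -> `|z - a'| < M^-1 ->
      `|z - a| < t.
    move=> t0 a't Mt za; rewrite -[z](subrK a') -addrA.
    by rewrite (le_lt_trans (ler_normD _ _))//; lra.
  have [Ux H] := rP x y (close _ _ r0 a'r Mr xa) (close _ _ r0 a'r Mr ya).
  split => //.
    rewrite (le_trans H)// ler_wpM2r ?exprn_ge0//.
    by have := ler_norm N; rewrite /M; lra.
  exists i; have := sP x (close _ _ s0 a's Ms xa).
  move=> h; rewrite (le_trans Md)//.
  have : d <= `|'D_('e_i) F a - 'D_('e_i) F x| + `|'D_('e_i) F x|.
    by rewrite -[X in `|X| <= _](subrK ('D_('e_i) F x)) ler_normD.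
  by rewrite -lerBlDl; apply: le_trans; rewrite lerBrDl [leRHS](splitr d) lerD2r ltW.
have [[a Ga] _ _ _] := hGam.
exists N; split; first by have [] := NP a Ga.
by move=> z x y /NP[_]; exact.
Qed.
End SurfaceEstimates.

(** * Sign structure of small cells *)

Section Distances.
Context {R : realType}.
Implicit Types (x y : 'rV[R]_3) (T : tet R).

Lemma norm_le_enorm x : `|x| <= enorm x.
Proof.
rewrite [leLHS]mx_normrE; apply: bigmax_le => [|[i j] _ /=]; first exact: sqrtr_ge0.
rewrite -sqrtr_sqr ler_sqrt ?sumr_ge0// => [|k _]; last exact: sqr_ge0.
by rewrite (ord1 i) (bigD1 j)//= lerDl sumr_ge0// => k _; exact: sqr_ge0.
Qed.

Lemma enorm_le_norm x : enorm x <= 2 * `|x|.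
Proof.
have h0 : 0 <= 2 * `|x| by rewrite mulr_ge0.
rewrite -(ger0_norm h0) -sqrtr_sqr ler_sqrt ?sqr_ge0//.
have sq (i : 'I_3) : x 0 i ^+ 2 <= `|x| ^+ 2.
  by rewrite -[leLHS]real_normK ?num_real// lerXn2r ?nnegrE// row_entry_le.
have := ler_sum (index_enum 'I_3) (fun i (_ : true) => sq i); move=> /le_trans; apply.
rewrite sumr_const card_ord exprMn -[leLHS]mulr_natl ler_wpM2r ?exprn_ge0//.
by rewrite expr2 -natrM ler_nat.
Qed.

Lemma enorm_axis (s : R) (i : 'I_3) : enorm (s *: 'e_i) = `|s|.
Proof.
rewrite /enorm (bigD1 i)//= big1 => [|j ji]; last first.
  by rewrite !mxE/= (negbTE ji) mulr0 expr0n.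
by rewrite !mxE/= eqxx mulr1 addr0 sqrtr_sqr.
Qed.

Lemma hull_norm_le T x : hull T x -> `|x| <= \sum_i `|T i|.
Proof.
move=> [l [l0 _ l1 ->]]; rewrite (le_trans (ler_norm_sum _ _ _))// ler_sum// => i _.
rewrite normrZ ger0_norm// ler_piMl// -l1 (bigD1 i)//= lerDl.
by rewrite sumr_ge0.
Qed.

Lemma enorm_le_diam T x y : hull T x -> hull T y -> enorm (x - y) <= diam (hull T).
Proof.
move=> Tx Ty; apply: ub_le_sup; last by exists x, y.
exists (2 * (\sum_i `|T i| + \sum_i `|T i|)) => _ [a [b [Ta Tb ->]]].
rewrite (le_trans (enorm_le_norm _))// ler_wpM2l//.
by rewrite (le_trans (ler_normB _ _))// lerD// hull_norm_le.
Qed.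

Lemma diam_le_mesh_size (Th : seq (tet R)) T : T \in Th ->
  diam (hull T) <= mesh_size Th.
Proof. by move=> TTh; exact: (@le_bigmax_seq _ _ _ _ _ T xpredT _ TTh isT). Qed.

Lemma dist_to_le (A : set 'rV[R]_3) x a : A a -> dist_to A x <= enorm (x - a).
Proof.
move=> Aa; apply: ge_inf; last by exists a.
by exists 0 => _ [y _ <-]; exact: sqrtr_ge0.
Qed.

Lemma hull_vertex T i : hull T (T i).
Proof.
exists (fun j => (j == i)%:R); split => [j|j|| ] //; first by rewrite inE.
  by rewrite (bigD1 i)//= eqxx big1 ?addr0// => j /negbTE ->.
rewrite (bigD1 i)//= eqxx scale1r big1 ?addr0// => j /negbTE ->.
by rewrite scale0r.
Qed.

Lemma hull_on_sub T (A : {set 'I_4}) : hull_on T A `<=` hull T.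
Proof. by move=> x [l [l0 lA l1 ->]]; exists l; split => // i; rewrite inE. Qed.

Lemma hull_segment n (p : 'I_n -> 'rV[R]_3) x y (t : R) :
  hull p x -> hull p y -> 0 <= t <= 1 -> hull p ((1 - t) *: x + t *: y).
Proof.
move=> [l [l0 _ l1 ->]] [k [k0 _ k1 ->]] /andP[t0 t1].
exists (fun i => (1 - t) * l i + t * k i); split.
- by move=> i; rewrite addr_ge0// mulr_ge0// subr_ge0.
- by move=> i; rewrite inE.
- by rewrite big_split/= -!mulr_sumr l1 k1 !mulr1 subrK.
- rewrite !scaler_sumr -big_split/=; apply: eq_bigr => i _.
  by rewrite !scalerA -scalerDl.
Qed.
End Distances.

Section CutTetrahedra.
Context {R : realType}.
Implicit Types (T : tet R) (F psi : 'rV[R]_3 -> R).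

Definition pos_face F T := hull_on T [set i | 0 < F (T i)].
Definition neg_face F T := hull_on T [set i | F (T i) < 0].

(** Shared by [F] and by the functions whose zero sets are the linear patches, so
that the surface and its discretization can be treated alike. *)
Definition separating F T psi :=
  [/\ forall x, hull T x -> {for x, continuous psi},
      forall x, pos_face F T x -> 0 < psi x,
      forall y, neg_face F T y -> psi y < 0 &
      forall x y s t, pos_face F T x -> neg_face F T y ->
        0 <= s -> s < t -> t <= 1 ->
        psi ((1 - t) *: x + t *: y) < psi ((1 - s) *: x + s *: y)].

(** All that remains of the smallness of the mesh: a property of a single
cell, which relabeling its vertices preserves. *)
Definition cut_tet (U : set 'rV[R]_3) F T :=
  [/\ Defs.nondegenerate T, hull T `<=` U, forall i, F (T i) != 0,
      (exists i, 0 < F (T i)) /\ (exists i, F (T i) < 0) & separating F T F].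
End CutTetrahedra.

Section VertexValues.
Context {R : realType}.
Variables (U : set 'rV[R]_3) (F : 'rV[R]_3 -> R) (m : nat).
Hypotheses (oU : open U) (hF : Ck m.+2 U F) (hGam : closed_regular_surface U F).
Let Gam := zero_set U F.

Let F_diff x : U x -> differentiable F x.
Proof. by case: hF => + _; apply. Qed.

(** Move from [A] by [eta * h / 2] along an axis on which the gradient is bounded
below, in the direction in which the modulus of [F] decreases. No zero is met,
the surface being farther away, so [F] keeps its sign although it has dropped by
at least a fixed multiple of [eta * h]. *)
Lemma vertex_bound (N h eta : R) (A z : 'rV[R]_3) :
  0 < N -> (forall z x y, Gam z ->
    `|x - z| < N^-1 -> `|y - z| < N^-1 ->
    [/\ U x, `|F y - F x - 'D_(y - x) F x| <= N * `|y - x| ^+ 2 &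
      exists i, N^-1 <= `|'D_('e_i) F x|]) ->
  0 < h -> 2 * h < N^-1 -> N * h < N^-1 -> 0 < eta ->
  Gam z -> enorm (A - z) <= h -> F A != 0 ->
  eta * h <= dist_to Gam A -> eta / (4 * N) * h <= `|F A|.
Proof.
move=> N0 NP h0 hN hN2 eta0 Gz Az FA0 dA.
have Az' : `|A - z| <= h by exact: le_trans (norm_le_enorm _) Az.
have N1 : 0 < N^-1 by rewrite invr_gt0.
have AN : `|A - z| < N^-1 by lra.
have etah : eta * h <= h.
  by rewrite (le_trans dA)// (le_trans (dist_to_le _ Gz)).
have eh0 : 0 < eta * h by rewrite mulr_gt0.
have [_ _ [i Di]] := NP _ _ _ Gz AN AN.
pose s := eta * h / 2.
pose D := 'D_('e_i) F A.
pose tau := - s * (Num.sg (F A) * Num.sg D).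
have s0 : 0 < s by rewrite divr_gt0.
have D0 : D != 0 by rewrite -normr_gt0 (lt_le_trans N1).
have tauE : `|tau| = s.
  by rewrite /tau normrM normrN normrM !normr_sg FA0 D0 !mulr1 gtr0_norm.
pose B (t : R) := A + t *: (tau *: 'e_i).
have Be t : B t - A = (t * tau) *: 'e_i by rewrite /B addrC addKr scalerA.
have Bs t : 0 <= t <= 1 -> enorm (B t - A) <= s.
  move=> /andP[t0 t1]; rewrite Be enorm_axis normrM tauE ger0_norm//.
  by rewrite ler_piMl// ltW.
have Bz t : 0 <= t <= 1 -> `|B t - z| < N^-1.
  move=> t01; rewrite -[B t](subrK A) -addrA (le_lt_trans (ler_normD _ _))//.
  have := le_trans (norm_le_enorm _) (Bs _ t01).
  by rewrite /s => ?; lra.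
have UB t : 0 <= t <= 1 -> U (B t).
  by move=> /Bz tz; have [] := NP _ _ _ Gz tz tz.
have BF t : 0 <= t <= 1 -> F (B t) != 0.
  move=> t01; apply/eqP => FB.
  have GB : Gam (B t) by split; [exact: UB|].
  have := le_trans dA (dist_to_le A GB).
  have -> : enorm (A - B t) = enorm (B t - A).
    by rewrite -opprB Be -scaleNr !enorm_axis normrN.
  by have := Bs _ t01; rewrite /s => ? ?; lra.
have B1 : 0 < Num.sg (F A) * F (B 1).
  rewrite ltNge; apply/negP => FB1.
  pose g (t : R) := Num.sg (F A) * F (B t).
  have cg : {within `[(0 : R), 1], continuous g}.
    apply: continuous_in_subspaceT => t; rewrite inE/= in_itv/= => t01.
    apply: cvgMl_tmp; apply: (@continuous_comp _ _ _ B F).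
      by apply: cvgD; [exact: cvg_cst|apply: cvgZr_tmp; exact: cvg_id].
    by apply: differentiable_continuous; apply: F_diff; exact: UB.
  have g0 : g 0 = `|F A| by rewrite /g /B scale0r addr0 -normrEsg.
  have [|c c01 gc] := @IVT _ g 0 1 0 ler01 cg.
    by rewrite g0 ge_min le_max normr_ge0 /= FB1 orbT.
  move: c01; rewrite in_itv/= => /BF; apply/negP/negPn.
  by move/eqP: gc; rewrite mulf_eq0 sgr_eq0 (negbTE FA0).
have [UA + _] := NP _ _ (B 1) Gz AN (Bz 1 (ltac:(by rewrite ler01 lexx))).
have B1s : `|B 1 - A| <= s.
  by apply: le_trans (norm_le_enorm _) _; apply: Bs; rewrite ler01 lexx.
have NB : N * `|B 1 - A| ^+ 2 <= N * s ^+ 2.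
  by apply: (ler_wpM2l (ltW N0)); rewrite !expr2 ler_pM.
have DE : 'D_(B 1 - A) F A = tau * D.
  have dA' := F_diff UA.
  by rewrite Be mul1r deriveE// linearZ /D deriveE.
rewrite DE => /le_trans/(_ NB) T1.
have T2 : Num.sg (F A) * (F (B 1) - F A - tau * D) <= N * s ^+ 2.
  by rewrite (le_trans _ T1)// (le_trans (ler_norm _))// normrM normr_sg FA0 mul1r.
have sgA : Num.sg (F A) * Num.sg (F A) = 1.
  by rewrite -sgrM -expr2 gtr0_sg// exprn_even_gt0.
have E : Num.sg (F A) * (F (B 1) - F A - tau * D) =
    Num.sg (F A) * F (B 1) - `|F A| + s * `|D|.
  rewrite (normrEsg (F A)) (normrEsg D) /tau.
  rewrite [in RHS](_ : s * (Num.sg D * D) =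
    s * ((Num.sg (F A) * Num.sg (F A)) * Num.sg D * D)); last by rewrite sgA mul1r.
  by ring.
rewrite E in T2.
have h1 : s * N^-1 <= s * `|D| by rewrite (ler_wpM2l (ltW s0)).
have h2 : s * (N * s) <= s * (N^-1 / 2).
  apply: (ler_wpM2l (ltW s0)); rewrite /s.
  have : N * (eta * h) <= N * h by rewrite (ler_wpM2l (ltW N0)).
  by lra.
have -> : eta / (4 * N) * h = s * N^-1 / 2 by rewrite /s; field; rewrite gt_eqF.
move: T2 B1 h1 h2; rewrite expr2 mulrCA; lra.
Qed.
End VertexValues.

Section LinearGrowth.
Context {R : realType}.
Variables (U : set 'rV[R]_3) (F : 'rV[R]_3 -> R) (m : nat).
Hypotheses (oU : open U) (hF : Ck m.+2 U F) (hGam : closed_regular_surface U F).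
Let Gam := zero_set U F.

Let F_diff x : U x -> differentiable F x.
Proof. by case: hF => + _; apply. Qed.

Let ar1 (S f p q : R) : 3 * p < q -> 0 < p -> `|S - f| <= p -> q <= S -> 0 < f.
Proof. by move=> ? ?; rewrite ler_norml => /andP[? ?] ?; lra. Qed.

Let ar2 (S f p q : R) : 3 * p < q -> 0 < p -> `|S - f| <= p -> S <= - q -> f < 0.
Proof. by move=> ? ?; rewrite ler_norml => /andP[? ?] ?; lra. Qed.

Let ar3 (S1 S2 f d1 d2 p q : R) : `|S1 - f - d1| <= p -> `|S2 - f - d2| <= p ->
  q <= S1 -> S2 <= - q -> d2 - d1 <= - 2 * q + 2 * p.
Proof. by rewrite !ler_norml => /andP[? ?] /andP[? ?] ? ?; lra. Qed.

Let ar4 (fa fb u D e p q : R) : 3 * p < q -> 0 < p -> 0 < u ->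
  `|fb - fa - u * D| <= e -> e <= u * p -> D <= - 2 * q + 2 * p -> fb < fa.
Proof.
move=> pq p0 u0; rewrite ler_norml => /andP[_ h] eu Dq.
have h1 : u * D <= u * (- 2 * q + 2 * p) by rewrite (ler_wpM2l (ltW u0)).
have h2 : u * (3 * p - 2 * q) < 0 by rewrite pmulr_rlt0//; lra.
lra.
Qed.

(** On the cell [F] is within [N h^2] of the affine function with the same values
at the vertices, while those values are at least [c h] in modulus. For
[3 N h < c] the signs on the two faces and the monotonicity along joins are
therefore those of the affine function. *)
Lemma cut_tet_of_bounds (T : tet R) (N h c : R) :
  Defs.nondegenerate T -> hull T `<=` U ->
  (forall x y, hull T x -> hull T y ->
    `|F y - F x - 'D_(y - x) F x| <= N * `|y - x| ^+ 2) ->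
  (forall x y, hull T x -> hull T y -> `|y - x| <= h) ->
  0 < N -> 0 < h -> (forall i, c * h <= `|F (T i)|) -> 3 * N * h < c ->
  (hull T `&` Gam) !=set0 -> cut_tet U F T.
Proof.
move=> nT TU tay Th N0 h0 Fc Nc [z [Tz [Uz Fz]]].
have c0 : 0 < c by apply: lt_trans Nc; rewrite !mulr_gt0.
have ch0 : 0 < c * h by rewrite mulr_gt0.
have Nch : 3 * (N * h ^+ 2) < c * h.
  by rewrite expr2 !mulrA ltr_pM2r.
have Nh0 : 0 < N * h ^+ 2 by rewrite mulr_gt0// exprn_gt0.
have tayh x y : hull T x -> hull T y ->
    `|F y - F x - 'D_(y - x) F x| <= N * h ^+ 2.
  move=> Tx Ty; rewrite (le_trans (tay _ _ Tx Ty))// (ler_wpM2l (ltW N0))//.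
  by rewrite !expr2 ler_pM// Th.
have F0 i : F (T i) != 0 by rewrite -normr_gt0 (lt_le_trans ch0).
have lin x (l : 'I_4 -> R) : hull T x -> (forall i, 0 <= l i) -> \sum_i l i = 1 ->
    `|\sum_i l i * F (T i) - F x - 'D_(\sum_i l i *: T i - x) F x| <= N * h ^+ 2.
  move=> Tx l0 l1.
  have dx := F_diff (TU _ Tx).
  have -> : \sum_i l i * F (T i) - F x - 'D_(\sum_i l i *: T i - x) F x =
      \sum_i l i * (F (T i) - F x - 'D_(T i - x) F x).
    have -> : \sum_i l i *: T i - x = \sum_i l i *: (T i - x).
      rewrite -[in LHS](scale1r x) -l1 scaler_suml -sumrB; apply: eq_bigr => i _.
      by rewrite scalerBr.
    rewrite deriveE// linear_sum -{1}[F x]mul1r -l1 mulr_suml -!sumrB.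
    apply: eq_bigr => i _; rewrite deriveE// !mulrBr.
    have -> // : 'd F x (l i *: (T i - x)) = l i * 'd F x (T i - x) by exact: linearZ.
  rewrite (le_trans (ler_norm_sum _ _ _))//.
  rewrite -[leRHS]mul1r -l1 mulr_suml ler_sum// => i _.
  by rewrite normrM (ger0_norm (l0 i)) ler_wpM2l// tayh//; exact: hull_vertex.
have posF x : pos_face F T x -> exists l : 'I_4 -> R, [/\ forall i, 0 <= l i,
    \sum_i l i = 1, x = \sum_i l i *: T i & c * h <= \sum_i l i * F (T i)].
  move=> [l [l0 lA l1 xE]]; exists l; split => //.
  rewrite -[leLHS]mul1r -l1 mulr_suml ler_sum// => i _.
  have [iA|/lA ->] := boolP (i \in [set i | 0 < F (T i)]%SET); last by rewrite !mul0r.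
  by rewrite ler_wpM2l// -(gtr0_norm (_ : 0 < F (T i))); rewrite inE in iA.
have negF x : neg_face F T x -> exists l : 'I_4 -> R, [/\ forall i, 0 <= l i,
    \sum_i l i = 1, x = \sum_i l i *: T i & \sum_i l i * F (T i) <= - (c * h)].
  move=> [l [l0 lA l1 xE]]; exists l; split => //.
  rewrite -[leRHS]mul1r -l1 mulr_suml ler_sum// => i _.
  have [iA|/lA ->] := boolP (i \in [set i | F (T i) < 0]%SET); last first.
    by rewrite !mul0r.
  rewrite ler_wpM2l// lerNr -(ltr0_norm (_ : F (T i) < 0))//.
  by rewrite inE in iA.
have hull0 x y l : hull T x -> x = \sum_i l i *: T i -> y = x ->
  'D_(\sum_i l i *: T i - x) F x = 0.
  by move=> Tx <- _; rewrite subrr deriveE ?linear0//; exact/F_diff/TU.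
have zsum (l : 'I_4 -> R) : (forall i, 0 <= l i) -> \sum_i l i = 1 ->
    z = \sum_i l i *: T i -> `|\sum_i l i * F (T i)| <= N * h ^+ 2.
  by move=> l0 l1 zE; have := lin _ _ Tz l0 l1; rewrite (hull0 _ _ _ Tz zE erefl) Fz !subr0.
have [l [l0 _ l1 zE]] := Tz.
have bz := zsum _ l0 l1 zE.
split => //.
  split; apply: contrapT => Hn.
    have Fn i : F (T i) < 0.
      by rewrite lt_neqAle F0 leNgt; apply/negP => ?; apply: Hn; exists i.
    rewrite -[\sum_i _]subr0 in bz.
    have := ar2 Nch Nh0 bz; rewrite ltxx => /(_ _)/notF; apply.
    rewrite -[leRHS]mul1r -l1 mulr_suml ler_sum// => i _.
    by rewrite ler_wpM2l// lerNr -(ltr0_norm (Fn i)).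
  have Fp i : 0 < F (T i).
    by rewrite lt_neqAle eq_sym F0 leNgt; apply/negP => ?; apply: Hn; exists i.
  rewrite -[\sum_i _]subr0 in bz.
  have := ar1 Nch Nh0 bz; rewrite ltxx => /(_ _)/notF; apply.
  rewrite -[leLHS]mul1r -l1 mulr_suml ler_sum// => i _.
  by rewrite ler_wpM2l// -(gtr0_norm (Fp i)).
split.
- by move=> x Tx; apply: differentiable_continuous; exact/F_diff/TU.
- move=> x px; have Tx := hull_on_sub px; have [k [k0 k1 xE kF]] := posF x px.
  have := lin _ _ Tx k0 k1; rewrite (hull0 _ _ _ Tx xE erefl) subr0.
  by move=> /(ar1 Nch Nh0); apply.
- move=> x nx; have Tx := hull_on_sub nx; have [k [k0 k1 xE kF]] := negF x nx.
  have := lin _ _ Tx k0 k1; rewrite (hull0 _ _ _ Tx xE erefl) subr0.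
  by move=> /(ar2 Nch Nh0); apply.
move=> x y s t px ny s0 st t1.
have [Tx Ty] := (hull_on_sub px, hull_on_sub ny).
have [k [k0 k1 xE kF]] := posF x px; have [k' [k'0 k'1 yE k'F]] := negF y ny.
set a := (1 - s) *: x + s *: y; set b := (1 - t) *: x + t *: y.
have Ta : hull T a by apply: hull_segment => //; rewrite s0 (le_trans (ltW st)).
have Tb : hull T b by apply: hull_segment => //; rewrite t1 (le_trans s0 (ltW st)).
have da := F_diff (TU _ Ta).
have baE : b - a = (t - s) *: (y - x).
  by apply/rowP => i; rewrite /a /b !mxE; ring.
have Dyx : 'D_(y - x) F a <= - 2 * (c * h) + 2 * (N * h ^+ 2).
  have := lin _ _ Ta k0 k1; have := lin _ _ Ta k'0 k'1; rewrite -xE -yE.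
  have -> : y - x = (y - a) - (x - a) by rewrite opprB addrA subrK.
  have -> : 'D_(y - a - (x - a)) F a = 'D_(y - a) F a - 'D_(x - a) F a.
    by rewrite !deriveE// linearB.
  by move=> h1 h2; exact: ar3 h2 h1 kF k'F.
have ts0 : 0 < t - s by rewrite subr_gt0.
have ts1 : t - s <= 1 by rewrite lerBlDr (le_trans t1)// lerDl.
have := tay _ _ Ta Tb; rewrite baE.
have -> : 'D_((t - s) *: (y - x)) F a = (t - s) * 'D_(y - x) F a.
  by rewrite !deriveE//; exact: linearZ.
rewrite normrZ (gtr0_norm ts0) => tb.
apply: (ar4 Nch Nh0 ts0 tb _ Dyx); rewrite [leRHS]mulrCA.
apply: (ler_wpM2l (ltW N0)).
have yx : `|y - x| <= h by exact: Th.
rewrite exprMn; apply: ler_pM; rewrite ?exprn_ge0 ?(ltW ts0)//.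
  by rewrite expr2 ler_piMr// ltW.
by rewrite !expr2 ler_pM.
Qed.
End LinearGrowth.

Section ActiveCells.
Context {R : realType}.
Variables (U : set 'rV[R]_3) (F : 'rV[R]_3 -> R) (m : nat) (J : Type)
  (Th : J -> seq (tet R)).

(** The four conditions on [h0] allow, in this order, the use of the admissibility
bounds, of the expansions on a whole cell, and of the vertex bound, and make the
Taylor error smaller than the vertex values. *)
Lemma active_cut_tet : open U -> Ck m.+2 U F -> closed_regular_surface U F ->
  (forall j, tetrahedral_mesh U (Th j)) -> admissible_family U F Th ->
  exists2 h0 : R, 0 < h0 & forall j, mesh_size (Th j) < h0 ->
    forall T, active U F (Th j) T -> cut_tet U F T.
Proof.
move=> oU hF hGam hTh [sigma [eta [C [h1 [_ eta0 _ h10 hadm]]]]].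
have [N [N0 NP]] := uniform_taylor oU hF hGam.
pose c := eta / (4 * N).
have c0 : 0 < c by rewrite divr_gt0// mulr_gt0.
have N1 : 0 < N^-1 by rewrite invr_gt0.
pose h0 := Num.min (Num.min h1 (N^-1 / 2)) (Num.min (N^-1 / N) (c / (3 * N))).
exists h0.
  by rewrite !lt_min h10 !divr_gt0// mulr_gt0.
move=> j; set h := mesh_size (Th j); rewrite !lt_min.
move=> /andP[/andP[hh1 hN] /andP[hNN hc]] T aT.
have [TTh [z [Tz Gz]]] := aT.
have [_ hGv heta _] := hadm j hh1.
have [hnd _ _] := hTh j.
have Th_le x y : hull T x -> hull T y -> enorm (y - x) <= h.
  by move=> Tx Ty; rewrite (le_trans (enorm_le_diam Ty Tx))// diam_le_mesh_size.
have Tz_lt x : hull T x -> `|x - z| < N^-1.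
  move=> Tx; rewrite (le_lt_trans (norm_le_enorm _))//.
  by rewrite (le_lt_trans (Th_le _ _ Tz Tx))//; lra.
have TU x : hull T x -> U x.
  by move=> /Tz_lt xz; have [] := NP _ _ _ Gz xz xz.
have F0 i : F (T i) != 0.
  apply/eqP => Fi; apply: (hGv T i TTh); split => //.
  exact/TU/hull_vertex.
have hp : 0 < h.
  apply: lt_le_trans (Th_le _ _ Tz (hull_vertex T 0)).
  apply: lt_le_trans (norm_le_enorm _); rewrite normr_gt0 subr_eq0.
  by apply/eqP => T0z; apply: (hGv T 0 TTh); rewrite T0z.
apply: (@cut_tet_of_bounds _ _ _ _ hF _ N h c) => //.
- exact: hnd.
- by move=> x y /Tz_lt xz /Tz_lt yz; have [] := NP _ _ _ Gz xz yz.
- by move=> x y Tx Ty; rewrite (le_trans (norm_le_enorm _))// Th_le.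
- move=> i; apply: (vertex_bound hF N0 NP hp _ _ eta0 Gz) => //.
  + by lra.
  + by rewrite mulrC -ltr_pdivlMr.
  + exact/Th_le/hull_vertex.
  + have := heta T i aT; rewrite /sdist normrM normr_sg F0 mul1r ger0_norm//.
    apply: lb_le_inf; first by exists (enorm (T i - z)); exists z.
    by move=> _ [y _ <-]; exact: sqrtr_ge0.
- by rewrite mulrC -ltr_pdivlMr// mulr_gt0.
- by exists z.
Qed.
End ActiveCells.

(** * Barycentric coordinates and coaxial points *)

Section Barycentric.
Context {R : realType}.
Implicit Types (T : tet R) (x y : 'rV[R]_3).

(** Appending a 1 to each vertex turns affine into linear combinations, so that
barycentric coordinates are obtained by inverting a square matrix. *)
Definition bary_mx T : 'M[R]_(4, 3 + 1) := \matrix_(i < 4) row_mx (T i) 1%:M.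

Definition lam T x (i : 'I_4) : R :=
  (row_mx x 1%:M *m invmx (bary_mx T : 'M[R]_4)) 0 i.

Lemma comb_bary_mx T (l : 'I_4 -> R) :
  (\row_i l i) *m bary_mx T = row_mx (\sum_i l i *: T i) (\sum_i l i)%:M.
Proof.
rewrite mulmx_sum_row; under eq_bigr do rewrite mxE rowK scale_row_mx.
rewrite (_ : (\sum_i l i)%:M = \sum_i l i *: (1%:M : 'M[R]_1)); last first.
  by rewrite -scaler_suml scalemx1.
by elim/big_ind3 : _ => [||]; rewrite ?row_mx0//; move=> ? ? ? ? ? ? -> ->; rewrite add_row_mx.
Qed.

Section Nondegenerate.
Variable T : tet R.
Hypothesis nT : Defs.nondegenerate T.

Lemma bary_mx_unit : (bary_mx T : 'M[R]_4) \in unitmx.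
Proof.
rewrite -row_free_unit; apply: inj_row_free => v.
have -> : v = \row_i v 0 i by apply/rowP => i; rewrite mxE.
rewrite [X in X = _ -> _]comb_bary_mx => h.
have [v0 v1] := @eq_row_mx _ 1 3 1 _ _ _ _ (etrans h (esym (row_mx0 _ 1 3 1))).
apply/rowP => i; rewrite !mxE; apply: nT v0 i.
by have := congr1 (fun M : 'M[R]_1 => M 0 0) v1; rewrite !mxE.
Qed.

Lemma lam_uniq (l : 'I_4 -> R) x : \sum_i l i = 1 -> x = \sum_i l i *: T i ->
  forall i, lam T x i = l i.
Proof.
move=> l1 -> i; rewrite /lam -[in 1%:M]l1 -comb_bary_mx mulmxK ?mxE//.
exact: bary_mx_unit.
Qed.

Lemma lam_comb_sum x : \sum_i lam T x i *: T i = x /\ \sum_i lam T x i = 1.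
Proof.
have : (\row_i lam T x i) *m bary_mx T = row_mx x 1%:M.
  rewrite (_ : \row_i _ = row_mx x 1%:M *m invmx (bary_mx T : 'M[R]_4)).
    by rewrite mulmxKV// bary_mx_unit.
  by apply/rowP => i; rewrite mxE.
rewrite comb_bary_mx => /eq_row_mx[-> h]; split => //.
by have := congr1 (fun M : 'M[R]_1 => M 0 0) h; rewrite !mxE.
Qed.

Lemma lam_comb x : \sum_i lam T x i *: T i = x. Proof. by case: (lam_comb_sum x). Qed.
Lemma lam_sum x : \sum_i lam T x i = 1. Proof. by case: (lam_comb_sum x). Qed.

Lemma lam_inj x y : (forall i, lam T x i = lam T y i) -> x = y.
Proof. by move=> xy; rewrite -(lam_comb x) -(lam_comb y); apply: eq_bigr => i _; rewrite xy. Qed.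

Lemma lam_affine (I : finType) (a : I -> R) (p : I -> 'rV[R]_3) i :
  \sum_k a k = 1 -> lam T (\sum_k a k *: p k) i = \sum_k a k * lam T (p k) i.
Proof.
move=> a1; apply: (lam_uniq (l := fun i => \sum_k a k * lam T (p k) i)).
  rewrite exchange_big/= -[RHS]a1; apply: eq_bigr => k _.
  by rewrite -mulr_sumr lam_sum mulr1.
under [RHS]eq_bigr do rewrite scaler_suml.
rewrite exchange_big/=; apply: eq_bigr => k _.
rewrite -{1}(lam_comb (p k)) scaler_sumr; apply: eq_bigr => j _.
by rewrite scalerA.
Qed.

Lemma lam_segment x y (t : R) i :
  lam T ((1 - t) *: x + t *: y) i = (1 - t) * lam T x i + t * lam T y i.
Proof.
apply: (lam_uniq (l := fun i => (1 - t) * lam T x i + t * lam T y i)).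
  by rewrite big_split/= -!mulr_sumr !lam_sum !mulr1 subrK.
rewrite -{1}(lam_comb x) -{1}(lam_comb y) !scaler_sumr -big_split/=.
by apply: eq_bigr => j _; rewrite !scalerA -scalerDl.
Qed.

Lemma lam_vertex i j : lam T (T i) j = (j == i)%:R.
Proof.
apply: (lam_uniq (l := fun j => (j == i)%:R)).
  by rewrite (bigD1 i)//= eqxx big1 ?addr0// => k /negbTE ->.
rewrite (bigD1 i)//= eqxx scale1r big1 ?addr0// => k /negbTE ->.
by rewrite scale0r.
Qed.

Lemma vertex_inj : injective T.
Proof.
move=> i j Tij; have := lam_vertex i i; rewrite Tij lam_vertex eqxx.
by case: eqP => [->//|_ /eqP]; rewrite eq_sym oner_eq0.
Qed.

Lemma hull_onP (A : {set 'I_4}) x : hull_on T A x <->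
  (forall i, 0 <= lam T x i) /\ (forall i, i \notin A -> lam T x i = 0).
Proof.
split=> [[l [l0 lA l1 xE]]|[l0 lA]].
  by split=> i; [|move=> iA]; rewrite (lam_uniq l1 xE)// lA.
by exists (lam T x); split => //; rewrite ?lam_sum ?lam_comb.
Qed.

Lemma hullP x : hull T x <-> forall i, 0 <= lam T x i.
Proof.
rewrite /hull hull_onP; split=> [[]//|l0]; split => // i.
by rewrite inE.
Qed.

Lemma lam_lip i : exists2 L : R, 0 <= L & forall x y,
  `|lam T x i - lam T y i| <= L * `|x - y|.
Proof.
pose B := invmx (bary_mx T : 'M[R]_4).
exists (\sum_k `|B k i|); first by rewrite sumr_ge0.
move=> x y.
have -> : lam T x i - lam T y i = (row_mx (x - y) (0 : 'M[R]_1) *m B) 0 i.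
  rewrite /lam (_ : row_mx (x - y) 0 = row_mx x 1%:M - row_mx y 1%:M).
    by rewrite mulmxBl !mxE.
  by rewrite opp_row_mx add_row_mx subrr.
rewrite mxE (le_trans (ler_norm_sum _ _ _))// mulr_suml ler_sum// => k _.
rewrite normrM mulrC ler_wpM2l//.
case: (split_ordP k) => k' ->; first by rewrite row_mxEl row_entry_le.
by rewrite row_mxEr mxE normr0.
Qed.

Lemma lam_continuous i : continuous (fun x => lam T x i).
Proof.
have [L L0 HL] := lam_lip i.
move=> x; apply: loc_lip_cvg; exists 1, L; split => // *; exact: HL.
Qed.

Lemma barycentricE x i : barycentric T x i = lam T x i.
Proof.
rewrite /barycentric; case: xgetP => [l _ [l1 xE]|/(_ [ffun i => lam T x i])].
  by rewrite (lam_uniq l1 xE).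
case; split; first by under eq_bigr do rewrite ffunE; exact: lam_sum.
by rewrite -[LHS]lam_comb; apply: eq_bigr => k _; rewrite ffunE.
Qed.
End Nondegenerate.
End Barycentric.

(** Two points of a cut tetrahedron are coaxial when they lie on the same open
segment from the face spanned by its positive vertices to the one spanned by
its negative vertices; stated on barycentric coordinates, the relation is
symmetric and visibly compatible with faces. *)
Definition coax {R : realType} (F : 'rV[R]_3 -> R) (T : tet R) (x y : 'rV[R]_3) :=
  exists a b : R, [/\ 0 < a, 0 < b &
    forall i, lam T y i = (if 0 < F (T i) then a else b) * lam T x i].

Section Coaxial.
Context {R : realType}.
Variables (U : set 'rV[R]_3) (F : 'rV[R]_3 -> R) (T : tet R).
Hypothesis hT : cut_tet U F T.
Implicit Types x y : 'rV[R]_3.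

Let nT : Defs.nondegenerate T. Proof. by case: hT. Qed.

Lemma coax_sym x y : coax F T x y -> coax F T y x.
Proof.
move=> [a [b [a0 b0 yE]]]; exists a^-1, b^-1; rewrite !invr_gt0; split => // i.
by rewrite yE; case: ifP => _; rewrite mulKf// gt_eqF.
Qed.

Lemma coax_hull x y : coax F T x y -> hull T x -> hull T y.
Proof.
move=> [a [b [a0 b0 yE]]] /(hullP nT) x0; apply/(hullP nT) => i.
by rewrite yE mulr_ge0//; case: ifP => _; exact: ltW.
Qed.

Definition psum x := \sum_(i | 0 < F (T i)) lam T x i.
Definition nsum x := \sum_(i | ~~ (0 < F (T i))) lam T x i.

(** Points off both sign faces: exactly these lie on the open segment between a
unique pair of ends. *)
Definition mixed x := [/\ hull T x, 0 < psum x & 0 < nsum x].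

Definition pos_end x : 'rV[R]_3 :=
  \sum_i (if 0 < F (T i) then lam T x i / psum x else 0) *: T i.
Definition neg_end x : 'rV[R]_3 :=
  \sum_i (if 0 < F (T i) then 0 else lam T x i / nsum x) *: T i.

Let pos_end_sum x : 0 < psum x ->
  \sum_i (if 0 < F (T i) then lam T x i / psum x else 0) = 1.
Proof.
by move=> p0; rewrite -big_mkcond/= -mulr_suml divff// gt_eqF.
Qed.

Let neg_end_sum x : 0 < nsum x ->
  \sum_i (if 0 < F (T i) then 0 else lam T x i / nsum x) = 1.
Proof.
move=> n0; rewrite -[RHS](divff (lt0r_neq0 n0)) {1}/nsum mulr_suml [RHS]big_mkcond/=.
by apply: eq_bigr => i _; rewrite if_neg.
Qed.

Lemma pos_endP x : mixed x -> pos_face F T (pos_end x).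
Proof.
move=> [/(hullP nT) x0 p0 _].
exists (fun i => if 0 < F (T i) then lam T x i / psum x else 0); split => //.
- by move=> i; case: ifP => // _; rewrite divr_ge0 ?x0// ltW.
- by move=> i; rewrite inE => /negbTE ->.
- exact: pos_end_sum.
Qed.

Lemma neg_endP x : mixed x -> neg_face F T (neg_end x).
Proof.
move=> [/(hullP nT) x0 _ n0]; have [_ _ F0 _ _] := hT.
exists (fun i => if 0 < F (T i) then 0 else lam T x i / nsum x); split => //.
- by move=> i; case: ifP => // _; rewrite divr_ge0 ?x0// ltW.
- by move=> i; rewrite inE -leNgt le_eqVlt eq_sym (negbTE (F0 i))/= => ->.
- exact: neg_end_sum.
Qed.

Lemma lam_join x (t : R) i : mixed x ->
  lam T ((1 - t) *: pos_end x + t *: neg_end x) i =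
  (if 0 < F (T i) then (1 - t) / psum x else t / nsum x) * lam T x i.
Proof.
move=> [_ p0 n0]; rewrite lam_segment//.
rewrite (lam_uniq nT (pos_end_sum p0) erefl) (lam_uniq nT (neg_end_sum n0) erefl).
by case: ifP => _; rewrite mulr0 ?addr0 ?add0r mulrAC -?mulrA.
Qed.

Lemma coax_join x (t : R) : mixed x -> 0 < t < 1 ->
  coax F T x ((1 - t) *: pos_end x + t *: neg_end x).
Proof.
move=> mx /andP[t0 t1]; have [_ p0 n0] := mx.
exists ((1 - t) / psum x), (t / nsum x); rewrite !divr_gt0 ?subr_gt0//.
by split => // i; exact: lam_join.
Qed.

Lemma coax_on_join x y : mixed x -> coax F T x y ->
  exists2 t : R, 0 < t < 1 & y = (1 - t) *: pos_end x + t *: neg_end x.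
Proof.
move=> mx [a [b [a0 b0 yE]]]; have [_ p0 n0] := mx.
have ab : a * psum x + b * nsum x = 1.
  rewrite -[RHS](lam_sum nT y) [RHS](bigID (fun i => 0 < F (T i)))/=.
  rewrite /psum /nsum !mulr_sumr; congr (_ + _); apply: eq_bigr => i Fi.
    by rewrite yE Fi.
  by rewrite yE (negbTE Fi).
have bn : 0 < b * nsum x by rewrite mulr_gt0.
have ap : 0 < a * psum x by rewrite mulr_gt0.
have apE : 1 - b * nsum x = a * psum x by rewrite -ab addrK.
exists (b * nsum x).
  by rewrite bn/= -subr_gt0 apE.
apply: (lam_inj nT) => i; rewrite lam_join// yE apE.
by rewrite !mulfK// gt_eqF.
Qed.

Lemma coax_mixed x y : mixed x -> coax F T x y -> mixed y.
Proof.
move=> mx cxy; have [Tx p0 n0] := mx; split; first exact: coax_hull cxy Tx.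
  case: cxy => a [b [a0 b0 yE]]; have -> : psum y = a * psum x.
    by rewrite /psum mulr_sumr; apply: eq_bigr => i Fi; rewrite yE Fi.
  exact: mulr_gt0.
case: cxy => a [b [a0 b0 yE]]; have -> : nsum y = b * nsum x.
  by rewrite /nsum mulr_sumr; apply: eq_bigr => i Fi; rewrite yE (negbTE Fi).
exact: mulr_gt0.
Qed.

(** Eliminating the two factors leaves polynomial equations, hence a closed
condition. *)
Lemma coaxP x y : mixed x -> mixed y ->
  (coax F T x y <-> forall i j, (0 < F (T i)) = (0 < F (T j)) ->
     lam T x i * lam T y j = lam T x j * lam T y i).
Proof.
move=> [_ px nx] [_ py ny]; split=> [[a [b [_ _ yE]]] i j ij|H].
  by rewrite !yE ij; case: ifP => _; ring.
exists (psum y / psum x), (nsum y / nsum x); rewrite !divr_gt0//; split => // i.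
have E (P : pred 'I_4) : P =1 (fun j => (0 < F (T i)) == (0 < F (T j))) ->
    lam T x i * \sum_(j | P j) lam T y j = (\sum_(j | P j) lam T x j) * lam T y i.
  move=> PE; rewrite mulr_sumr mulr_suml; apply: eq_bigr => j.
  by rewrite PE => /eqP; exact: H.
case: ifPn => Fi; apply/esym; rewrite mulrAC.
  apply: (canLR (mulfK _)); first by rewrite gt_eqF.
  rewrite mulrC E; first by rewrite mulrC.
  by move=> j; rewrite Fi.
apply: (canLR (mulfK _)); first by rewrite gt_eqF.
rewrite mulrC E; first by rewrite mulrC.
by move=> j; rewrite (negbTE Fi); case: (0 < _).
Qed.

Lemma psum0_neg x : hull T x -> psum x <= 0 -> neg_face F T x.
Proof.
move=> Tx px; have [_ _ F0 _ _] := hT; have x0 := (hullP nT x).1 Tx.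
apply/(hull_onP nT); split => // i.
rewrite inE -leNgt le_eqVlt eq_sym (negbTE (F0 i))/= => Fi.
apply/eqP; rewrite eq_le x0 andbT (le_trans _ px)//.
by rewrite /psum (bigD1 i)//= lerDl sumr_ge0.
Qed.

Lemma nsum0_pos x : hull T x -> nsum x <= 0 -> pos_face F T x.
Proof.
move=> Tx px; have x0 := (hullP nT x).1 Tx.
apply/(hull_onP nT); split => // i; rewrite inE => Fi.
apply/eqP; rewrite eq_le x0 andbT (le_trans _ px)//.
by rewrite /nsum (bigD1 i)//= lerDl sumr_ge0.
Qed.

Section Separating.
Variable psi : 'rV[R]_3 -> R.
Hypothesis hpsi : separating F T psi.

Lemma zero_mixed x : hull T x -> psi x = 0 -> mixed x.
Proof.
move=> Tx px; have [_ pp pn _] := hpsi; split => //.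
  by rewrite ltNge; apply/negP => /(psum0_neg Tx)/pn; rewrite px ltxx.
by rewrite ltNge; apply/negP => /(nsum0_pos Tx)/pp; rewrite px ltxx.
Qed.

Lemma coax_zero_uniq x y y' : mixed x -> coax F T x y -> coax F T x y' ->
  psi y = 0 -> psi y' = 0 -> y = y'.
Proof.
move=> mx /(coax_on_join mx)[t /andP[t0 t1] ->] /(coax_on_join mx)[t' /andP[t'0 t'1] ->].
have [_ _ _ dec] := hpsi.
have d := dec _ _ _ _ (pos_endP mx) (neg_endP mx).
have [tt'|tt'|->//] := ltgtP t t'.
  by have := d t t' (ltW t0) tt' (ltW t'1) => /[swap] -> /[swap] ->; rewrite ltxx.
by have := d t' t (ltW t'0) tt' (ltW t1) => /[swap] -> /[swap] ->; rewrite ltxx.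
Qed.

Lemma coax_zero_exists x : mixed x -> exists y, [/\ hull T y, coax F T x y & psi y = 0].
Proof.
move=> mx; have [cpsi pp pn _] := hpsi.
have [px nx] := (pos_endP mx, neg_endP mx).
pose g (t : R) := psi ((1 - t) *: pos_end x + t *: neg_end x).
have cg : {within `[(0 : R), 1], continuous g}.
  apply: continuous_in_subspaceT => t; rewrite inE/= in_itv/= => t01.
  apply: (@continuous_comp _ _ _ (fun t : R => (1 - t) *: pos_end x + t *: neg_end x) psi).
    apply: cvgD; apply: cvgZr_tmp; last exact: cvg_id.
    by apply: cvgB; [exact: cvg_cst|exact: cvg_id].
  apply: cpsi; apply: hull_segment t01; [exact: hull_on_sub px|exact: hull_on_sub nx].
have g0 : 0 < g 0 by rewrite /g subr0 scale1r scale0r addr0 pp.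
have g1 : g 1 < 0 by rewrite /g subrr scale1r scale0r add0r pn.
have [|t] := @IVT _ g 0 1 0 ler01 cg.
  by rewrite ge_min le_max (ltW g0) (ltW g1) orbT.
rewrite in_itv/= => /andP[t0 t1] gt.
have t01 : 0 < t < 1.
  rewrite !lt_neqAle t0 t1 !andbT; apply/andP; split; apply/eqP => tE.
    by move: gt; rewrite -tE => g0'; rewrite g0' ltxx in g0.
  by rewrite -tE gt ltxx in g1.
have cx := coax_join mx t01.
have [Tx _ _] := mx.
by eexists; split; [exact: coax_hull cx Tx|exact: cx|exact: gt].
Qed.

(** Along the segment through [x] a separating function is positive at one end,
negative at the other and strictly decreasing. *)
Lemma coax_zero_ex1 x : mixed x ->
  exists y, [/\ hull T y, coax F T x y, psi y = 0 &
    forall y', coax F T x y' -> psi y' = 0 -> y' = y].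
Proof.
move=> mx; have [y [Ty cy py]] := coax_zero_exists mx.
by exists y; split => // y' cy' py'; exact: (coax_zero_uniq mx).
Qed.
End Separating.
End Coaxial.

(** * Linear patches of one cell *)

Lemma sum_continuous (R : realType) (V : topologicalType) (W : normedModType R) (I : Type) (r : seq I)
  (f : I -> V -> W) : (forall i, continuous (f i)) ->
  continuous (fun x => \sum_(i <- r) f i x).
Proof.
move=> cf x; elim: r => [|i r IH].
  by under eq_fun do rewrite big_nil; exact: cvg_cst.
under eq_fun do rewrite big_cons.
by apply: cvgD => //; exact: cf.
Qed.

Section LinearSeparation.
Context {R : realType}.
Variables (U : set 'rV[R]_3) (F : 'rV[R]_3 -> R) (T : tet R).
Hypothesis hT : cut_tet U F T.
Let nT : Defs.nondegenerate T. Proof. by case: hT. Qed.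

Definition lincomb (c : 'I_4 -> R) (x : 'rV[R]_3) : R := \sum_i c i * lam T x i.

Lemma lincomb_continuous c : continuous (lincomb c).
Proof.
have tc i : continuous (fun x => c i * lam T x i).
  by move=> x; apply: continuousM; [exact: cst_continuous|exact: lam_continuous].
exact: sum_continuous.
Qed.

Let lincomb_gt0 c x : (forall i, 0 <= lam T x i) ->
  (forall i, 0 < lam T x i -> 0 < c i) -> 0 < lincomb c x.
Proof.
move=> x0 xc; rewrite lt_neqAle; apply/andP; split; last first.
  apply: sumr_ge0 => i _; have := x0 i; rewrite le_eqVlt => /orP[/eqP <-|xi].
    by rewrite mulr0.
  by rewrite mulr_ge0 ?x0// ltW// xc.
apply/eqP => /esym/eqP; rewrite /lincomb psumr_eq0 => [/allP z|i _]; last first.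
  have := x0 i; rewrite le_eqVlt => /orP[/eqP <-|xi]; first by rewrite mulr0.
  by rewrite mulr_ge0 ?x0// ltW// xc.
have : \sum_i lam T x i = 0.
  apply: big1 => i _; have := z i (mem_index_enum _); rewrite mulf_eq0.
  move=> /orP[/eqP ci|/eqP//]; have := x0 i; rewrite le_eqVlt => /orP[/eqP//|/xc].
  by rewrite ci ltxx.
by rewrite lam_sum// => /eqP; rewrite oner_eq0.
Qed.

Let lincombN c x : lincomb (fun i => - c i) x = - lincomb c x.
Proof. by rewrite /lincomb -sumrN; apply: eq_bigr => i _; rewrite mulNr. Qed.

Lemma separating_lincomb c : (forall i, 0 < c i * F (T i)) ->
  separating F T (lincomb c).
Proof.
move=> cF.
have pos x : pos_face F T x -> 0 < lincomb c x.
  move=> /(hull_onP nT)[x0 xA]; apply: lincomb_gt0 => // i xi.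
  have [|/xA xi0] := boolP (i \in [set i | 0 < F (T i)]%SET).
    by rewrite inE => Fi; rewrite -(pmulr_lgt0 _ Fi) cF.
  by rewrite xi0 ltxx in xi.
have neg x : neg_face F T x -> lincomb c x < 0.
  move=> /(hull_onP nT)[x0 xA]; rewrite -oppr_gt0 -lincombN.
  apply: lincomb_gt0 => // i xi.
  have [|/xA xi0] := boolP (i \in [set i | F (T i) < 0]%SET).
    by rewrite inE => Fi; rewrite oppr_gt0 -(nmulr_lgt0 _ Fi) cF.
  by rewrite xi0 ltxx in xi.
split => //; first by move=> x _; exact: lincomb_continuous.
move=> x y s t /pos px /neg ny s0 st t1.
have E u : lincomb c ((1 - u) *: x + u *: y) = (1 - u) * lincomb c x + u * lincomb c y.
  rewrite /lincomb !mulr_sumr -big_split/=; apply: eq_bigr => i _.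
  by rewrite lam_segment//; ring.
rewrite !E; nra.
Qed.

(** A patch made of two noncoplanar triangles is the zero set of the minimum or
maximum of two affine functions, not of an affine one. *)
Lemma separating_min psi1 psi2 : separating F T psi1 -> separating F T psi2 ->
  separating F T (fun x => Num.min (psi1 x) (psi2 x)).
Proof.
move=> [c1 p1 n1 d1] [c2 p2 n2 d2]; split.
- by move=> x Tx; apply: continuous_min; [exact: c1|exact: c2].
- by move=> x px; rewrite lt_min p1 ?p2.
- by move=> x nx; rewrite gt_min n1.
- move=> x y s t px ny s0 st t1.
  by rewrite lt_min !gt_min d1// d2// orbT.
Qed.

Lemma separating_max psi1 psi2 : separating F T psi1 -> separating F T psi2 ->
  separating F T (fun x => Num.max (psi1 x) (psi2 x)).
Proof.
move=> [c1 p1 n1 d1] [c2 p2 n2 d2]; split.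
- by move=> x Tx; apply: continuous_max; [exact: c1|exact: c2].
- by move=> x px; rewrite lt_max p1.
- by move=> x nx; rewrite gt_max n1 ?n2.
- move=> x y s t px ny s0 st t1.
  by rewrite gt_max !lt_max d1// d2// orbT.
Qed.
End LinearSeparation.

Section EdgePoints.
Context {R : realType}.
Variables (U : set 'rV[R]_3) (F : 'rV[R]_3 -> R) (T : tet R).
Hypothesis hT : cut_tet U F T.
Let nT : Defs.nondegenerate T. Proof. by case: hT. Qed.
Let Gam := zero_set U F.

Lemma zero_setP x : hull T x -> (Gam x <-> F x = 0).
Proof.
move=> Tx; have [_ TU _ _ _] := hT.
by split=> [[]//|Fx]; split => //; exact: TU.
Qed.

Lemma mixedP x : hull T x -> (exists2 i, 0 < F (T i) & 0 < lam T x i) ->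
  (exists2 i, F (T i) < 0 & 0 < lam T x i) -> mixed F T x.
Proof.
move=> Tx [i Fi xi] [j Fj xj]; have x0 := (hullP nT x).1 Tx; split => //.
  by rewrite /psum (bigD1 i)//= ltr_wpDr// sumr_ge0.
by rewrite /nsum (bigD1 j)/= -?leNgt ?ltW// ltr_wpDr// sumr_ge0.
Qed.

Lemma lam_edge i j (t : R) k : i != j ->
  lam T ((1 - t) *: T i + t *: T j) k =
  if k == i then 1 - t else if k == j then t else 0.
Proof.
move=> ij; rewrite lam_segment// !lam_vertex//.
have [->|ki] := eqVneq k i; first by rewrite (negbTE ij) mulr1 mulr0 addr0.
by have [_|_] := eqVneq k j; rewrite ?mulr1 ?mulr0 ?add0r// addr0.
Qed.

Lemma edge_zero i j : F (T i) * F (T j) < 0 ->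
  exists P e, [/\ 0 < e < 1, P = (1 - e) *: T i + e *: T j, Gam P &
    forall Q, Gam Q -> segment (T i) (T j) Q -> Q = P].
Proof.
move=> Fij.
have ij : i != j by apply: contraTN Fij => /eqP ->; rewrite -leNgt -expr2 sqr_ge0.
have [_ _ F0 _ FT] := hT.
have mixt (t : R) : 0 < t < 1 -> mixed F T ((1 - t) *: T i + t *: T j).
  move=> /andP[t0 t1]; have Tt : hull T ((1 - t) *: T i + t *: T j).
    by apply: hull_segment; rewrite ?ltW//; exact: hull_vertex.
  have li : 0 < lam T ((1 - t) *: T i + t *: T j) i.
    by rewrite lam_edge// eqxx subr_gt0.
  have lj : 0 < lam T ((1 - t) *: T i + t *: T j) j.
    by rewrite lam_edge// eqxx eq_sym (negbTE ij).
  have [Fi|Fi] := ltP 0 (F (T i)).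
    apply: mixedP => //; first by exists i.
    by exists j => //; rewrite -(pmulr_rlt0 _ Fi).
  have {}Fi : F (T i) < 0 by rewrite lt_neqAle F0.
  apply: mixedP => //; last by exists i.
  by exists j => //; rewrite -(nmulr_rlt0 _ Fi).
have sgij : (0 < F (T i)) = ~~ (0 < F (T j)).
  have [Fi|Fi] := ltP 0 (F (T i)).
    by rewrite -leNgt ltW// -(pmulr_rlt0 _ Fi).
  have {}Fi : F (T i) < 0 by rewrite lt_neqAle F0.
  by apply/esym/negbTE; rewrite negbK -(nmulr_rlt0 _ Fi).
have coaxt (s t : R) : 0 < s < 1 -> 0 < t < 1 ->
    coax F T ((1 - s) *: T i + s *: T j) ((1 - t) *: T i + t *: T j).
  move=> s01 t01; have [_ +] := coaxP (mixt _ s01) (mixt _ t01).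
  apply => k l kl.
  rewrite !lam_edge//.
  have [ki|ki] := eqVneq k i; have [li|li] := eqVneq l i; rewrite ?mul0r ?mulr0//.
  - have [lj|lj] := eqVneq l j; rewrite ?mul0r ?mulr0//.
    by move: kl; rewrite ki lj sgij; case: (0 < _).
  - have [kj|kj] := eqVneq k j; rewrite ?mul0r ?mulr0//.
    by move: kl; rewrite li kj sgij; case: (0 < _).
  by have [kj|kj] := eqVneq k j; have [lj|lj] := eqVneq l j; rewrite ?mul0r ?mulr0.
have h01 : 0 < (2^-1 : R) < 1 by rewrite invr_gt0 ltr0n invf_lt1// ltr1n.
have mm := mixt _ h01.
have [P [TP cP FP uP]] := coax_zero_ex1 hT FT mm.
have lP0 k : k != i -> k != j -> lam T P k = 0.
  move=> ki kj; case: cP => a [b [_ _ ->]].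
  by rewrite lam_edge// (negbTE ki) (negbTE kj) mulr0.
have lPs : lam T P i = 1 - lam T P j.
  rewrite -(lam_sum nT P) (bigD1 i)//= (bigD1 j)/= 1?eq_sym// big1 ?addr0 ?addrK//.
  by move=> k /andP[ki kj]; exact: lP0.
have PE : P = (1 - lam T P j) *: T i + lam T P j *: T j.
  rewrite -lPs -{1}(lam_comb nT P) (bigD1 i)//= (bigD1 j)/= 1?eq_sym//.
  by rewrite big1 ?addr0// => k /andP[ki kj]; rewrite lP0// scale0r.
have e01 : 0 < lam T P j < 1.
  rewrite -[X in _ && X]subr_gt0 -lPs; case: cP => a [b [a0 b0 lE]].
  rewrite !lE !lam_edge// !eqxx eq_sym (negbTE ij); case/andP: h01 => ? ?.
  by apply/andP; split; apply: mulr_gt0; rewrite ?subr_gt0//; case: ifP.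
exists P, (lam T P j); split => //; first exact/(zero_setP TP).
move=> Q GQ [t [/andP[t0 t1] QE]].
have TQ : hull T Q.
  by rewrite QE; apply: hull_segment; rewrite ?t0//; exact: hull_vertex.
apply: uP; last exact/(zero_setP TQ).
rewrite QE; apply: coaxt => //; rewrite !lt_neqAle t0 t1 !andbT; apply/andP; split.
  apply/eqP => tE; move: GQ; rewrite QE -tE subr0 scale1r scale0r addr0.
  by case=> _ /eqP; rewrite (negbTE (F0 i)).
apply/eqP => tE; move: GQ; rewrite QE tE subrr scale1r scale0r add0r.
by case=> _ /eqP; rewrite (negbTE (F0 j)).
Qed.

Lemma edge_ptP i j : F (T i) * F (T j) < 0 ->
  let P := edge_pt U F T i j in
  [/\ Gam P, hull T P, 0 < lam T P i /\ 0 < lam T P j,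
      forall k, k != i -> k != j -> lam T P k = 0 &
      (Gam `&` segment (T i) (T j)) P /\
      forall Q, (Gam `&` segment (T i) (T j)) Q -> Q = P].
Proof.
move=> Fij P.
have ij : i != j by apply: contraTN Fij => /eqP ->; rewrite -leNgt -expr2 sqr_ge0.
have [P' [e [/andP[e0 e1] PE GP uP]]] := edge_zero Fij.
have sP : segment (T i) (T j) P' by exists e; rewrite !ltW.
have -> : P = P'.
  rewrite /P /edge_pt /edge_point; case: xgetP => [Q _ [GQ sQ]|/(_ P')].
    exact: uP.
  by case.
split => //.
- by rewrite PE; apply: hull_segment; rewrite ?ltW//; exact: hull_vertex.
- by rewrite PE !lam_edge// !eqxx eq_sym (negbTE ij) subr_gt0.
- by move=> k ki kj; rewrite PE lam_edge// (negbTE ki) (negbTE kj).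
- by split => // Q [GQ sQ]; exact: uP.
Qed.
End EdgePoints.

Lemma edge_point_sym (R : realType) (U : set 'rV[R]_3) F (a b : 'rV[R]_3) :
  edge_point U F a b = edge_point U F b a.
Proof.
rewrite /edge_point; congr (xget 0 (_ `&` _)).
apply/seteqP; split => x [t [/andP[t0 t1] ->]]; exists (1 - t);
  by rewrite subr_ge0 gerBl t0 t1 subKr addrC.
Qed.

Section FourIndices.
Variable V : nmodType.

Lemma ord4P (P : 'I_4 -> Prop) : P 0 -> P 1 -> P 2 -> P 3 -> forall i, P i.
Proof.
move=> P0 P1 P2 P3 [[|[|[|[|//]]]] h].
- by rewrite (_ : Ordinal h = 0)//; exact: val_inj.
- by rewrite (_ : Ordinal h = 1)//; exact: val_inj.
- by rewrite (_ : Ordinal h = 2)//; exact: val_inj.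
- by rewrite (_ : Ordinal h = 3)//; exact: val_inj.
Qed.

Lemma sum_ord4 (f : 'I_4 -> V) : (\sum_i f i = f 0 + f 1 + f 2 + f 3)%R.
Proof.
rewrite !big_ord_recl big_ord0 addr0 !addrA.
by congr (_ + f _ + f _ + f _)%R; exact: val_inj.
Qed.
End FourIndices.

Section PatchAlgebra.
Variable K : realFieldType.
Implicit Types x y : K.

(** Nonnegative weights on consecutive edges of a path of four vertices are
determined from its two ends; what remains is one linear equation and the sign
of the middle weight. *)
Lemma path_weights (xa xb xc xd A1 A2 B1 B2 C1 C2 : K) :
  0 < A1 -> 0 < B1 -> 0 < C2 ->
  (exists w0 w1 w2, [/\ 0 <= w0, 0 <= w1 & 0 <= w2] /\
    [/\ xa = w0 * A1, xb = w0 * A2 + w1 * B1, xc = w1 * B2 + w2 * C1 & xd = w2 * C2])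
  -> xc = B2 / B1 * (xb - A2 / A1 * xa) + C1 / C2 * xd /\ 0 <= xb * A1 - A2 * xa.
Proof.
move=> A10 B10 C20 [w0 [w1 [w2 [[w00 w10 w20] [-> -> -> ->]]]]]; split.
  by field; rewrite !gt_eqF.
rewrite (_ : _ - _ = w1 * (B1 * A1)); last by ring.
by rewrite !mulr_ge0// ltW.
Qed.

Lemma path_weights_exist (xa xb xc xd A1 A2 B1 B2 C1 C2 : K) :
  0 < A1 -> 0 < B1 -> 0 < C2 -> 0 <= xa -> 0 <= xd ->
  xc = B2 / B1 * (xb - A2 / A1 * xa) + C1 / C2 * xd -> 0 <= xb * A1 - A2 * xa ->
  exists w0 w1 w2, [/\ 0 <= w0, 0 <= w1 & 0 <= w2] /\
    [/\ xa = w0 * A1, xb = w0 * A2 + w1 * B1, xc = w1 * B2 + w2 * C1 & xd = w2 * C2].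
Proof.
move=> A10 B10 C20 xa0 xd0 -> xab.
exists (xa / A1), ((xb * A1 - A2 * xa) / (A1 * B1)), (xd / C2); split.
  by rewrite !divr_ge0// ?ltW// mulr_gt0.
by split; field; rewrite ?gt_eqF.
Qed.

Lemma kappa_alg (x0 x1 x2 x3 p0 p1 q1 q2 s2 s3 u0 u3 : K) :
  p1 != 0 -> q1 != 0 -> q2 != 0 -> s2 != 0 -> u3 != 0 ->
  x0 - p0 / p1 * x1 + p0 * q1 / (p1 * q2) * x2 - u0 / u3 * x3 -
  (x0 - u0 * s3 * q2 / (u3 * s2 * q1) * x1 + u0 * s3 / (u3 * s2) * x2 - u0 / u3 * x3)
  = (p0 * q1 / (p1 * q2) - u0 * s3 / (u3 * s2)) / q1 * (q1 * x2 - q2 * x1).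
Proof. by move=> ? ? ? ? ?; field; do !(apply/andP; split). Qed.

Lemma plane1_alg (x0 x1 x2 x3 p0 p1 q1 q2 u0 u3 : K) :
  p1 != 0 -> q2 != 0 -> u3 != 0 ->
  x0 - p0 / p1 * x1 + p0 * q1 / (p1 * q2) * x2 - u0 / u3 * x3 =
  x0 - (p0 / p1 * (x1 - q1 / q2 * x2) + u0 / u3 * x3).
Proof. by move=> ? ? ?; field; do !(apply/andP; split). Qed.

Lemma plane2_alg (x0 x1 x2 x3 q1 q2 s2 s3 u0 u3 : K) :
  q1 != 0 -> s2 != 0 -> u0 != 0 -> u3 != 0 ->
  x0 - u0 * s3 * q2 / (u3 * s2 * q1) * x1 + u0 * s3 / (u3 * s2) * x2 - u0 / u3 * x3 =
  - (u0 / u3) * (x3 - (s3 / s2 * (x2 - q2 / q1 * x1) + u3 / u0 * x0)).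
Proof. by move=> ? ? ? ?; field; do !(apply/andP; split). Qed.
End PatchAlgebra.

Section Patches.
Context {R : realType}.
Variables (U : set 'rV[R]_3) (F : 'rV[R]_3 -> R) (T : tet R).
Hypothesis hT : cut_tet U F T.
Let nT : Defs.nondegenerate T. Proof. by case: hT. Qed.

Lemma triangleP (a b c x : 'rV[R]_3) : triangle a b c x <->
  exists w0 w1 w2 : R, [/\ 0 <= w0, 0 <= w1, 0 <= w2 & w0 + w1 + w2 = 1] /\
    x = w0 *: a + w1 *: b + w2 *: c.
Proof.
split=> [[l [l0 _ l1 xE]]|[w0 [w1 [w2 [[w00 w10 w20 w1E] xE]]]]].
  exists (l 0), (l 1), (l 2); split.
    split => //; rewrite -l1 !big_ord_recl big_ord0 addr0 addrA.
    by congr (l _ + l _ + l _); exact: val_inj.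
  rewrite xE !big_ord_recl big_ord0 addr0 addrA /=.
  by congr (l _ *: _ + l _ *: _ + l _ *: _); exact: val_inj.
exists (fun i : 'I_3 => nth 0 [:: w0; w1; w2] i); split.
- by move=> [[|[|[|//]]] h].
- by move=> i; rewrite inE.
- by rewrite !big_ord_recl big_ord0 addr0 addrA.
- by rewrite xE !big_ord_recl big_ord0 addr0 addrA.
Qed.

Lemma triangle_lamP (a b c x : 'rV[R]_3) : triangle a b c x <->
  exists w0 w1 w2 : R, [/\ 0 <= w0, 0 <= w1 & 0 <= w2] /\
    forall i, lam T x i = w0 * lam T a i + w1 * lam T b i + w2 * lam T c i.
Proof.
rewrite triangleP; split=> [[w0 [w1 [w2 [[w00 w10 w20 w1E] xE]]]]|].
  exists w0, w1, w2; split => //; apply: (lam_uniq nT).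
    by rewrite !big_split/= -!mulr_sumr !lam_sum// !mulr1.
  rewrite xE -{1}(lam_comb nT a) -{1}(lam_comb nT b) -{1}(lam_comb nT c).
  rewrite !scaler_sumr -!big_split/=; apply: eq_bigr => i _.
  by rewrite !scalerA -!scalerDl.
move=> [w0 [w1 [w2 [[w00 w10 w20] xE]]]].
have w1E : w0 + w1 + w2 = 1.
  rewrite -(lam_sum nT x); under [RHS]eq_bigr do rewrite xE.
  by rewrite !big_split/= -!mulr_sumr !lam_sum// !mulr1.
exists w0, w1, w2; split => //; apply: (lam_inj nT) => i; rewrite xE.
apply/esym; move: i; apply: (lam_uniq nT).
  by rewrite !big_split/= -!mulr_sumr !lam_sum// !mulr1.
rewrite -{1}(lam_comb nT a) -{1}(lam_comb nT b) -{1}(lam_comb nT c).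
rewrite !scaler_sumr -!big_split/=; apply: eq_bigr => i _.
by rewrite !scalerA -!scalerDl.
Qed.

Let P := edge_pt U F T.

(** On the triangle the coordinate at [T 0] is the combination of the other three
whose coefficients are the ratios found at the corners. *)
Lemma three_edge_triangle : three_edge_cut F T ->
  exists2 c : 'I_4 -> R, (forall i, 0 < c i * F (T i)) &
    forall x, triangle (P 0 1) (P 0 2) (P 0 3) x <->
      hull T x /\ lincomb T c x = 0.
Proof.
move=> T3.
have [_ hP1 [p1 q1] z1 _] := edge_ptP hT (T3 1 isT).
have [_ hP2 [p2 q2] z2 _] := edge_ptP hT (T3 2 isT).
have [_ hP3 [p3 q3] z3 _] := edge_ptP hT (T3 3 isT).
rewrite -/P in hP1 p1 q1 z1 hP2 p2 q2 z2 hP3 p3 q3 z3.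
have l1 := (hullP nT _).1 hP1.
have l2 := (hullP nT _).1 hP2.
have l3 := (hullP nT _).1 hP3.
pose sg : R := Num.sg (F (T 0)).
have [_ _ F0 _ _] := hT.
pose r (j : 'I_4) := lam T (P 0 j) 0 / lam T (P 0 j) j.
pose c (i : 'I_4) := if i == 0 then sg else - (sg * r i).
have cF i : 0 < c i * F (T i).
  rewrite /c; case: eqP => [->|/eqP i0].
    by rewrite /sg -normrEsg normr_gt0.
  have r0 : 0 < r i.
    by move: i i0; apply: ord4P => [//|_|_|_]; exact: divr_gt0.
  rewrite mulNr mulrAC mulrC -mulrN pmulr_rgt0// oppr_gt0 /sg.
  have := T3 i i0; have [F0p|F0n|/eqP] := ltgtP (F (T 0)) 0.
  - by rewrite ltr0_sg// mulN1r oppr_lt0 nmulr_rlt0.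
  - by rewrite gtr0_sg// mul1r pmulr_rlt0.
  - by rewrite (negbTE (F0 0)).
exists c => // x; rewrite triangle_lamP hullP// /lincomb sum_ord4.
have cE : c 0 * lam T x 0 + c 1 * lam T x 1 + c 2 * lam T x 2 + c 3 * lam T x 3 =
    sg * (lam T x 0 - r 1 * lam T x 1 - r 2 * lam T x 2 - r 3 * lam T x 3).
  by rewrite /c /=; ring.
rewrite cE.
have sg0 : sg != 0 by rewrite sgr_eq0.
split=> [[w1 [w2 [w3 [[w10 w20 w30] xE]]]]|[x0]].
  split; first by move=> i; rewrite xE !addr_ge0// mulr_ge0.
  rewrite !xE (z1 2)// (z1 3)// (z2 1)// (z2 3)// (z3 1)// (z3 2)// /r.
  by field; rewrite !gt_eqF.
move=> /eqP; rewrite mulf_eq0 (negbTE sg0)/= => /eqP e0.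
exists (lam T x 1 / lam T (P 0 1) 1), (lam T x 2 / lam T (P 0 2) 2),
  (lam T x 3 / lam T (P 0 3) 3).
split; first by rewrite !divr_ge0// ltW.
apply: ord4P; rewrite ?(z1 2)// ?(z1 3)// ?(z2 1)// ?(z2 3)// ?(z3 1)// ?(z3 2)//.
- have -> : lam T x 0 = r 1 * lam T x 1 + r 2 * lam T x 2 + r 3 * lam T x 3.
    by move: e0; lra.
  by rewrite /r; field; rewrite !gt_eqF.
- by field; rewrite !gt_eqF.
- by field; rewrite !gt_eqF.
- by field; rewrite !gt_eqF.
Qed.

(** In a four-edge cut the two triangles lie in the zero sets of two linear
combinations that agree up to a multiple of [g], which vanishes on the common
edge; the sign of that multiple decides whether the patch is the zero set of
their minimum or of their maximum. *)
Lemma four_edge_triangles : four_edge_cut F T ->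
  exists c1 c2 g : 'I_4 -> R, exists kappa : R,
  [/\ forall i, 0 < c1 i * F (T i), forall i, 0 < c2 i * F (T i),
      forall x, lincomb T c1 x - lincomb T c2 x = kappa * lincomb T g x,
      forall x, triangle (P 0 1) (P 1 2) (P 3 0) x <->
        [/\ hull T x, lincomb T c1 x = 0 & lincomb T g x <= 0] &
      forall x, triangle (P 1 2) (P 2 3) (P 3 0) x <->
        [/\ hull T x, lincomb T c2 x = 0 & 0 <= lincomb T g x]].
Proof.
move=> [F0 F1 F2 F3].
have F01 : F (T 0) * F (T 1) < 0 by rewrite pmulr_rlt0.
have F12 : F (T 1) * F (T 2) < 0 by rewrite nmulr_rlt0.
have F23 : F (T 2) * F (T 3) < 0 by rewrite pmulr_rlt0.
have F30 : F (T 3) * F (T 0) < 0 by rewrite nmulr_rlt0.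
have [_ hP1 [p0 p1] zp _] := edge_ptP hT F01.
have [_ hP2 [q1 q2] zq _] := edge_ptP hT F12.
have [_ hP3 [s2 s3] zs _] := edge_ptP hT F23.
have [_ hP4 [u3 u0] zu _] := edge_ptP hT F30.
rewrite -/P in hP1 p0 p1 zp hP2 q1 q2 zq hP3 s2 s3 zs hP4 u3 u0 zu.
have {}zp := (zp 2 isT isT, zp 3 isT isT).
have {}zq := (zq 0 isT isT, zq 3 isT isT).
have {}zs := (zs 0 isT isT, zs 1 isT isT).
have {}zu := (zu 1 isT isT, zu 2 isT isT).
move: (lam T (P 0 1)) (lam T (P 1 2)) (lam T (P 2 3)) (lam T (P 3 0))
  p0 p1 zp q1 q2 zq s2 s3 zs u3 u0 zu (@triangle_lamP (P 0 1) (P 1 2) (P 3 0))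
  (@triangle_lamP (P 1 2) (P 2 3) (P 3 0)) ((hullP nT _).1 hP1)
  ((hullP nT _).1 hP2) ((hullP nT _).1 hP3) ((hullP nT _).1 hP4).
move=> p q s u p0 p1 [p2 p3] q1 q2 [q0 q3] s2 s3 [s0 s1] u3 u0 [u1 u2].
move=> tri1 tri2 lp lq ls lu.
(* [c1] and [c2] vanish at the corners of the first and of the second triangle,
   [g] at their common corners [P 1 2] and [P 3 0]. *)
pose c1 (i : 'I_4) : R := nth 0 [:: 1; - (p 0 / p 1); p 0 * q 1 / (p 1 * q 2);
  - (u 0 / u 3)] i.
pose c2 (i : 'I_4) : R := nth 0 [:: 1; - (u 0 * s 3 * q 2 / (u 3 * s 2 * q 1));
  u 0 * s 3 / (u 3 * s 2); - (u 0 / u 3)] i.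
pose g (i : 'I_4) : R := nth 0 [:: 0; - q 2; q 1; 0] i.
have c1E x : lincomb T c1 x = lam T x 0 - p 0 / p 1 * lam T x 1
    + p 0 * q 1 / (p 1 * q 2) * lam T x 2 - u 0 / u 3 * lam T x 3.
  by rewrite /lincomb sum_ord4 /c1/=; ring.
have c2E x : lincomb T c2 x = lam T x 0 - u 0 * s 3 * q 2 / (u 3 * s 2 * q 1) * lam T x 1
    + u 0 * s 3 / (u 3 * s 2) * lam T x 2 - u 0 / u 3 * lam T x 3.
  by rewrite /lincomb sum_ord4 /c2/=; ring.
have gE x : lincomb T g x = q 1 * lam T x 2 - q 2 * lam T x 1.
  by rewrite /lincomb sum_ord4 /g/=; ring.
have n0 : [/\ p 1 != 0, q 1 != 0, q 2 != 0, s 2 != 0 & s 3 != 0] /\ u 3 != 0 /\ u 0 != 0.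
  by rewrite !gt_eqF.
case: n0 => -[np1 nq1 nq2 ns2 ns3] [nu3 nu0].
exists c1, c2, g, ((c1 2 - c2 2) / q 1); split.
- by apply: ord4P; rewrite /c1/= ?mul1r ?mulNr -?mulrN//;
    repeat (rewrite ?oppr_gt0 ?invr_gt0//; apply: mulr_gt0 => //).
- by apply: ord4P; rewrite /c2/= ?mul1r ?mulNr -?mulrN//;
    repeat (rewrite ?oppr_gt0 ?invr_gt0//; apply: mulr_gt0 => //).
- by move=> x; rewrite c1E c2E gE /c1 /c2/=; rewrite kappa_alg.
- move=> x;
  split=> [/tri1[w0 [w1 [w2 [[w00 w10 w20] xE]]]]|[hx x1 xg]].
    have x0 i : 0 <= lam T x i by rewrite xE !addr_ge0// mulr_ge0.
    have [|e1 e2] := @path_weights _ (lam T x 2) (lam T x 1) (lam T x 0) (lam T x 3)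
        _ (q 1) _ (p 0) (u 0) _ q2 p1 u3.
      exists w1, w0, w2; split => //; rewrite !xE ?(p2, p3, q0, q3, u1, u2).
      by split; ring.
    split; first exact/(hullP nT).
      by rewrite c1E plane1_alg// {1}e1 subrr.
    by rewrite gE -oppr_ge0 opprB (mulrC (q 2)).
  have /(hullP nT) x0 := hx.
  have [||w1 [w0 [w2 [[w10 w00 w20] [e2 e1 e0 e3]]]]] := @path_weights_exist _
      (lam T x 2) (lam T x 1) (lam T x 0) (lam T x 3)
      _ (q 1) _ (p 0) (u 0) _ q2 p1 u3 (x0 2) (x0 3).
  - by apply/eqP; rewrite -subr_eq0 -plane1_alg// -c1E x1.
  - by rewrite -oppr_le0 opprB (mulrC _ (q 2)) -gE.
  apply/tri1; exists w0, w1, w2; split => //.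
  apply: ord4P; rewrite ?(e0, e1, e2, e3) ?(p2, p3, q0, q3, u1, u2);
    by rewrite !mulr0 ?addr0 ?add0r// addrC.
- move=> x;
  split=> [/tri2[w0 [w1 [w2 [[w00 w10 w20] xE]]]]|[hx x1 xg]].
    have x0 i : 0 <= lam T x i by rewrite xE !addr_ge0// mulr_ge0.
    have [|e1 e2] := @path_weights _ (lam T x 1) (lam T x 2) (lam T x 3) (lam T x 0)
        _ (q 2) _ (s 3) (u 3) _ q1 s2 u0.
      exists w0, w1, w2; split => //; rewrite !xE ?(s0, s1, q0, q3, u1, u2).
      by split; ring.
    split; first exact/(hullP nT).
      by rewrite c2E plane2_alg// {1}e1 subrr mulr0.
    by rewrite gE (mulrC (q 1)).
  have /(hullP nT) x0 := hx.
  have [||w0 [w1 [w2 [[w00 w10 w20] [e1 e2 e3 e0]]]]] := @path_weights_exist _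
      (lam T x 1) (lam T x 2) (lam T x 3) (lam T x 0)
      _ (q 2) _ (s 3) (u 3) _ q1 s2 u0 (x0 1) (x0 0).
  - apply/eqP; rewrite -subr_eq0; move/eqP: x1; rewrite c2E plane2_alg//.
    by rewrite mulf_eq0 oppr_eq0 mulf_eq0 invr_eq0 (negbTE nu0) (negbTE nu3).
  - by rewrite (mulrC _ (q 1)) -gE.
  apply/tri2; exists w0, w1, w2; split => //.
  apply: ord4P; rewrite ?(e0, e1, e2, e3) ?(s0, s1, q0, q3, u1, u2);
    by rewrite !mulr0 ?addr0 ?add0r.
Qed.
End Patches.

Lemma sum3_eq0 (K : realFieldType) (w0 w1 w2 a b c : K) :
  0 <= w0 -> 0 <= w1 -> 0 <= w2 -> 0 <= a -> 0 <= b -> 0 <= c ->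
  w0 * a + w1 * b + w2 * c = 0 ->
  [/\ 0 < a -> w0 = 0, 0 < b -> w1 = 0 & 0 < c -> w2 = 0].
Proof.
move=> w00 w10 w20 a0 b0 c0; have m0 := mulr_ge0 w00 a0.
have m1 := mulr_ge0 w10 b0; have m2 := mulr_ge0 w20 c0 => s0.
have [e0 e1 e2] : [/\ w0 * a = 0, w1 * b = 0 & w2 * c = 0] by split; lra.
split => p0; apply/eqP.
- by move/eqP: e0; rewrite mulf_eq0 (gt_eqF p0) orbF.
- by move/eqP: e1; rewrite mulf_eq0 (gt_eqF p0) orbF.
- by move/eqP: e2; rewrite mulf_eq0 (gt_eqF p0) orbF.
Qed.

Section PatchSeparation.
Context {R : realType}.
Variables (U : set 'rV[R]_3) (F : 'rV[R]_3 -> R) (T : tet R).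
Hypothesis hT : cut_tet U F T.
Let nT : Defs.nondegenerate T. Proof. by case: hT. Qed.
Let P := edge_pt U F T.

Lemma not_three_edge : four_edge_cut F T -> ~ three_edge_cut F T.
Proof.
move=> [F0 _ F2 _] /(_ 2 isT); apply/negP; rewrite -leNgt.
by rewrite mulr_ge0// ltW.
Qed.

Lemma linear_patch3 : three_edge_cut F T ->
  linear_patch U F T = triangle (P 0 1) (P 0 2) (P 0 3).
Proof.
by move=> T3; rewrite /linear_patch /patch_triangles asboolT// bigcup_set1.
Qed.

Lemma linear_patch4 : four_edge_cut F T ->
  linear_patch U F T =
    triangle (P 0 1) (P 1 2) (P 3 0) `|` triangle (P 1 2) (P 2 3) (P 3 0).
Proof.
move=> T4; rewrite /linear_patch /patch_triangles asboolF; last exact: not_three_edge.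
by rewrite asboolT// bigcup_setU !bigcup_set1.
Qed.

(** The two triangles of a four-edge patch share a diagonal, on the two sides of
which the difference of the two affine functions has opposite signs. According
to the side on which the first one is smaller, the patch is the zero set of
their minimum or of their maximum. *)
Lemma patch_separating : normal_position F T ->
  exists2 psi, separating F T psi &
    forall x, linear_patch U F T x <-> hull T x /\ psi x = 0.
Proof.
move=> [T3|T4].
  have [c cF cE] := three_edge_triangle hT T3.
  exists (lincomb T c); first exact: (separating_lincomb hT cF).
  by move=> x; rewrite linear_patch3.
have [c1 [c2 [g [kappa [c1F c2F dE K1 K2]]]]] := four_edge_triangles hT T4.
have [s1 s2] := (separating_lincomb hT c1F, separating_lincomb hT c2F).
have [k0|k0] := leP 0 kappa.
  exists (fun x => Num.min (lincomb T c1 x) (lincomb T c2 x)).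
    exact: separating_min.
  move=> x; rewrite linear_patch4//.
  have gle : lincomb T g x <= 0 -> lincomb T c1 x <= lincomb T c2 x.
    by move=> g0; rewrite -subr_le0 dE mulr_ge0_le0.
  have gge : 0 <= lincomb T g x -> lincomb T c2 x <= lincomb T c1 x.
    by move=> g0; rewrite -subr_ge0 dE mulr_ge0.
  split=> [[/K1[Tx p0 /gle]|/K2[Tx p0 /gge]]|[Tx m0]].
  - by move=> /min_l ->.
  - by move=> /min_r ->.
  have [g0|/ltW g0] := leP (lincomb T g x) 0.
    by left; apply/K1; split => //; rewrite -m0 min_l// gle.
  by right; apply/K2; split => //; rewrite -m0 min_r// gge.
exists (fun x => Num.max (lincomb T c1 x) (lincomb T c2 x)).
  exact: separating_max.
move=> x; rewrite linear_patch4//.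
have gle : lincomb T g x <= 0 -> lincomb T c2 x <= lincomb T c1 x.
  by move=> g0; rewrite -subr_ge0 dE mulr_le0// ltW.
have gge : 0 <= lincomb T g x -> lincomb T c1 x <= lincomb T c2 x.
  by move=> g0; rewrite -subr_le0 dE mulr_le0_ge0// ltW.
split=> [[/K1[Tx p0 /gle]|/K2[Tx p0 /gge]]|[Tx m0]].
- by move=> /max_l ->.
- by move=> /max_r ->.
have [g0|/ltW g0] := leP (lincomb T g x) 0.
  by left; apply/K1; split => //; rewrite -m0 max_l// gle.
by right; apply/K2; split => //; rewrite -m0 max_r// gge.
Qed.

Lemma patch_triangle_plane K : patch_triangles U F T K ->
  exists2 c : 'I_4 -> R, (forall i, 0 < c i * F (T i)) &
    forall x, K x -> hull T x /\ lincomb T c x = 0.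
Proof.
rewrite /patch_triangles; case: asboolP => [T3 ->|_].
  have [c cF cE] := three_edge_triangle hT T3.
  by exists c => // x /cE.
case: asboolP => // T4.
have [c1 [c2 [g [kappa [c1F c2F _ K1 K2]]]]] := four_edge_triangles hT T4.
by case=> ->; [exists c1 => // x /K1[]|exists c2 => // x /K2[]].
Qed.

Lemma triangle_segment (a b c x y z : 'rV[R]_3) :
  triangle a b c x -> triangle a b c y -> segment x y z -> triangle a b c z.
Proof. by move=> tx ty [t [t01 ->]]; exact: hull_segment. Qed.

Lemma triangle_vertices (a b c : 'rV[R]_3) :
  [/\ triangle a b c a, triangle a b c b & triangle a b c c].
Proof.
split; apply/triangleP.
- by exists 1, 0, 0; rewrite !scale0r !addr0 scale1r ler01 lexx.
- by exists 0, 1, 0; rewrite !scale0r !addr0 !add0r scale1r ler01 lexx.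
- by exists 0, 0, 1; rewrite !scale0r !add0r scale1r ler01 lexx.
Qed.

Lemma edge_pt_sym i j : P i j = P j i.
Proof. exact: edge_point_sym. Qed.

Let opp i j := F (T i) * F (T j) < 0.

Let oppC i j : opp i j = opp j i. Proof. by rewrite /opp mulrC. Qed.

Let oppP i j : opp i j -> (0 < F (T i)) != (0 < F (T j)).
Proof.
rewrite /opp; apply: contraTneq; rewrite -leNgt; have [Fi /esym Fj|Fi /esym/negbT] := ltP 0 (F (T i)).
  by rewrite mulr_ge0// ltW.
by rewrite -leNgt => Fj; rewrite mulr_le0.
Qed.

(** Two cut edges at a vertex carry consecutive corners of the patch, and
consecutive corners of a quadrilateral belong to one of its two triangles,
whichever diagonal is drawn. *)
Lemma vertex_triangle a : normal_position F T ->
  exists2 K, patch_triangles U F T K /\ (exists p q r, K = triangle p q r) &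
    forall b, opp a b -> K (P a b).
Proof.
rewrite /patch_triangles; case: asboolP => [T3 _|_ []// T4].
  have [v1 v2 v3] := triangle_vertices (P 0 1) (P 0 2) (P 0 3).
  have v i : i != 0 -> triangle (P 0 1) (P 0 2) (P 0 3) (P 0 i).
    by move: i; apply: ord4P.
  exists (triangle (P 0 1) (P 0 2) (P 0 3)); first by split => //; do 3 eexists.
  move=> b; have [->|a0] := eqVneq a 0.
    move=> ab; apply: v; apply: contraTneq ab => ->.
    by rewrite /opp -leNgt -expr2 sqr_ge0.
  move=> /oppP; have [-> _|b0 ab] := eqVneq b 0; first by rewrite (edge_pt_sym a 0); exact: v.
  have := T3 a a0; have := T3 b b0; move: ab.
  have [Fa|Fa] := ltP 0 (F (T a)); have [Fb|Fb] := ltP 0 (F (T b)) => // _.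
    by move=> + Ba; move: Ba; rewrite (pmulr_llt0 _ Fa) => /ltW F0; rewrite ltNge mulr_le0.
  by rewrite (pmulr_llt0 _ Fb) => /ltW F0; rewrite ltNge mulr_le0.
rewrite asboolT//; have [F0 F1 F2 F3] := T4.
have [u1 u2 u3] := triangle_vertices (P 0 1) (P 1 2) (P 3 0).
have [v1 v2 v3] := triangle_vertices (P 1 2) (P 2 3) (P 3 0).
have no i j : (0 < F (T i)) = (0 < F (T j)) -> ~ opp i j.
  by move=> ij /oppP; rewrite ij eqxx.
have s0 : 0 < F (T 0) = true := F0; have s2 : 0 < F (T 2) = true := F2.
have s1 : 0 < F (T 1) = false by apply/negbTE; rewrite -leNgt ltW.
have s3 : 0 < F (T 3) = false by apply/negbTE; rewrite -leNgt ltW.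
move: a; apply: ord4P.
- exists (triangle (P 0 1) (P 1 2) (P 3 0)); first by split; [left|do 3 eexists].
  apply: ord4P => o.
  + by case: (no _ _ erefl o).
  + exact: u1.
  + by case: (no _ _ (etrans s0 (esym s2)) o).
  + by rewrite (edge_pt_sym 0 3); exact: u3.
- exists (triangle (P 0 1) (P 1 2) (P 3 0)); first by split; [left|do 3 eexists].
  apply: ord4P => o.
  + by rewrite (edge_pt_sym 1 0); exact: u1.
  + by case: (no _ _ erefl o).
  + exact: u2.
  + by case: (no _ _ (etrans s1 (esym s3)) o).
- exists (triangle (P 1 2) (P 2 3) (P 3 0)); first by split; [right|do 3 eexists].
  apply: ord4P => o.
  + by case: (no _ _ (etrans s2 (esym s0)) o).
  + by rewrite (edge_pt_sym 2 1); exact: v1.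
  + by case: (no _ _ erefl o).
  + exact: v2.
- exists (triangle (P 1 2) (P 2 3) (P 3 0)); first by split; [right|do 3 eexists].
  apply: ord4P => o.
  + exact: v3.
  + by case: (no _ _ (etrans s3 (esym s1)) o).
  + by rewrite (edge_pt_sym 3 2); exact: v2.
  + by case: (no _ _ erefl o).
Qed.

(** The segment joining the edge points of two edges at a vertex, which is the
trace of the patch on their common face, does not depend on the cell. *)
Lemma patch_of_face_segment a b c x : normal_position F T -> opp a b -> opp a c ->
  segment (P a b) (P a c) x -> linear_patch U F T x.
Proof.
move=> /(vertex_triangle a)[K [KP [p [q [r KE]]]] Ka] ab ac sx.
exists K => //; move: (Ka) sx; rewrite KE => {}Ka.
exact: triangle_segment (Ka b ab) (Ka c ac).
Qed.

Let edge_in A i j x w : opp i j -> hull_on T A x ->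
  (forall k, lam T x k = 0 -> 0 < lam T (P i j) k -> w = 0 :> R) ->
  w != 0 -> i \in A /\ j \in A.
Proof.
move=> ij /(hull_onP nT)[_ xA] hw w0; have [_ _ [pi pj] _ _] := edge_ptP hT ij.
split; apply: contrapT => /negP/xA x0; move/eqP: w0; apply.
- exact: hw x0 pi.
- exact: hw x0 pj.
Qed.

Let share_vertex (A : {set 'I_4}) i j k l x : A != [set: 'I_4]%SET ->
  opp i j -> opp k l -> i \in A -> j \in A -> k \in A -> l \in A ->
  segment (P i j) (P k l) x ->
  exists a b c, [/\ [/\ a \in A, b \in A & c \in A], opp a b, opp a c &
    segment (P a b) (P a c) x].
Proof.
move=> AT ij kl iA jA kA lA sx.
have [E|ik] := eqVneq i k; first by subst k; exists i, j, l.
have [E|il] := eqVneq i l.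
  subst l; exists i, j, k; rewrite (edge_pt_sym i k).
  by split; [split|exact: ij|rewrite oppC|].
have [E|jk] := eqVneq j k.
  subst k; exists j, i, l; rewrite (edge_pt_sym j i).
  by split; [split|rewrite oppC|exact: kl|].
have [E|jl] := eqVneq j l.
  subst l; exists j, i, k; rewrite (edge_pt_sym j i) (edge_pt_sym j k).
  by split; [split|rewrite oppC|rewrite oppC|].
have ne a b : opp a b -> a != b.
  by move=> /oppP; apply: contraNneq => ->.
case/negP: AT; rewrite eqEcard finset.subsetT cardsT card_ord.
have /card_uniqP U4 : uniq [:: i; j; k; l].
  by rewrite /= !inE !negb_or (ne _ _ ij) ik il jk jl (ne _ _ kl).
rewrite /=; apply: (@leq_trans #|[:: i; j; k; l]|); first by rewrite U4.
by apply: subset_leq_card; apply/fintype.subsetP => z; rewrite !inE => /or4P[] /eqP ->.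
Qed.

Let face_of_triangle (A : {set 'I_4}) i1 j1 i2 j2 i3 j3 x : A != [set: 'I_4]%SET ->
  opp i1 j1 -> opp i2 j2 -> opp i3 j3 ->
  (forall k, k \in [:: i1; j1; i2; j2; i3; j3]) ->
  triangle (P i1 j1) (P i2 j2) (P i3 j3) x -> hull_on T A x ->
  exists a b c, [/\ [/\ a \in A, b \in A & c \in A], opp a b, opp a c &
    segment (P a b) (P a c) x].
Proof.
move=> AT o1 o2 o3 cov tx Ax.
have [_ h1 _ _ _] := edge_ptP hT o1; have [_ h2 _ _ _] := edge_ptP hT o2.
have [_ h3 _ _ _] := edge_ptP hT o3.
have [w0 [w1 [w2 [[w00 w10 w20 w1E] xE]]]] := (triangleP _ _ _ _).1 tx.
have W i : lam T x i = 0 -> [/\ 0 < lam T (P i1 j1) i -> w0 = 0,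
    0 < lam T (P i2 j2) i -> w1 = 0 & 0 < lam T (P i3 j3) i -> w2 = 0].
  have -> : lam T x i = w0 * lam T (P i1 j1) i + w1 * lam T (P i2 j2) i +
      w2 * lam T (P i3 j3) i.
    rewrite xE; pose a (k : 'I_3) := nth 0 [:: w0; w1; w2] k.
    pose v (k : 'I_3) := nth 0 [:: P i1 j1; P i2 j2; P i3 j3] k.
    have := @lam_affine _ T nT 'I_3 a v i.
    by rewrite !big_ord_recl !big_ord0 !addr0 /a /v /= !addrA; exact.
  have := sum3_eq0 w00 w10 w20 ((hullP nT _).1 h1 i) ((hullP nT _).1 h2 i)
    ((hullP nT _).1 h3 i); exact.
have E1 : w0 != 0 -> i1 \in A /\ j1 \in A.
  by apply: edge_in o1 Ax _ => k /W[].
have E2 : w1 != 0 -> i2 \in A /\ j2 \in A.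
  by apply: edge_in o2 Ax _ => k /W[].
have E3 : w2 != 0 -> i3 \in A /\ j3 \in A.
  by apply: edge_in o3 Ax _ => k /W[].
have seg p q r s t : x = s *: p + t *: q + 0 *: r -> s + t = 1 -> 0 <= s -> 0 <= t ->
    segment p q x.
  move=> -> st s0 t0; exists t; rewrite -st scale0r addr0 addrK; split => //.
  by rewrite t0/= lerDr.
have mk i j k l : opp i j -> opp k l -> i \in A -> j \in A -> k \in A -> l \in A ->
  segment (P i j) (P k l) x -> _ := @share_vertex A i j k l x AT.
have [e0|/E1[a1 b1]] := eqVneq w0 0.
  have [e1|/E2[a2 b2]] := eqVneq w1 0.
    move: w1E xE; rewrite e0 e1 !add0r => w1E xE; move: E3; rewrite w1E oner_eq0.
    move=> /(_ isT)[a3 b3]; apply: (mk i3 j3 i3 j3) => //.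
    by exists 0; rewrite ler01 lexx subr0 xE !scale0r !add0r addr0 w1E.
  have [e2|/E3[a3 b3]] := eqVneq w2 0.
    apply: (mk i2 j2 i2 j2) => //; move: w1E xE; rewrite e0 e2 add0r addr0 => -> ->.
    by exists 0; rewrite ler01 lexx subr0 !scale0r add0r !addr0.
  apply: (mk i2 j2 i3 j3) => //; apply: (seg _ _ (P i1 j1) w1 w2) => //.
    by rewrite xE e0 !scale0r addr0 add0r.
  by rewrite -w1E e0 add0r.
have [e1|/E2[a2 b2]] := eqVneq w1 0.
  have [e2|/E3[a3 b3]] := eqVneq w2 0.
    apply: (mk i1 j1 i1 j1) => //; move: w1E xE; rewrite e1 e2 !addr0 => -> ->.
    by exists 0; rewrite ler01 lexx subr0 !scale0r !addr0.
  apply: (mk i1 j1 i3 j3) => //; apply: (seg _ _ (P i1 j1) w0 w2) => //.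
    by rewrite xE e1 !scale0r !addr0.
  by rewrite -w1E e1 addr0.
have [e2|/E3[a3 b3]] := eqVneq w2 0.
  apply: (mk i1 j1 i2 j2) => //; apply: (seg _ _ (P i1 j1) w0 w1) => //.
    by rewrite xE e2 !scale0r !addr0.
  by rewrite -w1E e2 addr0.
case/negP: AT; rewrite finset.eqEsubset finset.subsetT; apply/fintype.subsetP => k _.
by move: (cov k); rewrite !inE; do 5 (case/orP => [/eqP -> //|]); move=> /eqP ->.
Qed.

(** Conversely, the trace of the patch on a proper face consists of such
segments: two of the edges carrying the corners of a patch triangle either
share a vertex or span the whole tetrahedron. *)
Lemma patch_face_segment (A : {set 'I_4}) x : normal_position F T ->
  A != [set: 'I_4]%SET -> linear_patch U F T x -> hull_on T A x ->
  exists a b c, [/\ [/\ a \in A, b \in A & c \in A], opp a b, opp a c &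
    segment (P a b) (P a c) x].
Proof.
move=> [T3|T4] AT.
  rewrite linear_patch3//; apply: face_of_triangle => //; try exact: T3.
  exact: ord4P.
have [F0 F1 F2 F3] := T4; rewrite linear_patch4//.
have o01 : opp 0 1 by rewrite /opp pmulr_rlt0.
have o21 : opp 1 2 by rewrite /opp pmulr_llt0.
have o23 : opp 2 3 by rewrite /opp pmulr_rlt0.
have o30 : opp 3 0 by rewrite /opp pmulr_llt0.
by case; apply: face_of_triangle => //; exact: ord4P.
Qed.

End PatchSeparation.

(** * The local lift *)

Section LocalMap.
Context {R : realType}.
Variables (U : set 'rV[R]_3) (F : 'rV[R]_3 -> R) (T : tet R).
Hypothesis hT : cut_tet U F T.
Let nT : Defs.nondegenerate T. Proof. by case: hT. Qed.
Let Gam := zero_set U F.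

Let sepF : separating F T F. Proof. by case: hT. Qed.

Lemma zero_set_mixed x : hull T x -> Gam x -> mixed F T x.
Proof. by move=> Tx /(zero_setP hT Tx); exact: (zero_mixed hT sepF Tx). Qed.

Lemma patch_mixed x : normal_position F T -> linear_patch U F T x -> mixed F T x.
Proof.
by move=> /(patch_separating hT)[psi spsi ppsi] /ppsi[Tx px]; exact: (zero_mixed hT spsi Tx px).
Qed.

Section ThreeEdges.
Hypothesis T3 : three_edge_cut F T.

Let T0 : F (T 0) != 0. Proof. by case: hT. Qed.

Let lone i : i != 0 -> (0 < F (T i)) = ~~ (0 < F (T 0)).
Proof.
move=> /T3; have [F0|] := ltP 0 (F (T 0)).
  by rewrite pmulr_rlt0// => /ltW; rewrite leNgt => /negbTE.
by rewrite le_eqVlt (negbTE T0)/= => F0; rewrite nmulr_rlt0.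
Qed.

Let lam0E x : 1 - lam T x 0 = \sum_(i | i != 0) lam T x i.
Proof. by rewrite -[1](lam_sum nT x) (bigD1 0)//= addrAC subrr add0r. Qed.

Let lam0_gt0 x : mixed F T x -> 0 < lam T x 0 /\ 0 < 1 - lam T x 0.
Proof.
move=> [_]; rewrite lam0E /psum /nsum.
have [F0|F0] := boolP (0 < F (T 0)).
  rewrite (bigD1 0)//= big1 => [|i /andP[+ i0]]; last by rewrite lone// F0.
  rewrite addr0 => -> n0; split => //; rewrite (le_lt_trans _ (lt_le_trans n0 _))//.
  by rewrite le_eqVlt; apply/orP; left; apply/eqP; apply: eq_bigl => i;
    have [->|i0] := eqVneq i 0; rewrite ?F0// lone ?F0.
move=> p0; rewrite (bigD1 0)//= big1 => [|i /andP[+ i0]]; last by rewrite lone// F0.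
rewrite addr0 => -> ; split => //; rewrite (lt_le_trans p0)//.
rewrite le_eqVlt; apply/orP; left; apply/eqP; apply: eq_bigl => i.
by have [->|i0] := eqVneq i 0; rewrite ?(negbTE F0)// lone ?F0.
Qed.

(** Rays from the lone vertex are the joins of that vertex with the points of
the opposite face. *)
Lemma ray_pointsP x y : mixed F T x ->
  ray_points U F T x y <-> Gam y /\ coax F T x y.
Proof.
move=> mx; have [x0 x0'] := lam0_gt0 mx; have [Tx _ _] := mx.
have rayE t : T 0 + t *: (x - T 0) = (1 - t) *: T 0 + t *: x.
  by rewrite scalerBr scalerBl scale1r addrA addrAC.
split=> [[Gy Ty [t t0 yE]]|[Gy cxy]].
  split => //; have my := zero_set_mixed Ty Gy; have [y0 y0'] := lam0_gt0 my.
  have yi i : i != 0 -> lam T y i = t * lam T x i.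
    by move=> i0; rewrite yE rayE lam_segment// lam_vertex// (negbTE i0) mulr0 add0r.
  have y0E : 1 - lam T y 0 = t * (1 - lam T x 0).
    by rewrite !lam0E mulr_sumr; apply: eq_bigr.
  have tp : 0 < t by move: y0'; rewrite y0E pmulr_lgt0.
  exists (if 0 < F (T 0) then lam T y 0 / lam T x 0 else t),
    (if 0 < F (T 0) then t else lam T y 0 / lam T x 0).
  split; [by case: ifP => // _; rewrite divr_gt0|by case: ifP => // _; rewrite divr_gt0|].
  move=> i; have [->|i0] := eqVneq i 0; last by rewrite lone// yi//; case: (0 < F (T 0)).
  by case: (0 < F (T 0)); rewrite divfK ?lt0r_neq0.
split => //; first exact: (coax_hull hT cxy).
case: cxy => a [b [a0 b0 yE]]; set t := if 0 < F (T 0) then b else a.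
exists t; first by rewrite /t; case: ifP => _; exact: ltW.
have yi i : i != 0 -> lam T y i = t * lam T x i.
  by move=> i0; rewrite yE lone// /t; case: (0 < F (T 0)).
apply: (lam_inj nT) => i; rewrite rayE lam_segment// lam_vertex//.
have [->|i0] := eqVneq i 0; last by rewrite mulr0 add0r yi.
have : 1 - lam T y 0 = t * (1 - lam T x 0).
  by rewrite !lam0E mulr_sumr; apply: eq_bigr.
by rewrite /= mulr1 => E; lra.
Qed.
End ThreeEdges.

Section FourEdges.
Hypothesis T4 : four_edge_cut F T.

Let u x := lam T x 2 / (lam T x 0 + lam T x 2).
Let v x := lam T x 3 / (lam T x 1 + lam T x 3).

Let psum4 x : psum F T x = lam T x 0 + lam T x 2.
Proof.
have [F0 F1 F2 F3] := T4; rewrite /psum big_mkcond sum_ord4 F0 F2.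
by rewrite !ifF ?addr0//; apply/negbTE; rewrite -leNgt ltW.
Qed.

Let nsum4 x : nsum F T x = lam T x 1 + lam T x 3.
Proof.
have [F0 F1 F2 F3] := T4; rewrite /nsum big_mkcond sum_ord4 F0 F2/= add0r addr0.
by rewrite !ifT//; rewrite -leNgt ltW.
Qed.

Lemma lam_join_point a b w :
  [/\ lam T (join_point T a b w) 0 = (1 - w) * (1 - a),
      lam T (join_point T a b w) 1 = w * (1 - b),
      lam T (join_point T a b w) 2 = (1 - w) * a &
      lam T (join_point T a b w) 3 = w * b].
Proof.
by rewrite /join_point; split; rewrite lam_segment// !lam_segment// !lam_vertex//=;
  rewrite !(mulr0, mulr1, addr0, add0r).
Qed.

Let join_pointE x w : mixed F T x ->
  join_point T (u x) (v x) w = (1 - w) *: pos_end F T x + w *: neg_end F T x.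
Proof.
move=> mx; have [_ + +] := mx; rewrite psum4 nsum4 => p0 n0.
have [F0 F1 F2 F3] := T4; have [J0 J1 J2 J3] := lam_join_point (u x) (v x) w.
have u1 : 1 - u x = lam T x 0 / (lam T x 0 + lam T x 2).
  by rewrite /u -[1](divff (lt0r_neq0 p0)) -mulrBl addrK.
have v1 : 1 - v x = lam T x 1 / (lam T x 1 + lam T x 3).
  by rewrite /v -[1](divff (lt0r_neq0 n0)) -mulrBl addrK.
apply: (lam_inj nT); apply: ord4P; rewrite (lam_join hT)// psum4 nsum4.
- by rewrite J0 u1 F0 mulrAC mulrA.
- by rewrite J1 v1 ltNge (ltW F1)/= mulrAC mulrA.
- by rewrite J2 F2 mulrAC mulrA.
- by rewrite J3 ltNge (ltW F3)/= mulrAC mulrA.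
Qed.

(** For the parameters of [x] the segment from [M(u)] to [N(v)] is the join
through [x]. *)
Lemma join_params_mixed x : mixed F T x ->
  exists w, [/\ join_params U F T (u x) (v x) w,
    forall w', join_params U F T (u x) (v x) w' -> w' = w,
    Gam (join_point T (u x) (v x) w) &
    coax F T x (join_point T (u x) (v x) w)].
Proof.
move=> mx; have [y [Ty cxy Fy uy]] := coax_zero_ex1 hT sepF mx.
have [w w01 yE] := coax_on_join hT mx cxy.
have jE : join_point T (u x) (v x) w = y by rewrite join_pointE// yE.
have Gy : Gam y by apply/(zero_setP hT Ty).
exists w; rewrite jE; split => //; first by split => //; rewrite jE.
move=> w' [w'01 Gw']; have cw' := coax_join hT mx w'01.
have [Tx _ _] := mx; have Tw' := coax_hull hT cw' Tx.
have : join_point T (u x) (v x) w' = y.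
  by rewrite join_pointE//; apply: uy => //; apply/(zero_setP hT Tw'); rewrite -join_pointE.
have [_ K1 _ K3] := lam_join_point (u x) (v x) w'.
have [_ L1 _ L3] := lam_join_point (u x) (v x) w.
rewrite -jE => E; move: K1 K3; rewrite E L1 L3; lra.
Qed.

(** Every pair of parameters is that of a mixed point, the midpoint of its join;
it is mixed even when [u] or [v] is 0 or 1. *)
Lemma join_params_ex1 a b : 0 <= a <= 1 -> 0 <= b <= 1 ->
  exists! w, join_params U F T a b w.
Proof.
move=> /andP[a0 a1] /andP[b0 b1]; have [J0 J1 J2 J3] := lam_join_point a b 2^-1.
pose x := join_point T a b 2^-1; have h0 : 0 < (2^-1 : R) by rewrite invr_gt0.
have h1 : 1 - 2^-1 = 2^-1 :> R by lra.
move: J0 J1 J2 J3; rewrite h1 -/x => J0 J1 J2 J3.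
have px : lam T x 0 + lam T x 2 = 2^-1 by rewrite J0 J2; lra.
have nx : lam T x 1 + lam T x 3 = 2^-1 by rewrite J1 J3; lra.
have mx : mixed F T x.
  split; rewrite ?psum4 ?nsum4 ?px ?nx//; apply/(hullP nT); apply: ord4P.
  - by rewrite J0 mulr_ge0 ?subr_ge0// ltW.
  - by rewrite J1 mulr_ge0 ?subr_ge0// ltW.
  - by rewrite J2 mulr_ge0// ltW.
  - by rewrite J3 mulr_ge0// ltW.
have [w [jw uw _ _]] := join_params_mixed mx.
have ua : u x = a by rewrite /u px J2 mulrAC divff ?mul1r ?lt0r_neq0.
have vb : v x = b by rewrite /v nx J3 mulrAC divff ?mul1r ?lt0r_neq0.
by exists w; split=> [|w' jw']; [rewrite -ua -vb|symmetry; apply: uw; rewrite ua vb].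
Qed.
End FourEdges.

(** Both constructions of the lift select the zero of [F] on the join through
[x]; this common description is the only one used when cells are compared. *)
Lemma Phi_locP x : normal_position F T -> mixed F T x ->
  [/\ Gam (Phi_loc U F T x), hull T (Phi_loc U F T x) & coax F T x (Phi_loc U F T x)].
Proof.
move=> Tn mx; suff [Gy cy] : Gam (Phi_loc U F T x) /\ coax F T x (Phi_loc U F T x).
  by split => //; case: mx => Tx _ _; exact: (coax_hull hT cy Tx).
case: (pselect (three_edge_cut F T)) => T3.
  rewrite /Phi_loc asboolT//; apply/(ray_pointsP T3 _ mx).
  have [y [Ty cy Fy _]] := coax_zero_ex1 hT sepF mx.
  by apply: (@xgetI _ _ _ y); apply/(ray_pointsP T3 _ mx); split => //; apply/(zero_setP hT Ty).
have T4 : four_edge_cut F T by case: Tn.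
have [w [jw uw Gw cw]] := join_params_mixed T4 mx.
rewrite /Phi_loc asboolF// !barycentricE//.
suff -> : xget 0 (join_params U F T (lam T x 2 / (lam T x 0 + lam T x 2))
  (lam T x 3 / (lam T x 1 + lam T x 3))) = w by [].
by apply: uw; exact: xgetI jw.
Qed.

Lemma cut_well_posed : normal_position F T -> well_posed_cut U F T.
Proof.
have ep i k : F (T i) * F (T k) < 0 -> exists! P, (Gam `&` segment (T i) (T k)) P.
  move=> Fik; have [_ _ _ _ [PP uP]] := edge_ptP hT Fik.
  by exists (edge_pt U F T i k); split => // Q /uP.
move=> Tn; have [T3|T4] := Tn; [left|right]; split => //; split.
- by move=> i i0; apply: ep; exact: T3.
- move=> X pX; have mX := patch_mixed Tn pX.
  have [y [Ty cy Fy uy]] := coax_zero_ex1 hT sepF mX.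
  exists y; split; first by apply/(ray_pointsP T3 _ mX); split => //; apply/(zero_setP hT Ty).
  move=> z /(ray_pointsP T3 _ mX)[Gz cz]; symmetry; apply: uy => //.
  by apply/(zero_setP hT) => //; case: mX => TX _ _; exact: (coax_hull hT cz TX).
- exact: ep.
- by move=> a b; exact: join_params_ex1.
Qed.

End LocalMap.

(** * Neighbouring cells *)

Section Relabeling.
Context {R : realType}.
Variables (U : set 'rV[R]_3) (F : 'rV[R]_3 -> R) (T : tet R).

Lemma nondegenerate_relabel s : Defs.nondegenerate T -> Defs.nondegenerate (relabel T s).
Proof.
move=> nT l l0 lT i; have := nT (fun i => l ((s^-1)%g i)).
rewrite (reindex_perm s)/=; under eq_bigr do rewrite permK.
move=> /(_ l0); rewrite (reindex_perm s)/=.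
under eq_bigr do rewrite permK.
have -> : \sum_i l i *: T (s i) = \sum_i l i *: relabel T s i.
  by apply: eq_bigr => j _; rewrite ffunE.
by move=> /(_ lT (s i)); rewrite permK.
Qed.

Hypothesis nT : Defs.nondegenerate T.

Lemma lam_relabel s x i : lam (relabel T s) x i = lam T x (s i).
Proof.
apply: (@lam_uniq _ _ (nondegenerate_relabel (s := s) nT) (fun i => lam T x (s i)) x).
  by rewrite -[RHS](lam_sum nT x) [RHS](reindex_perm s).
rewrite -[LHS](lam_comb nT x) (reindex_perm s)/=.
by apply: eq_bigr => j _; rewrite ffunE.
Qed.

Lemma hull_on_relabel s (A : {set 'I_4}) : hull_on (relabel T s) A = hull_on T (s @: A).
Proof.
have nS := nondegenerate_relabel (s := s) nT.
apply/seteqP; split => x /hull_onP.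
- move=> /(_ nS)[x0 xA]; apply/(hull_onP nT); split => i; rewrite -(permKV s i).
    by rewrite -lam_relabel.
  by rewrite mem_imset; [move=> /xA; rewrite lam_relabel|exact: perm_inj].
- move=> /(_ nT)[x0 xA]; apply/(hull_onP nS); split => i; rewrite lam_relabel//.
  by move=> iA; apply: xA; rewrite mem_imset//; exact: perm_inj.
Qed.

Lemma hull_relabel s : hull (relabel T s) = hull T.
Proof.
rewrite /hull hull_on_relabel; congr hull_on; apply/setP => i.
by rewrite inE -(permKV s i) mem_imset ?inE//; exact: perm_inj.
Qed.

Lemma imset_perm_pred s (P : pred 'I_4) : (s : {perm 'I_4}) @: [set i | P (s i)]%SET = [set i | P i]%SET.
Proof.
apply/setP => i; rewrite -(permKV s i) mem_imset; last exact: perm_inj.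
by rewrite !inE.
Qed.

End Relabeling.

Section NormalPosition.
Context {R : realType}.
Variables (U : set 'rV[R]_3) (F : 'rV[R]_3 -> R) (T : tet R).
Hypothesis hT : cut_tet U F T.

Lemma cut_tet_relabel s : cut_tet U F (relabel T s).
Proof.
have [nT TU F0 [[i Fi] [j Fj]] [s1 s2 s3 s4]] := hT.
have pE : pos_face F (relabel T s) = pos_face F T.
  rewrite /pos_face hull_on_relabel//; congr hull_on; rewrite -[RHS](imset_perm_pred s).
  have -> // : [set i | 0 < F (relabel T s i)]%SET = [set i | 0 < F (T (s i))]%SET.
  by apply/setP => k; rewrite !inE ffunE.
have nE : neg_face F (relabel T s) = neg_face F T.
  rewrite /neg_face hull_on_relabel//; congr hull_on; rewrite -[RHS](imset_perm_pred s).
  have -> // : [set i | F (relabel T s i) < 0]%SET = [set i | F (T (s i)) < 0]%SET.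
  by apply/setP => k; rewrite !inE ffunE.
split; rewrite ?hull_relabel//; first exact: nondegenerate_relabel.
- by move=> k; rewrite ffunE.
- by split; [exists ((s^-1)%g i)|exists ((s^-1)%g j)]; rewrite ffunE permKV.
- by split; rewrite ?hull_relabel ?pE ?nE.
Qed.

(** With one vertex of a sign different from the others, that vertex is moved to
place 0; with two vertices of each sign, a permutation makes the signs
alternate. *)
Lemma exists_normal_position : exists s, normal_position F (relabel T s).
Proof.
have [_ _ F0 [[i Fi] [j Fj]] _] := hT.
have sg k : 0 < F (T k) \/ F (T k) < 0.
  by have := F0 k; rewrite neq_lt => /orP[?|?]; [right|left].
have lone k : (forall l, l != k -> F (T k) * F (T l) < 0) ->
    exists s, normal_position F (relabel T s).
  move=> kl; exists (tperm 0 k); left => l l0; rewrite !ffunE tpermL; apply: kl.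
  by rewrite -[X in _ != X](tpermL 0 k) (inj_eq perm_inj).
have two s : 0 < F (T ((s : {perm 'I_4}) 0)) -> F (T (s 1)) < 0 ->
    0 < F (T (s 2)) -> F (T (s 3)) < 0 -> exists s, normal_position F (relabel T s).
  by move=> ? ? ? ?; exists s; right; split; rewrite ffunE.
have pn k l : 0 < F (T k) -> F (T l) < 0 -> F (T k) * F (T l) < 0.
  by move=> ? ?; rewrite pmulr_rlt0.
have np k l : F (T k) < 0 -> 0 < F (T l) -> F (T k) * F (T l) < 0.
  by move=> ? ?; rewrite nmulr_rlt0.
have [h0|h0] := sg 0; have [h1|h1] := sg 1; have [h2|h2] := sg 2; have [h3|h3] := sg 3.
- exfalso; have : 0 < F (T j) by move: j {Fj}; exact: ord4P.
  by rewrite ltNge (ltW Fj).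
- by apply: (lone 3); apply: ord4P => // _; exact: np.
- by apply: (lone 2); apply: ord4P => // _; exact: np.
- by apply: (two (tperm 1 2)); rewrite permE.
- by apply: (lone 1); apply: ord4P => // _; exact: np.
- by apply: (two 1%g); rewrite permE.
- by apply: (two (tperm 2 3)); rewrite permE.
- by apply: (lone 0); apply: ord4P => // _; exact: pn.
- by apply: (lone 0); apply: ord4P => // _; exact: np.
- by apply: (two (tperm 0 1)); rewrite permE.
- pose s : {perm 'I_4} := (tperm 0%R 1%R * tperm 2%R 3%R)%g.
  by apply: (two s); rewrite /s permM !permE.
- by apply: (lone 1); apply: ord4P => // _; exact: pn.
- by apply: (two (tperm 0 3)); rewrite permE.
- by apply: (lone 2); apply: ord4P => // _; exact: pn.
- by apply: (lone 3); apply: ord4P => // _; exact: pn.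
- exfalso; have : F (T i) < 0 by move: i {Fi}; exact: ord4P.
  by rewrite ltNge (ltW Fi).
Qed.
End NormalPosition.

Section CommonFaces.
Context {R : realType}.
Implicit Types T : tet R.

Lemma hull_interior T : Defs.nondegenerate T -> interior (hull T) !=set0.
Proof.
move=> nT; pose c : 'rV[R]_3 := \sum_i (4^-1 : R) *: T i; exists c.
have c1 : \sum_(i < 4) (4^-1 : R) = 1 by rewrite sum_ord4; lra.
have lc i : 0 < lam T c i by rewrite (lam_uniq nT (l := fun=> 4^-1)).
have n i : \forall x \near c, 0 < lam T x i.
  have : continuous (fun x => lam T x i) by exact: lam_continuous.
  by move=> /(_ c)/cvgr_gt; apply; exact: lc.
near=> x; apply/(hullP nT); apply: ord4P; apply: ltW; near: x; exact: n.
Unshelve. all: by end_near. Qed.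

(** A common face equal to the whole of one cell would put the interior of that
cell, which is not empty, inside the other. *)
Lemma distinct_cells T T' (A : {set 'I_4}) : Defs.nondegenerate T ->
  interior (hull T) `&` interior (hull T') = set0 ->
  hull T `&` hull T' = hull_on T A -> A != [set: 'I_4]%SET.
Proof.
move=> nT dis TA; apply/eqP => AT; have [c cT] := hull_interior nT.
have TT' : hull T `<=` hull T'.
  by move=> x Tx; have [] : (hull T `&` hull T') x by rewrite TA AT.
have : (interior (hull T) `&` interior (hull T')) c.
  by split => //; exact: (interiorS TT').
by rewrite dis.
Qed.

(** A vertex of a face of one cell is an extreme point of that face, hence a
vertex of any other cell having the same face. *)
Lemma common_face_vertex T1 T2 (A1 A2 : {set 'I_4}) i : Defs.nondegenerate T1 ->
  hull_on T1 A1 = hull_on T2 A2 -> i \in A1 -> exists2 j, j \in A2 & T1 i = T2 j.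
Proof.
move=> nT1 E iA.
have : hull_on T1 A1 (T1 i).
  apply/(hull_onP nT1); split => k; rewrite lam_vertex//.
  by move=> kA; rewrite (negbTE (contraNneq _ kA))// => ->.
rewrite E => -[l [l0 lA l1 xE]].
have [j lj] : exists j, 0 < l j.
  apply: contrapT => /forallNP h; have : \sum_i l i <= 0.
    by apply: sumr_le0 => k _; rewrite leNgt; apply/negP/h.
  by rewrite l1 ler10.
have inA k : 0 < l k -> k \in A2.
  by apply: contraTT => /lA ->; rewrite ltxx.
exists j; first exact: inA.
have face k : k \in A2 -> forall n, 0 <= lam T1 (T2 k) n.
  move=> kA; have : hull_on T2 A2 (T2 k).
    exists (fun n => (n == k)%:R); split => //.
    - by move=> n nA; rewrite (negbTE (contraNneq _ nA))// => ->.
    - by rewrite (bigD1 k)//= eqxx big1 ?addr0// => n /negbTE ->.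
    - rewrite (bigD1 k)//= eqxx scale1r big1 ?addr0// => n /negbTE ->.
      by rewrite scale0r.
  by rewrite -E => /(hull_onP nT1)[].
have j0 n : n != i -> lam T1 (T2 j) n = 0.
  move=> ni; have : \sum_k l k * lam T1 (T2 k) n = 0.
    by rewrite -lam_affine// -xE lam_vertex// (negbTE ni).
  move=> /eqP; rewrite psumr_eq0 => [/allP/(_ j)|k _].
    rewrite mem_index_enum => /(_ isT); rewrite /= mulf_eq0 (gt_eqF lj)/=.
    by move=> /eqP.
  have := l0 k; rewrite le_eqVlt => /orP[/eqP <-|lk]; first by rewrite mul0r.
  by rewrite mulr_ge0// face// inA.
apply: (lam_inj nT1) => n; rewrite lam_vertex//.
have [->|/j0 ->//] := eqVneq n i.
by rewrite -(lam_sum nT1 (T2 j)) (bigD1 i)//= big1 ?addr0.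
Qed.

Lemma common_face_lam T1 T2 (A1 A2 : {set 'I_4}) j :
  Defs.nondegenerate T1 -> Defs.nondegenerate T2 ->
  hull_on T1 A1 = hull_on T2 A2 -> j \in A2 ->
  exists i, [/\ i \in A1, T1 i = T2 j &
    forall y, hull_on T1 A1 y -> lam T1 y i = lam T2 y j].
Proof.
move=> n1 n2 E jA; have [i iA ij] := common_face_vertex n2 (esym E) jA.
exists i; split; rewrite ?ij// => y Ay.
have /(hull_onP n2)[_ y2] : hull_on T2 A2 y by rewrite -E.
rewrite -[in LHS](lam_comb n2 y) lam_affine ?lam_sum//.
rewrite (bigD1 j)//= ij lam_vertex// eqxx mulr1 big1 ?addr0// => k kj.
have [kA|/y2 ->] := boolP (k \in A2); last by rewrite mul0r.
have [i' i'A ki'] := common_face_vertex n2 (esym E) kA.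
rewrite ki' lam_vertex//; have [ii'|_] := eqVneq i i'; last by rewrite mulr0.
by move: kj; rewrite -(inj_eq (vertex_inj n2)) ki' ij ii' eqxx.
Qed.
End CommonFaces.

(** * The lift as a compact graph *)

Section ClosedGraph.

(** A map whose graph is compact is continuous: the preimage of a closed set is
a projection of a compact part of the graph. *)
Lemma compact_graph_continuous (V W : topologicalType) (G : set (V * W))
    (f : V -> W) (K : set V) :
  hausdorff_space V -> compact G ->
  (forall x, K x -> G (x, f x)) -> (forall x y, G (x, y) -> K x /\ y = f x) ->
  {within K, continuous f}.
Proof.
move=> hV cG Kf Gf; apply/continuous_closedP => C cC; apply/closed_subspaceP.
pose B : set V := fst @` (G `&` snd @^-1` C); exists B.
  apply: compact_closed => //; apply: continuous_compact.
    by apply: continuous_subspaceT => p; exact: cvg_fst.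
  apply: compact_closedI => //; apply: closed_comp => // p _; exact: cvg_snd.
apply/seteqP; split => x [+ Kx] => [[[x' y] [/= /Gf[_ yE] Cy] xE]|Cx]; split => //.
  by move: xE Cy; rewrite /= yE => <-.
by exists (x, f x) => //; split => //=; exact: Kf.
Qed.

Lemma closed_zero_in (R : realType) (V : topologicalType) (K : set V) (psi : V -> R) :
  closed K -> (forall x, K x -> {for x, continuous psi}) ->
  closed [set x | K x /\ psi x = 0].
Proof.
move=> cK cpsi x clx; have Kx : K x.
  by apply: cK => O /clx[y [[Ky _] Oy]]; exists y.
split => //; apply: contrapT => /eqP p0.
have : \forall y \near x, psi y != 0.
  have := cpsi x Kx; rewrite /continuous_at => /cvgr_neq0; exact.
by move=> /clx[y [[_ /eqP py] /negP]].
Qed.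

End ClosedGraph.

Section CutHulls.
Context {R : realType}.
Variables (U : set 'rV[R]_3) (F : 'rV[R]_3 -> R) (T : tet R).
Hypothesis hT : cut_tet U F T.
Let nT : Defs.nondegenerate T. Proof. by case: hT. Qed.

Lemma hull_compact : compact (hull T).
Proof.
apply: bounded_closed_compact.
  exists (\sum_i `|T i|); split; first by rewrite num_real.
  by move=> M lM x /hull_norm_le /le_trans; apply; exact: ltW.
have -> : hull T = \bigcap_(i in [set: 'I_4]) [set x | 0 <= lam T x i].
  by apply/seteqP; split => x; [move=> /(hullP nT) x0 i _|move=> x0; apply/(hullP nT) => i];
    exact: x0.
apply: closed_bigI => i _; apply: (@closed_comp _ _ (fun x => lam T x i) [set s | 0 <= s]).
  by move=> x _; exact: lam_continuous.
exact: closed_ge.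
Qed.

Lemma patch_compact : normal_position F T -> compact (linear_patch U F T).
Proof.
move=> /(patch_separating hT)[psi [cpsi _ _ _] ppsi].
have -> : linear_patch U F T = hull T `&` [set x | hull T x /\ psi x = 0].
  by apply/seteqP; split => x; [move=> /ppsi[]|move=> [_ /ppsi]].
apply: compact_closedI; first exact: hull_compact.
apply: closed_zero_in => //; apply: compact_closed; first exact: norm_hausdorff.
exact: hull_compact.
Qed.

Lemma coax_graph_compact : normal_position F T -> compact (zero_set U F) ->
  compact [set p : 'rV[R]_3 * 'rV[R]_3 | [/\ linear_patch U F T p.1, hull T p.2,
    zero_set U F p.2 & coax F T p.1 p.2]].
Proof.
move=> Tn cG.
pose D : set ('rV[R]_3 * 'rV[R]_3) :=
  \bigcap_(k in [set k : 'I_4 * 'I_4 | (0 < F (T k.1)) = (0 < F (T k.2))])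
  [set p | lam T p.1 k.1 * lam T p.2 k.2 - lam T p.1 k.2 * lam T p.2 k.1 = 0].
have -> : [set p : 'rV[R]_3 * 'rV[R]_3 | [/\ linear_patch U F T p.1, hull T p.2,
    zero_set U F p.2 & coax F T p.1 p.2]] =
    (linear_patch U F T `*` (hull T `&` zero_set U F)) `&` D.
  apply/seteqP; split => -[x y] /=.
    move=> [px Ty Gy cxy]; split => // -[i j] /= ij.
    have /coaxP := cxy; move=> /(_ (patch_mixed hT Tn px) (zero_set_mixed hT Ty Gy)).
    by move=> /(_ i j ij) ->; rewrite subrr.
  move=> [[px [Ty Gy]] Dxy]; split => //.
  apply/(coaxP (patch_mixed hT Tn px) (zero_set_mixed hT Ty Gy)) => i j ij.
  by apply/eqP; rewrite -subr_eq0; apply/eqP; exact: (Dxy (i, j)).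
apply: compact_closedI.
  apply: compact_setX; first exact: patch_compact.
  apply: compact_closedI; first exact: hull_compact.
  by apply: compact_closed => //; exact: norm_hausdorff.
apply: closed_bigI => k _.
pose g (p : 'rV[R]_3 * 'rV[R]_3) := lam T p.1 k.1 * lam T p.2 k.2 - lam T p.1 k.2 * lam T p.2 k.1.
apply: (@closed_comp _ _ g [set s | s = 0]); last exact: closed_eq.
have c1 i : continuous (fun p : 'rV[R]_3 * 'rV[R]_3 => lam T p.1 i).
  by move=> p; apply: (@continuous_comp _ _ _ fst (fun x => lam T x i));
    [exact: cvg_fst|exact: lam_continuous].
have c2 i : continuous (fun p : 'rV[R]_3 * 'rV[R]_3 => lam T p.2 i).
  by move=> p; apply: (@continuous_comp _ _ _ snd (fun x => lam T x i));
    [exact: cvg_snd|exact: lam_continuous].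
have cM i j : continuous (fun p : 'rV[R]_3 * 'rV[R]_3 => lam T p.1 i * lam T p.2 j).
  by move=> p; apply: continuousM; [exact: c1|exact: c2].
by move=> p _; exact: (continuousB (cM k.1 k.2 p) (cM k.2 k.1 p)).
Qed.

End CutHulls.

(** A common face of two distinct cells is proper, because the interiors of the
cells are nonempty and disjoint; a point of it lies on the boundary of either
cell. *)
Definition cut_complex {R : realType} (U : set 'rV[R]_3) (F : 'rV[R]_3 -> R)
    (Ts : set (tet R)) :=
  [/\ forall T, Ts T -> cut_tet U F T, forall T, Ts T -> normal_position F T &
    forall T T', Ts T -> Ts T' -> T = T' \/
      exists A A' : {set 'I_4}, [/\ A != [set: 'I_4]%SET,
        hull T `&` hull T' = hull_on T A & hull T `&` hull T' = hull_on T' A']].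

Section LiftRelation.
Context {R : realType}.
Variables (U : set 'rV[R]_3) (F : 'rV[R]_3 -> R) (Ts : set (tet R)).
Hypothesis hTs : cut_complex U F Ts.

Let cutTs T : Ts T -> cut_tet U F T. Proof. by case: hTs => + _ _; exact. Qed.
Let normTs T : Ts T -> normal_position F T. Proof. by case: hTs => _ + _; exact. Qed.
Let confTs T T' : Ts T -> Ts T' -> T = T' \/
  exists A A' : {set 'I_4}, [/\ A != [set: 'I_4]%SET,
    hull T `&` hull T' = hull_on T A & hull T `&` hull T' = hull_on T' A'].
Proof. by case: hTs => _ _; exact. Qed.
Let nTs T : Ts T -> Defs.nondegenerate T. Proof. by move=> /cutTs[]. Qed.

(** Coaxiality is a relation between barycentric coordinates with respect to
the vertices of a common face, so that it does not depend on the cell. *)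
Lemma coax_transfer T T' x y : Ts T -> Ts T' -> hull T x -> hull T' x ->
  coax F T x y -> hull T' y /\ coax F T' x y.
Proof.
move=> hT hT' Tx T'x cxy; have [<-|[A [A' [_ EA EA']]]] := confTs hT hT'.
  by split => //; exact: (coax_hull (cutTs hT) cxy Tx).
have nT := nTs hT; have nT' := nTs hT'.
have Ax : hull_on T A x by rewrite -EA.
have A'x : hull_on T' A' x by rewrite -EA'.
case: cxy => a [b [a0 b0 yE]].
have Ay : hull_on T A y.
  move: Ax => /(hull_onP nT)[x0 xA]; apply/(hull_onP nT); split => i.
    by rewrite yE mulr_ge0//; case: ifP => _; exact: ltW.
  by move=> /xA; rewrite yE => ->; rewrite mulr0.
have A'y : hull_on T' A' y by rewrite -EA' EA.
split; first exact: hull_on_sub A'y.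
exists a, b; split => // j; have [jA|jA] := boolP (j \in A').
  have [i [iA ij lE]] := common_face_lam nT nT' (etrans (esym EA) EA') jA.
  by rewrite -!lE// yE ij.
have [_ zx] := (hull_onP nT' _ _).1 A'x; have [_ zy] := (hull_onP nT' _ _).1 A'y.
by rewrite zx// zy// mulr0.
Qed.

(** On a common face the patch consists of segments between edge points, and these
are determined by the vertices of the face alone. In particular the choice of a
diagonal inside a four-edge patch is invisible from the neighbouring cell. *)
Lemma patch_transfer T T' x : Ts T -> Ts T' -> linear_patch U F T x ->
  hull T' x -> linear_patch U F T' x.
Proof.
move=> hT hT' px T'x; have [<-//|[A [A' [AT EA EA']]]] := confTs hT hT'.
have nT := nTs hT; have [Tx _ _] := patch_mixed (cutTs hT) (normTs hT) px.
have Ax : hull_on T A x by rewrite -EA.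
have [a [b [c [[aA bA cA] ab ac sx]]]] :=
  patch_face_segment (cutTs hT) (normTs hT) AT px Ax.
have E := etrans (esym EA) EA'.
have [a' _ aE] := common_face_vertex nT E aA.
have [b' _ bE] := common_face_vertex nT E bA.
have [c' _ cE] := common_face_vertex nT E cA.
apply: (patch_of_face_segment (a := a') (b := b') (c := c') (normTs hT')).
- by rewrite -aE -bE.
- by rewrite -aE -cE.
- by rewrite /edge_pt -aE -bE -cE.
Qed.

(** The lift is kept as a relation so that it and its inverse are treated alike. *)
Definition lift_rel X Y := exists T, [/\ Ts T, linear_patch U F T X,
  zero_set U F Y & coax F T X Y].

(** Coaxiality carries the second point into the cell of the first, and the patch
of a cell is the one seen from its neighbours. *)
Lemma lift_rel_local X Y T : lift_rel X Y -> Ts T -> hull T X \/ hull T Y ->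
  [/\ linear_patch U F T X, hull T X, hull T Y, mixed F T X & coax F T X Y].
Proof.
move=> [T' [hT' pX GY cXY]] hT TXY; have mX' := patch_mixed (cutTs hT') (normTs hT') pX.
have [T'X _ _] := mX'; have T'Y := coax_hull (cutTs hT') cXY T'X.
have TX : hull T X.
  case: TXY => // TY; have := coax_transfer hT' hT T'Y TY (coax_sym cXY).
  by case.
have [TY cT] := coax_transfer hT' hT T'X TX cXY.
have pT := patch_transfer hT' hT pX TX.
by split => //; exact: (patch_mixed (cutTs hT) (normTs hT) pT).
Qed.

(** Two images lie on the join through [X] in one cell, where [F] has a single
zero. *)
Lemma lift_rel_fun X Y Y' : lift_rel X Y -> lift_rel X Y' -> Y = Y'.
Proof.
move=> XY XY'; have [T [hT pX GY cXY]] := XY.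
have mX := patch_mixed (cutTs hT) (normTs hT) pX; have [TX _ _] := mX.
have [_ _ TY' _ cXY'] := lift_rel_local XY' hT (or_introl TX).
have [_ [_ _ GY' _]] := XY'.
have sF : separating F T F by case: (cutTs hT).
apply: (coax_zero_uniq (cutTs hT) sF mX cXY cXY').
  by apply/(zero_setP (cutTs hT)) => //; exact: (coax_hull (cutTs hT) cXY).
exact/(zero_setP (cutTs hT)).
Qed.

(** Two preimages lie on the join through [Y] in one cell, where the function
separating along the patch has a single zero. *)
Lemma lift_rel_inj X X' Y : lift_rel X Y -> lift_rel X' Y -> X = X'.
Proof.
move=> XY XY'; have [T [hT pX GY cXY]] := XY.
have mX := patch_mixed (cutTs hT) (normTs hT) pX; have [TX _ _] := mX.
have TY := coax_hull (cutTs hT) cXY TX.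
have [pX' _ _ _ cXY'] := lift_rel_local XY' hT (or_intror TY).
have [psi spsi ppsi] := patch_separating (cutTs hT) (normTs hT).
have mY := coax_mixed (cutTs hT) mX cXY.
apply: (coax_zero_uniq (cutTs hT) spsi mY (coax_sym cXY) (coax_sym cXY')).
  by have /ppsi[] := pX.
by have /ppsi[] := pX'.
Qed.

Lemma lift_rel_Phi T X : Ts T -> linear_patch U F T X -> lift_rel X (Phi_loc U F T X).
Proof.
move=> hT pX; have mX := patch_mixed (cutTs hT) (normTs hT) pX.
by have [GY _ cXY] := Phi_locP (cutTs hT) (normTs hT) mX; exists T.
Qed.

Lemma lift_rel_surj T Y : Ts T -> zero_set U F Y -> hull T Y -> exists X, lift_rel X Y.
Proof.
move=> hT GY TY; have mY := zero_set_mixed (cutTs hT) TY GY.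
have [psi spsi ppsi] := patch_separating (cutTs hT) (normTs hT).
have [X [TX cYX pX]] := coax_zero_exists (cutTs hT) spsi mY.
by exists X, T; split => //; [exact/ppsi|exact: coax_sym].
Qed.

Lemma lift_graph_compact : finite_set Ts -> compact (zero_set U F) ->
  compact [set p | lift_rel p.1 p.2].
Proof.
move=> /finite_seqP[s sE] cG.
have -> : [set p : 'rV[R]_3 * 'rV[R]_3 | lift_rel p.1 p.2] = \big[setU/set0]_(T <- s | T \in s)
    [set p | [/\ linear_patch U F T p.1, hull T p.2, zero_set U F p.2 & coax F T p.1 p.2]].
  rewrite -bigcup_seq_cond; apply/seteqP; split => -[X Y].
    move=> [T [hT pX GY cXY]]; exists T; first by move: hT; rewrite sE /= => ->.
    split => //; apply: (coax_hull (cutTs hT) cXY).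
    by have [] := patch_mixed (cutTs hT) (normTs hT) pX.
  by move=> [T /andP[Ts1 _] [pX TY GY cXY]]; exists T; split => //; rewrite sE.
apply: bigsetU_compact => T sT; have hT : Ts T by rewrite sE.
exact: (coax_graph_compact (cutTs hT) (normTs hT) cG).
Qed.

End LiftRelation.

(** * Lipschitz regularity of lifted functions *)

Section LocallyLipschitzAlgebra.
Context {R : realType} {V : normedModType R}.
Implicit Types f g : V -> R.

Lemma loc_lip_cst (c : R) (t : V) : loc_lip (fun=> c) t.
Proof. by exists 1, 0; split => // *; rewrite subrr normr0 mul0r. Qed.

Lemma loc_lip_mul f g t : loc_lip f t -> loc_lip g t -> loc_lip (fun x => f x * g x) t.
Proof. exact: loc_lipM. Qed.

Lemma loc_lipD f g t : loc_lip f t -> loc_lip g t -> loc_lip (fun x => f x + g x) t.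
Proof.
move=> [e1 [L1 [e10 H1]]] [e2 [L2 [e20 H2]]].
exists (Num.min e1 e2), (L1 + L2); split; first by rewrite lt_min e10.
move=> s s'; rewrite !lt_min => /andP[s1 s2] /andP[s'1 s'2].
rewrite opprD addrACA mulrDl (le_trans (ler_normD _ _))// lerD//.
- exact: H1.
- exact: H2.
Qed.

Lemma loc_lip_sum (I : Type) (r : seq I) (P : pred I) (f : I -> V -> R) t :
  (forall i, loc_lip (f i) t) -> loc_lip (fun x => \sum_(i <- r | P i) f i x) t.
Proof.
move=> fl; elim: r => [|i r IH].
  by under eq_fun do rewrite big_nil; exact: loc_lip_cst.
under eq_fun do rewrite big_cons.
by case: (P i) => //; exact: loc_lipD.
Qed.

Lemma loc_lip_exp f n t : loc_lip f t -> loc_lip (fun x => f x ^+ n) t.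
Proof.
move=> fl; elim: n => [|n IH]; first by under eq_fun do rewrite expr0; exact: loc_lip_cst.
by under eq_fun do rewrite exprS; exact: loc_lip_mul.
Qed.

Lemma loc_lip_inv f t : loc_lip f t -> 0 < f t -> loc_lip (fun x => (f x)^-1) t.
Proof.
move=> fl f0; have /cvgrPdist_lt := loc_lip_cvg fl.
move=> /(_ (f t / 2)); rewrite divr_gt0// => /(_ isT)/near_ball[e1 e10 fe1].
have [e2 [L [e20 H]]] := fl.
exists (Num.min e1 e2), (`|L| * (4 / f t ^+ 2)); split; first by rewrite lt_min e10.
have low x : `|x - t| < e1 -> f t / 2 < f x.
  by move=> /fe1; rewrite ltr_norml => /andP[_]; lra.
move=> s s'; rewrite !lt_min => /andP[/low s1 s2] /andP[/low s'1 s'2].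
have h0 : 0 < f t / 2 by rewrite divr_gt0.
have fs := lt_trans h0 s1; have fs' := lt_trans h0 s'1.
have -> : (f s)^-1 - (f s')^-1 = (f s' - f s) * (f s * f s')^-1.
  by field; rewrite !gt_eqF.
have N : `|(f s * f s')^-1| = (f s * f s')^-1.
  by rewrite gtr0_norm// invr_gt0 mulr_gt0.
rewrite normrM N (mulrAC `|L|) ler_pM// ?invr_ge0 ?mulr_ge0 ?(ltW fs) ?(ltW fs')//.
  by rewrite (distrC (f s')) (le_trans (H _ _ s2 s'2))// ler_wpM2r// ler_norm.
have -> : 4 / f t ^+ 2 = (f t / 2 * (f t / 2))^-1 by field; rewrite gt_eqF.
by rewrite lef_pV2 ?posrE ?mulr_gt0// ler_pM// ltW.
Qed.
End LocallyLipschitzAlgebra.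

Section Charts.
Context {R : realType}.

Lemma norm_lincomb2 (W : normedModType R) (a b c A B : R) (x y : W) :
  `|a| <= c -> `|b| <= c -> `|x| <= A -> `|y| <= B -> `|a *: x + b *: y| <= (A + B) * c.
Proof.
move=> ac bc xA yB; rewrite (le_trans (ler_normD _ _))// !normrZ mulrDl.
by rewrite lerD// mulrC ler_pM.
Qed.

(** The derivatives of each coordinate are bounded near [p] by those of the chart
along the two axes. *)
Lemma C1_chart_lip (V : set (R * R)) (chi : R * R -> 'rV[R]_3) p :
  open V -> Ck 1 V chi -> V p -> exists e L : R, [/\ 0 < e, 0 <= L &
    forall s s', `|s - p| < e -> `|s' - p| < e -> `|chi s - chi s'| <= L * `|s - s'|].
Proof.
move=> oV [dchi cchi] Vp.
pose B (v : R * R) := `|'D_v chi p| + 1.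
have bnd v : \forall q \near p, `|'D_v chi q| <= B v by exact: near_cont_bound (cchi v p Vp).
have [e1 e10 E1] := near_ball (bnd (1, 0)).
have [e2 e20 E2] := near_ball (bnd (0, 1)).
have [e3 e30 E3] : exists2 r : R, 0 < r & forall z, `|z - p| < r -> V z.
  by apply: near_ball; exact: open_nbhs_nbhs.
pose e := Num.min (Num.min e1 e2) e3.
have e0 : 0 < e by rewrite !lt_min e10 e20 e30.
pose L := B (1, 0) + B (0, 1).
exists e, L; split => //; first by rewrite !addr_ge0.
move=> s s' sp s'p; have L0 : 0 <= L * `|s - s'| by rewrite mulr_ge0// !addr_ge0.
rewrite [leLHS]mx_normrE; apply: bigmax_le => // -[i j] _ /=; rewrite (ord1 i) !mxE.
pose g q := chi q 0 j.
have dg z : `|z - p| < e -> differentiable g z /\ forall v, 'D_v g z = ('D_v chi z) 0 j.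
  rewrite !lt_min => /andP[_ /E3 Vz]; have dz := dchi z Vz.
  have dc : differentiable (fun M : 'rV[R]_3 => M 0 j) (chi z) by exact: differentiable_coord.
  have dgz : differentiable g z by exact: (differentiable_comp dz dc).
  split => // v; rewrite derive_mx ?mxE//; exact: diff_derivable.
apply: (@deriv_bound_lip _ _ g p e L) => //.
  by move=> z /dg[].
move=> z v ze; have [dgz ->] := dg z ze.
move: (ze); rewrite !lt_min => /andP[/andP[/E1 z1 /E2 z2] /E3 Vz].
rewrite (le_trans (row_entry_le _ _))//.
have -> : 'D_v chi z = v.1 *: 'D_((1, 0) : R * R) chi z + v.2 *: 'D_((0, 1) : R * R) chi z.
  have dz := dchi z Vz; rewrite !deriveE// -!linearZ -linearD; congr ('d chi z _).
  by rewrite [v in LHS]surjective_pairing; congr pair; rewrite /= ?[_ *: 1]mulr1 ?scaler0 ?addr0 ?add0r.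
have v1 : `|v.1| <= `|v| by rewrite prod_normE le_max lexx.
have v2 : `|v.2| <= `|v| by rewrite prod_normE le_max lexx orbT.
exact: norm_lincomb2 v1 v2 z1 z2.
Qed.

(** A function that is Lipschitz near [Y0] on each member of a finite closed
cover is so along each curve in the union: the cover need not be locally
convex, which is why the estimate compares [Y'] only with a fixed nearby [Y]. *)
Definition piecewise_lip (C : set 'rV[R]_3) (f : 'rV[R]_3 -> R) (Y0 : 'rV[R]_3) :=
  exists e L : R, [/\ 0 < e, 0 <= L & forall Y, `|Y - Y0| < e ->
    \forall Y' \near Y, C Y' -> `|f Y' - f Y| <= L * `|Y' - Y| /\ C Y].

Lemma piecewise_lip_closed (C : set 'rV[R]_3) f g Y0 : closed C ->
  (forall Y, C Y -> f Y = g Y) -> (C Y0 -> loc_lip g Y0) -> piecewise_lip C f Y0.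
Proof.
move=> cC fg gl; have [CY|nCY] := pselect (C Y0); last first.
  have [e e0 eC] : exists2 e : R, 0 < e & forall z, `|z - Y0| < e -> (~` C) z.
    by apply: near_ball; apply: open_nbhs_nbhs; split => //; rewrite openC.
  exists e, 0; split => // Y Ye.
  have : \forall Y' \near Y, (~` C) Y'.
    by apply: open_nbhs_nbhs; split; [rewrite openC|exact: eC].
  by apply: filterS => Y' nC /nC.
have [e [L [e0 gL]]] := gl CY; exists e, `|L|; split => // Y Ye.
have nearC : \forall Y' \near Y, C Y' -> C Y.
  have [CY'|nCY'] := pselect (C Y); first by apply/nbhs_ballP; exists 1 => //=.
  have : \forall Y' \near Y, (~` C) Y' by apply: open_nbhs_nbhs; split => //; rewrite openC.
  by apply: filterS => Y' nC /nC.
have nearB : \forall Y' \near Y, `|Y' - Y0| < e.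
  have : \forall Y' \near Y, ball Y (e - `|Y - Y0|) Y' by apply: nbhsx_ballx; rewrite subr_gt0.
  apply: filterS => Y'; rewrite -ball_normE /ball_/= => h.
  rewrite -(subrK Y Y') -addrA (le_lt_trans (ler_normD _ _))//.
  by rewrite -ltrBrDr distrC.
apply: filterS2 nearC nearB => Y' h1 h2 CY'; have CYY := h1 CY'; split => //.
by rewrite !fg// (le_trans (gL _ _ h2 Ye))// ler_wpM2r// ler_norm.
Qed.

Lemma piecewise_lip_bigcup (I : eqType) (s : seq I) (C : I -> set 'rV[R]_3) f Y0 :
  (forall i, i \in s -> piecewise_lip (C i) f Y0) ->
  piecewise_lip (\bigcup_(i in [set` s]) C i) f Y0.
Proof.
elim: s => [|i s IH] Cs.
  by exists 1, 0; split => // Y _; apply/nbhs_ballP; exists 1 => //= Y' _ [j].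
have [|e2 [L2 [e20 L20 H2]]] := IH; first by move=> j js; apply: Cs; rewrite inE js orbT.
have [e1 [L1 [e10 L10 H1]]] := Cs i (mem_head _ _).
exists (Num.min e1 e2), (Num.max L1 L2); split; first by rewrite lt_min e10.
  by rewrite le_max L10.
move=> Y; rewrite lt_min => /andP[/H1 h1 /H2 h2].
apply: filterS2 h1 h2 => Y' h1 h2 -[j /=]; rewrite inE => /orP[/eqP ->|js] CY'.
  have [h CY] := h1 CY'; split; last by exists i => //=; rewrite mem_head.
  by rewrite (le_trans h)// ler_wpM2r// le_max lexx.
have [|h [k /= ks CY]] := h2; first by exists j.
split; last by exists k => //=; rewrite inE ks orbT.
by rewrite (le_trans h)// ler_wpM2r// le_max lexx orbT.
Qed.

Lemma piecewise_lip_chart (C : set 'rV[R]_3) f (V : set (R * R)) chi p :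
  open V -> Ck 1 V chi -> (forall q, V q -> C (chi q)) -> V p ->
  piecewise_lip C f (chi p) -> loc_lip (f \o chi) p.
Proof.
move=> oV cV VC Vp [e [L [e0 L0 HL]]].
have [d [M [d0 M0 HM]]] := C1_chart_lip oV cV Vp.
have [d' d'0 d'V] : exists2 r : R, 0 < r & forall z, `|z - p| < r -> V z.
  by apply: near_ball; exact: open_nbhs_nbhs.
pose r := Num.min (Num.min d d') (e / (M + 1)).
have M1 : 0 < M + 1 by rewrite ltr_wpDl.
have r0 : 0 < r by rewrite !lt_min d0 d'0 divr_gt0.
have inr z : `|z - p| < r -> [/\ `|z - p| < d, V z & `|chi z - chi p| < e].
  rewrite !lt_min => /andP[/andP[zd /d'V Vz] ze]; split => //.
  rewrite (le_lt_trans (HM _ _ zd _)) ?subrr ?normr0//.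
  apply: le_lt_trans (_ : _ <= (M + 1) * `|z - p|) _; first by rewrite ler_wpM2r// lerDl.
  by rewrite mulrC -ltr_pdivlMr.
exists r, (L * M); split => // s s' sr s'r.
pose z (t : R) := s' + t *: (s - s').
have zr t : 0 <= t <= 1 -> `|z t - p| < r.
  by move=> t01; apply: segment_ball => //; rewrite (addrC s') subrK.
have zd (t u : R) : z t - z u = (t - u) *: (s - s').
  by rewrite /z opprD addrACA subrr add0r -scalerBl.
have z0 : z 0 = s' by rewrite /z scale0r addr0.
have z1 : z 1 = s by rewrite /z scale1r addrC subrK.
have := @pointwise_lip_increment _ (fun t => f (chi (z t))) 0 1 (L * M * `|s - s'|) ler01.
rewrite z0 z1 subr0 mulr1; apply => t t01; have [td Vt te] := inr _ (zr t t01).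
have [b b0 Hb] := near_ball (HL _ te).
have K0 : 0 < M * `|s - s'| + 1 by rewrite ltr_wpDl// mulr_ge0.
exists (b / (M * `|s - s'| + 1)); first by rewrite divr_gt0.
move=> u u01 ut; have [ud Vu ue] := inr _ (zr u u01).
have cu : `|chi (z u) - chi (z t)| <= M * `|s - s'| * `|u - t|.
  by rewrite (le_trans (HM _ _ ud td))// zd normrZ mulrCA [leLHS]mulrC.
have [|h _] := Hb (chi (z u)) _ (VC _ Vu).
  rewrite (le_lt_trans cu)//.
  apply: le_lt_trans (_ : _ <= (M * `|s - s'| + 1) * `|u - t|) _.
    by rewrite ler_wpM2r// lerDl.
  by rewrite mulrC -ltr_pdivlMr.
by rewrite (le_trans h)// -!mulrA ler_wpM2l// mulrA.
Qed.
End Charts.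

Lemma wsum_gt0 (R : realFieldType) (I : finType) (P : pred I) (w l : I -> R) :
  (forall i, P i -> 0 < w i) -> (forall i, 0 <= l i) -> 0 < \sum_(i | P i) l i ->
  0 < \sum_(i | P i) w i * l i.
Proof.
move=> w0 l0; apply: contraTT; rewrite -!leNgt => wl; apply: sumr_le0 => i Pi.
move: wl; rewrite (bigD1 i)//= => /(le_trans _) wl.
have : w i * l i <= 0.
  by apply: wl; rewrite lerDl sumr_ge0// => j /andP[Pj _]; rewrite mulr_ge0// ltW// w0.
by rewrite pmulr_rle0// w0.
Qed.

Lemma triangle_closed (R : realType) (a b c : 'rV[R]_3) : closed (triangle a b c).
Proof.
apply: compact_closed; first exact: norm_hausdorff.
pose p := fun i : 'I_3 => nth 0 [:: a; b; c] i.
pose S := [set l : 'rV[R]_3 | (forall i, 0 <= l 0 i) /\ \sum_i l 0 i = 1].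
have -> : triangle a b c = (fun l : 'rV[R]_3 => \sum_i l 0 i *: p i) @` S.
  apply/seteqP; split => x.
    move=> [l [l0 _ l1 xE]]; exists (\row_i l i).
      by split=> [i|]; [rewrite mxE|under eq_bigr do rewrite mxE].
    by rewrite xE; apply: eq_bigr => i _; rewrite mxE.
  by move=> [l [l0 l1] <-]; exists (fun i => l 0 i); split => // i; rewrite inE.
have cS i : continuous (fun l : 'rV[R]_3 => l 0 i) by exact: coord_continuous.
apply: continuous_compact.
  apply: continuous_subspaceT; apply: sum_continuous => i l.
  by apply: continuousZr_tmp; exact: cS.
apply: bounded_closed_compact.
  exists 1; split; first by rewrite num_real.
  move=> M M1 l [l0 l1]; rewrite /= [leLHS]mx_normrE; apply: bigmax_le.
    by rewrite ltW// (lt_trans _ M1).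
  move=> -[i j] _ /=; rewrite (ord1 i) ger0_norm// (le_trans _ (ltW M1))// -l1.
  by rewrite (bigD1 j)//= lerDl sumr_ge0.
have -> : S = (\bigcap_(i in [set: 'I_3]) [set l : 'rV[R]_3 | 0 <= l 0 i]) `&`
    [set l : 'rV[R]_3 | \sum_i l 0 i = 1].
  by apply/seteqP; split => l [l0 l1]; split => // i; first [exact: (l0 i I)|move=> _; exact: l0].
apply: closedI.
  apply: closed_bigI => i _.
  apply: (@closed_comp _ _ (fun l : 'rV[R]_3 => l 0 i) [set s | 0 <= s]).
    by move=> x _; exact: cS.
  exact: closed_ge.
apply: (@closed_comp _ _ (fun l : 'rV[R]_3 => \sum_i l 0 i) [set s | s = 1]).
  by move=> x _; exact: sum_continuous.
exact: closed_eq.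
Qed.

Section FootPoints.
Context {R : realType}.
Variables (U : set 'rV[R]_3) (F : 'rV[R]_3 -> R) (T : tet R).
Hypothesis hT : cut_tet U F T.
Let nT : Defs.nondegenerate T. Proof. by case: hT. Qed.
Variable c : 'I_4 -> R.
Hypothesis cF : forall i, 0 < c i * F (T i).

Definition pos_weight Y := \sum_(i | 0 < F (T i)) c i * lam T Y i.
Definition neg_weight Y := \sum_(i | ~~ (0 < F (T i))) - c i * lam T Y i.
Definition foot_den Y := neg_weight Y * psum F T Y + pos_weight Y * nsum F T Y.
(** The coordinates of the point of the plane coaxial with [Y]. *)
Definition foot Y j := \sum_i (if 0 < F (T i) then neg_weight Y else pos_weight Y)
  * (foot_den Y)^-1 * lam T Y i * T i 0 j.

Lemma foot_den_gt0 Y : mixed F T Y -> 0 < foot_den Y.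
Proof.
move=> [/(hullP nT) Y0 p0 n0]; rewrite addr_gt0// mulr_gt0//.
- apply: wsum_gt0 => // i; rewrite -leNgt => Fi; have := cF i.
  have [F0|F0] := eqVneq (F (T i)) 0; first by rewrite F0 mulr0 ltxx.
  by rewrite nmulr_lgt0 ?oppr_gt0// lt_neqAle F0.
- by apply: wsum_gt0 => // i Fi; have := cF i; rewrite pmulr_lgt0.
Qed.

(** On the two ends of a join the plane [lincomb T c = 0] has opposite weights;
the foot of [Y] on the plane is therefore a rational function of [Y]. *)
Lemma footE X Y j : mixed F T Y -> coax F T Y X -> lincomb T c X = 0 -> X 0 j = foot Y j.
Proof.
move=> mY [a [b [a0 b0 XE]]] cX; have D0 := foot_den_gt0 mY.
have splitE (f : 'I_4 -> R) : \sum_i f i * lam T X i =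
    a * \sum_(i | 0 < F (T i)) f i * lam T Y i + b * \sum_(i | ~~ (0 < F (T i))) f i * lam T Y i.
  rewrite (bigID (fun i => 0 < F (T i)))/= !mulr_sumr; congr (_ + _);
    apply: eq_bigr => i Pi; rewrite XE ?Pi ?(negbTE Pi); ring.
have E1 : a * psum F T Y + b * nsum F T Y = 1.
  rewrite -(lam_sum nT X); under [RHS]eq_bigr do rewrite -[lam T X _]mul1r.
  by rewrite splitE; congr (_ * _ + _ * _); apply: eq_bigr => i _; rewrite mul1r.
have E2 : a * pos_weight Y = b * neg_weight Y.
  move: cX; rewrite /lincomb splitE => /eqP; rewrite addr_eq0 => /eqP ->.
  by rewrite -mulrN -sumrN; congr (_ * _); apply: eq_bigr => i _; rewrite mulNr.
have aE : a = neg_weight Y * (foot_den Y)^-1.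
  apply: (mulIf (lt0r_neq0 D0)); rewrite divfK ?lt0r_neq0// /foot_den mulrDr.
  rewrite [X in _ + X]mulrA E2 -[RHS]mulr1 -E1; ring.
have bE : b = pos_weight Y * (foot_den Y)^-1.
  apply: (mulIf (lt0r_neq0 D0)); rewrite divfK ?lt0r_neq0// /foot_den mulrDr.
  rewrite [X in X + _]mulrA -E2 -[RHS]mulr1 -E1; ring.
rewrite -[X in LHS](lam_comb nT) summxE; apply: eq_bigr => i _.
by rewrite mxE XE; case: ifP => _; rewrite -?aE -?bE.
Qed.

Lemma lam_loc_lip i Y : loc_lip (fun Y => lam T Y i) Y.
Proof. by have [L L0 HL] := lam_lip T i; exists 1, L; split => // *; exact: HL. Qed.

Lemma foot_loc_lip Y j : mixed F T Y -> loc_lip (foot^~ j) Y.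
Proof.
move=> mY; have D0 := foot_den_gt0 mY.
have lp : loc_lip pos_weight Y.
  by apply: loc_lip_sum => i; apply: loc_lip_mul; [exact: loc_lip_cst|exact: lam_loc_lip].
have ln : loc_lip neg_weight Y.
  by apply: loc_lip_sum => i; apply: loc_lip_mul; [exact: loc_lip_cst|exact: lam_loc_lip].
have ld : loc_lip foot_den Y.
  by apply: loc_lipD; apply: loc_lip_mul => //; apply: loc_lip_sum => i; exact: lam_loc_lip.
apply: loc_lip_sum => i; apply: loc_lip_mul; last exact: loc_lip_cst.
apply: loc_lip_mul; last exact: lam_loc_lip.
by apply: loc_lip_mul; [case: (0 < F (T i))|exact: loc_lip_inv].
Qed.

(** Pulled back to the surface, a polynomial on a patch triangle is a rational
function with nonvanishing denominator. *)
Lemma poly_on_foot r K (phi : 'rV[R]_3 -> R) : poly_on r K phi ->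
  (forall X, K X -> lincomb T c X = 0) ->
  exists g, (forall Y, mixed F T Y -> loc_lip g Y) /\
    forall X Y, mixed F T Y -> coax F T Y X -> K X -> phi X = g Y.
Proof.
move=> [d dE] Kc.
exists (fun Y => \sum_(i < r.+1) \sum_(j < r.+1) \sum_(k < r.+1 | (i + j + k <= r)%N)
  d i j k * foot Y 0 ^+ i * foot Y 1 ^+ j * foot Y 2 ^+ k); split.
  move=> Y mY; apply: loc_lip_sum => i; apply: loc_lip_sum => j; apply: loc_lip_sum => k.
  apply: loc_lip_mul; last by apply: loc_lip_exp; exact: foot_loc_lip.
  apply: loc_lip_mul; last by apply: loc_lip_exp; exact: foot_loc_lip.
  apply: loc_lip_mul; last by apply: loc_lip_exp; exact: foot_loc_lip.
  exact: loc_lip_cst.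
move=> X Y mY cYX KX; rewrite dE//; do 3 (apply: eq_bigr => ? _).
by rewrite !(footE _ mY cYX (Kc _ KX)).
Qed.
End FootPoints.

Section LiftRegularity.
Context {R : realType}.
Variables (U : set 'rV[R]_3) (F : 'rV[R]_3 -> R) (Ts : set (tet R)).
Hypothesis hTs : cut_complex U F Ts.
Let cutTs T : Ts T -> cut_tet U F T. Proof. by case: hTs => + _ _; exact. Qed.
Hypothesis finTs : finite_set Ts.
Let Gam := zero_set U F.
Hypothesis cGam : compact Gam.
Variable Psi : 'rV[R]_3 -> 'rV[R]_3.
Hypothesis cPsi : {within Gam, continuous Psi}.
Hypothesis liftPsi : forall Y, Gam Y -> lift_rel U F Ts (Psi Y) Y.
Hypothesis coverTs : forall Y, Gam Y -> exists2 T, Ts T & hull T Y.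

Let piece (T : tet R) (K : set 'rV[R]_3) := hull T `&` [set Y | Gam Y /\ K (Psi Y)].

Let piece_closed T K : Ts T -> closed K -> closed (piece T K).
Proof.
move=> hT cK; apply: closedI.
  by apply: compact_closed; [exact: norm_hausdorff|exact: (hull_compact (cutTs hT))].
have [B cB BE] := (closed_subspaceP _ _).1 ((continuous_closedP _).1 cPsi K cK).
have -> : [set Y | Gam Y /\ K (Psi Y)] = B `&` Gam.
  by rewrite BE; apply/seteqP; split => Y [].
by apply: closedI => //; apply: compact_closed => //; exact: norm_hausdorff.
Qed.

Let patch_triangles_finite T : finite_set (patch_triangles U F T).
Proof.
rewrite /patch_triangles; case: ifP => _; first exact: finite_set1.
by case: ifP => _; [exact: finite_set2|exact: finite_set0].
Qed.

Let patch_triangle_closed T K : patch_triangles U F T K -> closed K.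
Proof.
rewrite /patch_triangles; case: ifP => _; first by move=> ->; exact: triangle_closed.
by case: ifP => _ // -[] ->; exact: triangle_closed.
Qed.

(** The pieces are the parts of the surface that lie over one triangle of one
cell; they are closed because the inverse lift is continuous. *)
Lemma lifted_piecewise_lip r (f phi : 'rV[R]_3 -> R) Y0 :
  (forall T K, Ts T -> patch_triangles U F T K -> poly_on r K phi) ->
  (forall Y, Gam Y -> f Y = phi (Psi Y)) -> piecewise_lip Gam f Y0.
Proof.
move=> phiP fE.
have [s sE] := (finite_seqP _).1 finTs.
have -> : Gam = \bigcup_(T in [set` s]) \bigcup_(K in patch_triangles U F T) piece T K.
  apply/seteqP; split => Y.
    move=> GY; have [T hT TY] := coverTs GY.
    have [[K KT KX] _ _ _ _] :=
      lift_rel_local hTs (liftPsi GY) hT (or_intror TY).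
    by exists T; [rewrite -sE|exists K].
  by move=> [T _ [K _ [_ []]]].
apply: piecewise_lip_bigcup => T sT; have hT : Ts T by rewrite sE.
have [t tE] := (finite_seqP _).1 (patch_triangles_finite T).
rewrite tE; apply: piecewise_lip_bigcup => K tK.
have KT : patch_triangles U F T K by rewrite tE.
have [c cF cK] := patch_triangle_plane (cutTs hT) KT.
have [g [gl gE]] := poly_on_foot (cutTs hT) cF (phiP T K hT KT) (fun X KX => (cK X KX).2).
apply: (@piecewise_lip_closed _ _ _ g).
- exact: (piece_closed hT (patch_triangle_closed KT)).
- move=> Y [TY [GY KY]]; rewrite fE//.
  have [_ _ _ mX cXY] := lift_rel_local hTs (liftPsi GY) hT (or_intror TY).
  apply: gE => //; last exact: coax_sym.
  exact: (zero_set_mixed (cutTs hT)).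
- by move=> [TY [GY _]]; apply: gl; exact: (zero_set_mixed (cutTs hT)).
Qed.

Lemma lifted_H1 r (f phi : 'rV[R]_3 -> R) :
  (forall T K, Ts T -> patch_triangles U F T K -> poly_on r K phi) ->
  (forall Y, Gam Y -> f Y = phi (Psi Y)) -> H1 Gam f.
Proof.
move=> phiP fE V chi [oV cV _ _ Vim]; apply: loc_lip_H1loc => // p Vp.
apply: (piecewise_lip_chart (C := Gam) oV cV _ Vp); last exact: (lifted_piecewise_lip _ phiP fE).
move=> q Vq; have [W _ VW] := Vim V oV (fun x => id).
by have [] : (Gam `&` W) (chi q) by rewrite -VW; exists q.
Qed.
End LiftRegularity.

(** * From cells to surfaces *)

Lemma face_relabel (R : realType) (T : tet R) s (A : {set 'I_4}) :
  Defs.nondegenerate T -> A != [set: 'I_4]%SET ->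
  exists2 B : {set 'I_4}, B != [set: 'I_4]%SET & hull_on T A = hull_on (relabel T s) B.
Proof.
move=> nT AT; exists [set i | s i \in A]%SET.
  apply: contraNneq AT => /setP BT; apply/eqP/setP => i; rewrite -(permKV s i).
  by have := BT ((s^-1)%g i); rewrite !inE.
rewrite hull_on_relabel// (imset_perm_pred s (mem A)).
by have -> // : [set i | mem A i]%SET = A by apply/setP => i; rewrite inE.
Qed.

Section LiftHomeomorphism.
Context {R : realType}.
Variables (U : set 'rV[R]_3) (F : 'rV[R]_3 -> R) (Ts : set (tet R)).
Hypothesis hTs : cut_complex U F Ts.
Hypothesis finTs : finite_set Ts.
Let Gam := zero_set U F.
Hypothesis cGam : compact Gam.
Hypothesis coverTs : forall Y, Gam Y -> exists2 T, Ts T & hull T Y.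
Let Gam_h := \bigcup_(T in Ts) linear_patch U F T.

(** The relation and its converse are functional with compact graph. *)
Lemma lift_homeomorphism : exists Phi Psi : 'rV[R]_3 -> 'rV[R]_3,
  [/\ forall X, Gam_h X -> lift_rel U F Ts X (Phi X),
      forall Y, Gam Y -> lift_rel U F Ts (Psi Y) Y,
      {within Gam_h, continuous Phi} & {within Gam, continuous Psi}].
Proof.
pose Phi X := xget 0 (lift_rel U F Ts X); exists Phi.
pose Psi Y := xget 0 (lift_rel U F Ts ^~ Y); exists Psi.
have PhiP X : Gam_h X -> lift_rel U F Ts X (Phi X).
  by move=> [T hT pX]; apply: xgetI (lift_rel_Phi hTs hT pX).
have PsiP Y : Gam Y -> lift_rel U F Ts (Psi Y) Y.
  move=> GY; have [T hT TY] := coverTs GY.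
  by have [X XY] := lift_rel_surj hTs hT GY TY; exact: (@xgetI _ _ (fun X => lift_rel U F Ts X Y) X XY).
have cG := lift_graph_compact hTs finTs cGam.
split => //.
  apply: (compact_graph_continuous (@norm_hausdorff _ _) cG) => // X Y /= XY.
  have GX : Gam_h X by have [T [hT pX _ _]] := XY; exists T.
  by split => //; exact: (lift_rel_fun hTs XY (PhiP X GX)).
pose G := (fun p : 'rV[R]_3 * 'rV[R]_3 => (p.2, p.1)) @` [set p | lift_rel U F Ts p.1 p.2].
apply: (compact_graph_continuous (G := G)).
- exact: norm_hausdorff.
- apply: continuous_compact => //; apply: continuous_subspaceT => p.
  exact: (cvg_pair (@cvg_snd _ _ _ _ _) (@cvg_fst _ _ _ _ _)).
- by move=> Y GY; exists (Psi Y, Y) => //; exact: PsiP.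
- move=> _ _ [[X Y] /= XY [<- <-]]; have GY : Gam Y by case: XY => T [].
  by split => //; exact: (lift_rel_inj hTs XY (PsiP Y GY)).
Qed.
End LiftHomeomorphism.

Theorem theorem3p3 (R : realType) (m : nat) (U : set 'rV[R]_3)
    (F : 'rV[R]_3 -> R) (J : Type) (Th : J -> seq (tet R))
    (hm : (1 <= m)%N)
    (hU : polyhedral_domain U)
    (hF : Ck m.+2 U F)
    (hGam : closed_regular_surface U F)
    (hTh : forall j, tetrahedral_mesh U (Th j))
    (hadm : admissible_family U F Th) :
  exists2 h0 : R, 0 < h0 &
  forall (j : J) (lab : tet R -> {perm 'I_4}),
    mesh_size (Th j) < h0 ->
    normal_labeling U F (Th j) lab ->
    conforming_complex (active U F (Th j)) ->
    zero_set U F `<=` \bigcup_(T in active U F (Th j)) hull T ->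
    let Gam := zero_set U F in
    let act := active U F (Th j) in
    let Gam_h := Gamma_h U F (Th j) lab in
    let Phi := PhiT U F lab in
    [/\ forall T, act T -> well_posed_cut U F (normalized lab T),
        forall T X, act T -> (Gam_h `&` hull T) X -> (Gam `&` hull T) (Phi T X),
        forall (T T' : tet R) (A A' : {set 'I_4}), act T -> act T' ->
          #|A| = 3%N -> #|A'| = 3%N -> hull_on T A = hull_on T' A' ->
          (hull_on T A `&` Gam) !=set0 ->
          forall X, (Gam_h `&` hull_on T A) X -> Phi T X = Phi T' X &
        exists Phi_h : 'rV[R]_3 -> 'rV[R]_3,
          [/\ forall T X, act T -> (Gam_h `&` hull T) X -> Phi_h X = Phi T X,
              {within Gam_h, continuous Phi_h},
              set_bij Gam_h Gam Phi_h,
              exists Psi : 'rV[R]_3 -> 'rV[R]_3,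
                [/\ {within Gam, continuous Psi},
                    forall X, Gam_h X -> Psi (Phi_h X) = X &
                    forall Y, Gam Y -> Gam_h (Psi Y) /\ Phi_h (Psi Y) = Y] &
              forall r : nat, (1 <= r)%N ->
                lifted_space U F (Th j) lab Phi_h r `<=` H1 Gam]].
Proof.
have [oU _ _ _ _] := hU; have [_ cGam _ _] := hGam.
have [h0 [h00 cut_act]] := active_cut_tet oU hF hGam hTh hadm.
exists h0 => // j lab jh hlab hconf hcov Gam act Gam_h Phi.
have {}cut_act T : act T -> cut_tet U F T by exact: cut_act.
pose N := normalized lab; pose Ts := N @` act.
have hullN T : act T -> hull (N T) = hull T.
  by move=> aT; apply: hull_relabel; case: (cut_act T aT).
have ActN T : act T -> Ts (N T) by move=> aT; exists T.
have cutTs T : Ts T -> cut_tet U F T.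
  by move=> [T0 aT <-]; apply: cut_tet_relabel; exact: cut_act.
have normTs T : Ts T -> normal_position F T.
  by move=> [T0 aT <-]; apply: hlab => //; exact: exists_normal_position (cut_act _ aT).
have finTs : finite_set Ts.
  by apply: finite_image; apply: sub_finite_set (finite_seq (Th j)) => T [].
have confTs T T' : Ts T -> Ts T' -> T = T' \/
  exists A A' : {set 'I_4}, [/\ A != [set: 'I_4]%SET,
    hull T `&` hull T' = hull_on T A & hull T `&` hull T' = hull_on T' A'].
  move=> [T0 a0 <-] [T1 a1 <-]; have [->|T01] := eqVneq T0 T1; [by left|right].
  have [A [A' [EA EA']]] := hconf T0 T1 a0 a1.
  have [n0 n1] : Defs.nondegenerate T0 /\ Defs.nondegenerate T1.
    by case: (cut_act _ a0); case: (cut_act _ a1).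
  have dis : interior (hull T0) `&` interior (hull T1) = set0.
    by have [_ _] := hTh j; apply; [case: a0|case: a1|exact/eqP].
  have [B BT EB] := face_relabel (lab T0) n0 (distinct_cells n0 dis EA).
  have AT' : A' != [set: 'I_4]%SET.
    by apply: (distinct_cells (T' := T0) n1); rewrite setIC.
  have [B' _ EB'] := face_relabel (lab T1) n1 AT'.
  by exists B, B'; rewrite !hullN// -EB -EB'.
have hTs : cut_complex U F Ts by split.
have coverTs Y : Gam Y -> exists2 T, Ts T & hull T Y.
  by move=> /hcov[T aT TY]; exists (N T); [exact: ActN|rewrite hullN].
have Gam_hE : Gam_h = \bigcup_(T in Ts) linear_patch U F T.
  apply/seteqP; split => X.
    by move=> [K [T aT TK] KX]; exists (N T); [exact: ActN|exists K].
  by move=> [_ [T aT <-] [K TK KX]]; exists K => //; exists T.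
have Gam_h_patch T X : act T -> Gam_h X -> hull T X -> linear_patch U F (N T) X.
  rewrite Gam_hE => aT [T' hT' pX] TX.
  by apply: (patch_transfer hTs hT' (ActN _ aT) pX); rewrite hullN.
have PhiP T X : act T -> Gam_h X -> hull T X -> lift_rel U F Ts X (Phi T X).
  move=> aT GX TX; apply: (lift_rel_Phi hTs (ActN _ aT)).
  exact: Gam_h_patch.
have [Phi_h [Psi [Phi_hP PsiP cPhi cPsi]]] :=
  lift_homeomorphism hTs finTs cGam coverTs.
rewrite -Gam_hE in Phi_hP cPhi.
have liftG X Y : lift_rel U F Ts X Y -> Gam_h X /\ Gam Y.
  by rewrite Gam_hE => -[T [hT pX GY _]]; split => //; exists T.
have fun_lift X Y Y' := @lift_rel_fun _ _ _ _ hTs X Y Y'.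
have inj_lift X X' Y := @lift_rel_inj _ _ _ _ hTs X X' Y.
split.
- by move=> T aT; apply: cut_well_posed; [exact: cutTs (ActN _ aT)|exact: normTs (ActN _ aT)].
- move=> T X aT [GX TX]; have XY := PhiP T X aT GX TX; split; first by case: (liftG _ _ XY).
  have NX : hull (N T) X by rewrite hullN.
  have [_ _ + _ _] := lift_rel_local hTs XY (ActN _ aT) (or_introl NX).
  by rewrite hullN.
- move=> T T' A A' aT aT' _ _ EA _ X [GX AX].
  apply: (fun_lift X); apply: PhiP => //; first exact: hull_on_sub AX.
  by apply: (@hull_on_sub _ _ A'); rewrite -EA.
exists Phi_h; split => //.
- by move=> T X aT [GX TX]; apply: (fun_lift X); [exact: Phi_hP|exact: PhiP].
- split.
  + by move=> X GX; have [] := liftG _ _ (Phi_hP X GX).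
  + move=> X X'; rewrite !inE => GX GX' XX'; apply: (inj_lift _ _ (Phi_h X)).
      exact: Phi_hP.
    by rewrite XX'; exact: Phi_hP.
  + move=> Y GY; exists (Psi Y); first by have [] := liftG _ _ (PsiP Y GY).
    by apply: (fun_lift (Psi Y)); [apply: Phi_hP; have [] := liftG _ _ (PsiP Y GY)|exact: PsiP].
- exists Psi; split => //.
    move=> X GX; apply: (inj_lift _ _ (Phi_h X)); last exact: Phi_hP.
    by apply: PsiP; have [] := liftG _ _ (Phi_hP X GX).
  move=> Y GY; have [GX _] := liftG _ _ (PsiP Y GY); split => //.
  by apply: (fun_lift (Psi Y)); [exact: Phi_hP|exact: PsiP].
- move=> r _ f [phi [_ phiP] fE].
  apply: (lifted_H1 hTs finTs cGam cPsi PsiP coverTs (r := r) (phi := phi)).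
    by move=> _ K [T aT <-] TK; apply: phiP; exists T.
  move=> Y GY; have [GX _] := liftG _ _ (PsiP Y GY); rewrite -fE//.
  by congr f; apply: (fun_lift (Psi Y)); [exact: PsiP|exact: Phi_hP].
Qed.
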